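(* Let $f,g:\mathbb{C}\to\widehat{\mathbb{C}}$ be commuting transcendental meromorphic functions with finitely many poles. Let $z\in\mathbb{C}$ be a point that is escaping but not fast escaping under $f$ (that is, $f^n(z)$ is defined for all $n$, $f^n(z)\to\infty$ as $n\to\infty$, and $z\notin A(f)$). Then $g(z)\notin A(f)$.
   Context: A transcendental meromorphic function is a meromorphic function $f:\mathbb{C}\to\widehat{\mathbb{C}}=\mathbb{C}\cup\{\infty\}$ with an essential singularity at $\infty$ (entire functions are allowed); $f$ is undefined at $\infty$, and $f^n(z)$ is defined when $z,f(z),\dots,f^{n-1}(z)\in\mathbb{C}$. Two meromorphic functions $f,g$ commute if, for every $z\in\mathbb{C}$, either $f(g(z))=g(f(z))$ or neither $f(g(z))$ nor $g(f(z))$ is defined. Fast escaping set. For a Jordan curve $\gamma\subset\mathbb{C}$, its outer set is the closure of the unbounded component of $\mathbb{C}\setminus\gamma$. Let $f$ be a transcendental meromorphic function with at most finitely many poles. A sequence of Jordan curves $(\gamma_n)_{n\in\mathbb{N}}$ with associated outer sets $(E_n)_{n\in\mathbb{N}}$ is an outer sequence for $f$ if: (i) there exists $r>0$ such that all poles of $f$ lie in $\{|z|<r\}$ and every $\gamma_n$ surrounds $\{|z|=r\}$; (ii) $\mathrm{dist}(0,\gamma_n)\to+\infty$ as $n\to+\infty$; (iii) $\gamma_{n+1}\subset f(\gamma_n)$ for all $n\ge 1$; (iv) for all $n\ge 1$, each component of $f^{-1}(E_{n+1})$ lies either in $E_n$ or in $\{|z|<r\}$. It is known that every such $f$ has an outer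 sequence. The fast escaping set is $$A(f)=\{z\in\mathbb{C}:\text{ there exists } l\in\mathbb{N}\text{ such that } f^{n+l}(z)\in E_n\text{ for all } n\in\mathbb{N}\},$$ where $(E_n)$ is an outer sequence for $f$; it is known that $A(f)$ does not depend on the choice of outer sequence. *)

(* Defs.v *)
From HB Require Import structures.
From mathcomp Require Import all_boot all_order all_algebra.
From mathcomp Require Import all_classical all_reals all_analysis.
From mathcomp.real_closed Require Import complex.
Set Implicit Arguments.
Unset Strict Implicit.
Unset Printing Implicit Defensive.
Import Order.TTheory GRing.Theory Num.Theory.
Import numFieldNormedType.Exports.
Local Open Scope classical_set_scope.
Local Open Scope complex_scope.
Local Open Scope ring_scope.

HB.instance Definition _ (R : rcfType) := NormedModule.copy R[i] R[i]^o.

(* The Riemann sphere: [Some w] is the finite point w, [None] is infinity. *)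
Notation sphere R := (one_point_compactification R[i]).

Section Meromorphic.
Variable R : realType.
Implicit Types (f g : R[i] -> sphere R) (z a : R[i]).

(* The modulus as an element of R; the library norm [`|z|] lives in R[i]. *)
Definition cmod z : R := complex.Re `|z|.

Definition at_infty : set_system R[i] :=
  [set A | exists M : R, forall z, M < cmod z -> A z].

Definition infinity : sphere R := None.

(* The default value 0 is irrelevant: f is required to be finite near a. *)
Definition holomorphic_at f a : Prop :=
  \forall w \near a, f w <> infinity /\
    derivable (fun x : R[i] => odflt 0 (f x) : R[i]) w 1.

Definition pole f a : Prop :=
  [/\ f a = infinity,
      \forall w \near a^', holomorphic_at f w &
      f w @[w --> a^'] --> infinity].

Definition meromorphic f : Prop := forall a, holomorphic_at f a \/ pole f a.

(* The singularity at infinity is neither removable nor a pole, i.e. f has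
   no limit in the sphere, finite or infinite. *)
Definition essential_singularity_at_infty f : Prop :=
  ~ exists l : sphere R, f w @[w --> at_infty] --> l.

Definition transcendental_meromorphic f : Prop :=
  meromorphic f /\ essential_singularity_at_infty f.

Definition finitely_many_poles f : Prop := finite_set [set a | pole f a].

(* Outer [None]: undefined.  [Some infinity] is a legitimate value, to which
   no further map can be applied. *)
Definition papply f (v : option (sphere R)) : option (sphere R) :=
  if v is Some (Some w) then Some (f w) else None.

Definition commuting f g : Prop :=
  forall z, papply f (Some (g z)) = papply g (Some (f z)).

Definition iterate f (n : nat) z : option (sphere R) :=
  iter n (papply f) (Some (Some z)).

Definition escaping f z : Prop :=
  exists u : nat -> R[i],
    (forall n, iterate f n z = Some (Some (u n))) /\ u n @[n --> \oo] --> at_infty.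

Definition jordan_curve (gamma : set R[i]) : Prop :=
  exists c : R -> R[i],
    [/\ {within `[0, 1], continuous c},
        c 0 = c 1,
        {in `[0, 1[ &, injective c} &
        gamma = c @` `[0, 1]].

(* The complement of a Jordan curve has a unique unbounded component, so this
   set is the closure of that component. *)
Definition outer_set (gamma : set R[i]) : set R[i] :=
  closure [set z | (~` gamma) z /\
                   ~ bounded_set (connected_component (~` gamma) z)].

Definition surrounds (gamma S : set R[i]) : Prop :=
  S `<=` [set z | (~` gamma) z /\
                  bounded_set (connected_component (~` gamma) z)].

Definition dist0 (S : set R[i]) : R := inf (cmod @` S).

(* Sequences are indexed by the positive integers: the value at 0 is ignored. *)
Definition outer_sequence f (gamma : nat -> set R[i]) : Prop :=
  (forall n, (1 <= n)%N -> jordan_curve (gamma n)) /\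
  exists r : R,
  [/\ [/\ 0 < r,
          forall a, pole f a -> cmod a < r &
          forall n, (1 <= n)%N -> surrounds (gamma n) [set z | cmod z = r]],
      dist0 (gamma n) @[n --> \oo] --> +oo,
      forall n, (1 <= n)%N -> Some @` gamma n.+1 `<=` f @` gamma n &
      forall n, (1 <= n)%N ->
        let P := f @^-1` (Some @` outer_set (gamma n.+1)) in
        forall z, P z ->
          connected_component P z `<=` outer_set (gamma n) \/
          connected_component P z `<=` [set w | cmod w < r]].

(* The set does not depend on the choice of the outer sequence gamma for f. *)
Definition fast_escaping f (gamma : nat -> set R[i]) : set R[i] :=
  [set z | exists l : nat, (1 <= l)%N /\
     forall n, (1 <= n)%N ->
       exists2 w, iterate f (n + l) z = Some (Some w) & outer_set (gamma n) w].

End Meromorphic.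

(* Main.v *)
Require Import Defs.
From mathcomp Require Import all_boot all_order all_algebra.
From mathcomp Require Import all_classical all_reals all_analysis.
From mathcomp.real_closed Require Import complex.
From mathcomp Require Import ring lra zify.
Set Implicit Arguments.
Unset Strict Implicit.
Unset Printing Implicit Defensive.
Import Order.TTheory GRing.Theory Num.Theory.
Import numFieldNormedType.Exports.
Local Open Scope classical_set_scope.
Local Open Scope complex_scope.
Local Open Scope ring_scope.

(* Let u n = f^n z.  If g z is fast escaping then g (u (n + l)) lies in the outer
   set E_n for some l, whereas z not being fast escaping puts u (n + l + j) in the
   complement of E_n for every j and all large n.  So on the complement of E_n, g
   takes values as large as E_(n + j), for every j.  This is contradicted by
   comparing growth rates.  Write M and N for the maximum moduli of f and g outside
   a disc containing all poles.

   Polya's lemma, proved here for f with finitely many poles: the image under f of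
   an annulus of outer radius 8 x meets every continuum crossing rho <= |w| <= 2 rho,
   where rho = M x / K.  Applied to outer sets it gives |E_(n+1)| >= M (d / 64) / K
   when |E_n| >= d.  Applied to a continuum on which |g| is about N rho it gives a
   point a with |a| <= 8 x, f a on that continuum, hence f (g a) = g (f a) large.
   Then either g a is far out, so that N rho <= 2 M (N (8 x)), or g a is very close
   to a pole p of f.  In the second case the component of {|g - p| small} at a
   contains no zero of g - p, hence crosses a dyadic annulus, and a two-constants
   estimate bounds |g - p| from below there by a power of N (64 x); so N rho is at
   most a power of N (64 x), which M (N (64 x)) dominates since f is transcendental.
   In all cases N (M x / K) <= 2 M (N (64 x)), and iterating this together with
   M (2 y) >= L M y shows that N cannot outgrow the iterates of M by more than a
   fixed number of steps.

   All the complex analysis follows from the maximum principle, which is derived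
   from Goursat's bisection argument for trapezoid sums. *)

(** The curves of an outer sequence have no prescribed shape: their size is bounded above only
    through gamma_(n+1) being contained in f(gamma_n), and that of the outer sets below only through
    the condition on preimages, by Polya's lemma. The two bounds are iterates of different maps, H y
    = 2 M y and Phi y = M (y / 64) / K. Doubling with L = 256 K makes them comparable, as Phi (128
    y) >= 128 H y, and the growth inequality says that N o Phi <= H o N, a form that can be
    iterated. The factor 64 is 8 * 8: one 8 is the covering annulus, the other the outer circle of
    the two-constants estimate around a point of modulus at most 8 x. Polya's lemma and the estimate
    near poles use the same two-constants theorem; in the first it is applied to the product of the
    1 / (1 - f / y) over points y of the continuum that f is supposed to miss. Separation constants
    obtained by compactness are not quantitative, but each enters a product of many factors only
    once, so it is lost when the number of factors grows. *)

Section Modulus.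
Variable R : realType.
Implicit Types (z w a : R[i]) (x e : R).

Lemma cmodE z : cmod z = ComplexField.Normc.normc z.
Proof. by []. Qed.

Lemma normC_cmod z : `|z| = (cmod z)%:C.
Proof. by []. Qed.

Lemma cmod_ge0 z : 0 <= cmod z.
Proof. by case: z => u v; exact: sqrtr_ge0. Qed.

Lemma cmod0 : cmod (0 : R[i]) = 0.
Proof. by rewrite cmodE ComplexField.Normc.normc0. Qed.

Lemma cmod1 : cmod (1 : R[i]) = 1.
Proof. by rewrite cmodE ComplexField.Normc.normc1. Qed.

Lemma cmodM z w : cmod (z * w) = cmod z * cmod w.
Proof. by rewrite !cmodE ComplexField.Normc.normcM. Qed.

Lemma cmodV z : cmod z^-1 = (cmod z)^-1.
Proof. by rewrite !cmodE ComplexField.Normc.normcV. Qed.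

Lemma cmodN z : cmod (- z) = cmod z.
Proof. by rewrite !cmodE normcN. Qed.

Lemma cmodD z w : cmod (z + w) <= cmod z + cmod w.
Proof. by rewrite !cmodE le_normcD. Qed.

Lemma cmodBC z w : cmod (z - w) = cmod (w - z).
Proof. by rewrite -cmodN opprB. Qed.

Lemma cmodB z w : cmod (z - w) <= cmod z + cmod w.
Proof. by rewrite -(cmodN w) cmodD. Qed.

Lemma cmod_sub z w : cmod z - cmod w <= cmod (z - w).
Proof. by rewrite lerBlDr -{1}(subrK w z) cmodD. Qed.

Lemma cmod_dist z w : `|cmod z - cmod w| <= cmod (z - w).
Proof. by rewrite ler_norml cmod_sub andbT lerNl opprB cmodBC cmod_sub. Qed.

Lemma cmod_tri w z a : cmod (z - a) <= cmod (z - w) + cmod (w - a).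
Proof. by have := cmodD (z - w) (w - a); rewrite addrA subrK. Qed.

Lemma cmodX z n : cmod (z ^+ n) = cmod z ^+ n.
Proof. by elim: n => [|n IH]; rewrite ?expr0 ?cmod1// !exprS cmodM IH. Qed.

Lemma cmod_div z w : cmod (z / w) = cmod z / cmod w.
Proof. by rewrite cmodM cmodV. Qed.

Lemma cmod_prod I (s : seq I) (F : I -> R[i]) :
  cmod (\prod_(i <- s) F i) = \prod_(i <- s) cmod (F i).
Proof. by elim: s => [|i s IH]; rewrite ?big_nil ?cmod1// !big_cons cmodM IH. Qed.

Lemma cmod_eq0 z : (cmod z == 0) = (z == 0).
Proof.
apply/eqP/eqP => [h|->]; last exact: cmod0.
exact: ComplexField.Normc.eq0_normc h.
Qed.

Lemma cmod_gt0 z : (0 < cmod z) = (z != 0).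
Proof. by rewrite lt_def cmod_ge0 andbT cmod_eq0. Qed.

Lemma cmod_real x : cmod x%:C = `|x|.
Proof. by rewrite /cmod normc_def /= expr0n /= addr0 sqrtr_sqr. Qed.

Lemma cmod_i : cmod ('i : R[i]) = 1.
Proof. by rewrite /cmod normc_def /= expr0n /= add0r expr1n sqrtr1. Qed.

Lemma Re_cmod z : `|complex.Re z| <= cmod z.
Proof. by case: z => u v; rewrite cmodE /= -sqrtr_sqr ler_wsqrtr// lerDl sqr_ge0. Qed.

Lemma Im_cmod z : `|complex.Im z| <= cmod z.
Proof. by case: z => u v; rewrite cmodE /= -sqrtr_sqr ler_wsqrtr// lerDr sqr_ge0. Qed.

Lemma cmod_ReIm z : cmod z <= `|complex.Re z| + `|complex.Im z|.
Proof.
rewrite [z in X in X <= _]complexE; apply: le_trans (cmodD _ _) _.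
by rewrite cmodM cmod_i mul1r !cmod_real.
Qed.

(** * Topology of the plane through the real modulus *)

Lemma nbhs_cmod a (A : set R[i]) :
  nbhs a A <-> exists2 e, 0 < e & forall z, cmod (z - a) < e -> A z.
Proof.
split.
  move=> /nbhs_ballP[[e i] /=]; rewrite ltcE /= => /andP[/eqP -> e0] sub.
  exists e => // z za; apply: sub; rewrite -ball_normE /= normC_cmod ltcE /= eqxx /=.
  by rewrite cmodBC.
move=> [e e0 sub]; apply/nbhs_ballP; exists e%:C => /=; first by rewrite ltcE /= eqxx.
move=> z; rewrite -ball_normE /= normC_cmod ltcE /= eqxx /= cmodBC; exact: sub.
Qed.

Lemma closure_cmod (A : set R[i]) a :
  closure A a <-> forall e, 0 < e -> exists2 z, A z & cmod (z - a) < e.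
Proof.
split=> [cl e e0|h B /nbhs_cmod[e e0 sub]].
  have [|z [Az ze]] := cl [set z | cmod (z - a) < e]; last by exists z.
  by apply/nbhs_cmod; exists e.
by have [z Az ze] := h e e0; exists z; split => //; exact: sub.
Qed.

Lemma open_cmod (A : set R[i]) :
  (forall a, A a -> exists2 e, 0 < e & forall z, cmod (z - a) < e -> A z) ->
  open A.
Proof. by move=> h; rewrite openE => a /h /nbhs_cmod. Qed.

Lemma bounded_cmod (A : set R[i]) :
  bounded_set A <-> exists M, forall z, A z -> cmod z <= M.
Proof.
split.
  move=> [[M i] /= [Mr H]].
  exists (M + 1) => z Az; move: Mr; rewrite complex_real => /= /eqP i0; subst i.
  have := H (M + 1)%:C; rewrite ltcE /= eqxx ltrDl ltr01 => /(_ isT z Az).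
  by rewrite /= normC_cmod lecE /= eqxx.
move=> [M H]; exists M%:C; split; first by rewrite complex_real.
move=> [x i]; rewrite ltcE /= => /andP[/eqP -> Mx] z Az /=.
by rewrite normC_cmod lecE /= eqxx (le_trans (H _ Az)) ?ltW.
Qed.

Lemma closed_bounded_compact (A : set R[i]) M :
  closed A -> (forall z, A z -> cmod z <= M) -> compact A.
Proof.
move=> cA bA.
pose f (p : R * R) : R[i] := (p.1 +i* p.2).
have cf : continuous f.
  move=> p; apply/cvgrPdist_lt => -[e i] /=; rewrite ltcE /= => /andP[/eqP -> e0].
  have e2 : 0 < e / 2 by rewrite divr_gt0.
  exists ([set x | `|p.1 - x| < e / 2], [set y | `|p.2 - y| < e / 2]) => /=.
    by split; apply/nbhs_ballP; exists (e / 2).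
  move=> [x y] /= [px py]; rewrite normC_cmod ltcE /= eqxx /=.
  apply: le_lt_trans (cmod_ReIm _) _ => /=.
  by rewrite [e]splitr ltrD.
have := @continuous_compact _ _ f (`[-M, M] `*` `[-M, M]) (continuous_subspaceT cf)
  (compact_setX (@segment_compact _ _ _) (@segment_compact _ _ _)).
move=> cc; apply: (subclosed_compact cA cc) => z Az; exists (complex.Re z, complex.Im z); last by case: (z).
have := le_trans (Re_cmod z) (bA _ Az); have := le_trans (Im_cmod z) (bA _ Az).
by rewrite !ler_norml /= !in_itv /=.
Qed.

(** The main compactness device: local thresholds, by a finite cover, give one threshold for the
    whole set. With [n] as a bound, or 1 / (n + 1) as a distance, it yields the boundedness and
    separation constants needed later. *)
Lemma compact_uniform (A : set R[i]) (P : nat -> R[i] -> Prop) : compact A ->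
  (forall a, A a -> exists2 e, 0 < e & exists N, forall n z, (N <= n)%N ->
     cmod (z - a) < e -> P n z) ->
  exists N, forall n z, (N <= n)%N -> A z -> P n z.
Proof.
move=> /compact_near_coveringP cA loc.
have [|N _ H] := cA nat \oo (fun n z => P n z) _.
  move=> a /loc[e e0 [N HN]].
  exists ([set z | cmod (z - a) < e], [set n | (N <= n)%N]) => /=.
    by split; [apply/nbhs_cmod; exists e|exists N].
  by move=> [z n] /= [ze nN]; exact: HN.
by exists N => n z nN Az; exact: H.
Qed.

Lemma compact_max (A : set R[i]) (phi : R[i] -> R) : compact A -> A !=set0 ->
  (forall a, A a -> forall e, 0 < e -> exists2 d, 0 < d & forall z, A z ->
     cmod (z - a) < d -> `|phi z - phi a| < e) ->
  exists2 a, A a & forall z, A z -> phi z <= phi a.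
Proof.
move=> cA A0 cphi.
have [|a /set_mem Aa H] := compact_EVT_max (f := phi) A0 cA.
  apply/subspace_continuousP => a Aa; apply/cvgrPdist_lt => e e0.
  have [d d0 H] := cphi a Aa e e0.
  rewrite near_withinE; apply/nbhs_cmod; exists d => // z zd Az.
  by rewrite distrC; exact: H.
by exists a => // z Az; apply: H; rewrite inE.
Qed.

End Modulus.

(** * Complex differentiability *)

Section Differentiability.
Variable R : realType.
Implicit Types (F G : R[i] -> R[i]) (z w a : R[i]).

(** Caratheodory's form of differentiability: the derivative is [phi a]. Rules for products,
    inverses and compositions become identities between continuous factors, without limits of
    quotients. *)
Definition cdiff F a := exists2 phi : R[i] -> R[i],
  {for a, continuous phi} & \forall z \near a, F z = F a + phi z * (z - a).

Lemma continuous_cmod F a : {for a, continuous F} <->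
  forall e, 0 < e -> exists2 d, 0 < d & forall z, cmod (z - a) < d ->
    cmod (F z - F a) < e.
Proof.
split=> [cF e e0|h].
  have /nbhs_cmod[d d0 H] : nbhs a [set z | cmod (F z - F a) < e].
    by apply: (cF [set w | cmod (w - F a) < e]); apply/nbhs_cmod; exists e.
  by exists d.
move=> A /nbhs_cmod[e e0 H]; have [d d0 H'] := h e e0.
by apply/nbhs_cmod; exists d => // z /H'/H.
Qed.

Lemma cts_cst (c a : R[i]) : {for a, continuous (fun _ : R[i] => c)}.
Proof. by apply/continuous_cmod => e e0; exists 1 => // z _; rewrite subrr cmod0. Qed.

Arguments cts_cst : clear implicits.

Lemma ctsD F G a : {for a, continuous F} -> {for a, continuous G} ->
  {for a, continuous (fun z => F z + G z)}.
Proof. by move=> cF cG; exact: (@cvgD _ _ _ _ _ F G _ _ cF cG). Qed.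

Lemma ctsM F G a : {for a, continuous F} -> {for a, continuous G} ->
  {for a, continuous (fun z => F z * G z)}.
Proof. by move=> cF cG; exact: (@cvgM _ _ _ _ F G _ _ cF cG). Qed.

Lemma ctsN F a : {for a, continuous F} -> {for a, continuous (fun z => - F z)}.
Proof. by move=> cF; exact: (@cvgN _ _ _ _ _ F _ cF). Qed.

Lemma ctsV F a : {for a, continuous F} -> F a != 0 ->
  {for a, continuous (fun z => (F z)^-1)}.
Proof. by move=> cF Fa0; exact: (@cvgV _ _ _ _ F _ Fa0 cF). Qed.

Lemma cdiff_cts F a : cdiff F a -> {for a, continuous F}.
Proof.
move=> [phi cphi near_eq].
have cid : {for a, continuous (fun z : R[i] => z)} by exact: cvg_id.
have lim := ctsD (cts_cst (F a) a) (ctsM cphi (ctsD cid (cts_cst (- a) a))).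
move=> A; have := lim A; rewrite subrr mulr0 addr0 => {}lim /lim => h.
move: near_eq h => /nbhs_cmod[d d0 H1] /nbhs_cmod[e e0 H2].
apply/nbhs_cmod; exists (Num.min d e); first by rewrite lt_min d0.
by move=> z; rewrite lt_min => /andP[/H1 eqz /H2] /=; rewrite -eqz.
Qed.

Lemma cdiff_cst (c a : R[i]) : cdiff (fun=> c) a.
Proof. by exists (fun=> 0); [exact: cts_cst|near=> z; rewrite mul0r addr0]. Unshelve. all: by end_near. Qed.

Lemma cdiff_id a : cdiff id a.
Proof. by exists (fun=> 1); [exact: cts_cst|near=> z; rewrite mul1r addrC subrK]. Unshelve. all: by end_near. Qed.

Lemma cdiffD F G a : cdiff F a -> cdiff G a -> cdiff (fun z => F z + G z) a.
Proof.
move=> [phi cphi ephi] [psi cpsi epsi]; exists (fun z => phi z + psi z).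
  exact: ctsD.
near=> z; rewrite (near ephi z)// (near epsi z)//; ring.
Unshelve. all: by end_near. Qed.

Lemma cdiffM F G a : cdiff F a -> cdiff G a -> cdiff (fun z => F z * G z) a.
Proof.
move=> dF dG; have cF := cdiff_cts dF.
move: dF dG => [phi cphi ephi] [psi cpsi epsi].
exists (fun z => phi z * G a + F z * psi z).
  exact: (ctsD (ctsM cphi (cts_cst (G a) a)) (ctsM cF cpsi)).
near=> z; rewrite [G z](near epsi z)// mulrDr mulrDl !addrA; congr (_ + _); last by rewrite mulrA.
rewrite (near ephi z)//; ring.
Unshelve. all: by end_near. Qed.

Lemma cdiffN F a : cdiff F a -> cdiff (fun z => - F z) a.
Proof.
move=> dF; have := cdiffM (cdiff_cst (-1) a) dF.
by under eq_fun do rewrite mulN1r.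
Qed.

Lemma cdiffB F G a : cdiff F a -> cdiff G a -> cdiff (fun z => F z - G z) a.
Proof. by move=> dF dG; apply: cdiffD => //; exact: cdiffN. Qed.

Lemma cdiffV F a : cdiff F a -> F a != 0 -> cdiff (fun z => (F z)^-1) a.
Proof.
move=> dF Fa0; have cF := cdiff_cts dF; move: dF => [phi cphi ephi].
exists (fun z => - phi z * (F z)^-1 * (F a)^-1).
  exact: (ctsM (ctsM (ctsN cphi) (ctsV cF Fa0)) (cts_cst (F a)^-1 a)).
have F0 : \forall z \near a, F z != 0.
  have Fa_gt0 : 0 < cmod (F a) by rewrite cmod_gt0.
  have [d d0 H] := (continuous_cmod F a).1 cF _ Fa_gt0.
  apply/nbhs_cmod; exists d => // z /H; apply: contraTneq => ->.
  by rewrite sub0r cmodN ltxx.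
near=> z; have Fz0 : F z != 0 by near: z.
apply: (mulfI Fz0); rewrite mulfV// mulrDr !mulNr mulrN.
rewrite !mulrA [F z * phi z]mulrC mulfK// {1}(near ephi z)// mulrDl mulfV//.
by rewrite -addrA mulrAC subrr addr0.
Unshelve. all: by end_near. Qed.

Lemma cdiffX F n a : cdiff F a -> cdiff (fun z => F z ^+ n) a.
Proof.
move=> dF; elim: n => [|n IH]; first exact: cdiff_cst.
by under eq_fun do rewrite exprS; exact: cdiffM.
Qed.

Lemma cdiff_prod m (F : nat -> R[i] -> R[i]) a :
  (forall l, (l < m)%N -> cdiff (F l) a) ->
  cdiff (fun z => \prod_(0 <= l < m) F l z) a.
Proof.
elim: m => [|m IH] dF; first by under eq_fun do rewrite big_geq//; exact: cdiff_cst.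
under eq_fun do rewrite big_nat_recr//=.
by apply: cdiffM; [apply: IH => l lm; apply: dF; exact: ltnW|exact: dF].
Qed.

Lemma cdiff_comp F G a : cdiff G a -> cdiff F (G a) -> cdiff (fun z => F (G z)) a.
Proof.
move=> dG; have cG := cdiff_cts dG; move: dG => [psi cpsi epsi] [phi cphi ephi].
exists (fun z => phi (G z) * psi z).
  exact: (ctsM (continuous_comp cG cphi) cpsi).
near=> z; have -> : F (G z) = F (G a) + phi (G z) * (G z - G a).
  by near: z; exact: (cG _ ephi).
by rewrite {2}(near epsi z)// addrAC subrr add0r mulrA.
Unshelve. all: by end_near. Qed.


Lemma cdiff_eps F a : cdiff F a -> exists l, forall e, 0 < e ->
  exists2 d, 0 < d & forall z, cmod (z - a) < d ->
    cmod (F z - (F a + l * (z - a))) <= e * cmod (z - a).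
Proof.
move=> [phi /continuous_cmod cphi /nbhs_cmod[d1 d10 H1]]; exists (phi a) => e e0.
have [d2 d20 H2] := cphi e e0; exists (Num.min d1 d2); first by rewrite lt_min d10.
move=> z; rewrite lt_min => /andP[z1 z2]; rewrite H1//.
rewrite (_ : _ - _ = (phi z - phi a) * (z - a)); last by ring.
by rewrite cmodM ler_wpM2r ?cmod_ge0// ltW// H2.
Qed.

End Differentiability.

(** * Goursat's lemma *)

Section Goursat.
Variable R : realType.
Implicit Types (F G : R[i] -> R[i]) (z w a c p q h : R[i]) (s e : R).

(* Composite trapezoid sums over 2^n equal pieces replace the integral of F along
   [p, q]: they are exact on affine functions and additive under bisection. *)
Fixpoint trap F n p q : R[i] :=
  if n is m.+1 then trap F m p ((p + q) / 2) + trap F m ((p + q) / 2) q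
  else (F p + F q) / 2 * (q - p).

Lemma trapC F n p q : trap F n q p = - trap F n p q.
Proof.
elim: n p q => [|n IH] p q /=; first by rewrite [F q + _]addrC -mulrN opprB.
by rewrite [q + p]addrC (IH _ q) (IH p) -opprD [X in - X]addrC.
Qed.

Lemma trapD F G n p q :
  trap (fun z => F z + G z) n p q = trap F n p q + trap G n p q.
Proof.
elim: n p q => [|n IH] p q /=; last by rewrite !IH addrACA.
by rewrite -mulrDl -mulrDl addrACA.
Qed.

Lemma trap_affine (u l : R[i]) n p q :
  trap (fun z => u + l * z) n p q = (u + l * ((p + q) / 2)) * (q - p).
Proof.
elim: n p q => [|n IH] p q /=; first by field.
by rewrite !IH; field.
Qed.

Definition seg p q (t : R) : R[i] := p + t%:C * (q - p).

Lemma segL p q t : seg p ((p + q) / 2) t = seg p q (t / 2).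
Proof. by rewrite /seg rmorphM fmorphV rmorph_nat; field. Qed.

Lemma segR p q t : seg ((p + q) / 2) q t = seg p q ((1 + t) / 2).
Proof. by rewrite /seg rmorphM rmorphD rmorph1 fmorphV rmorph_nat; field. Qed.

Lemma seg0 p q : seg p q 0 = p.
Proof. by rewrite /seg mul0r addr0. Qed.

Lemma seg1 p q : seg p q 1 = q.
Proof. by rewrite /seg mul1r addrC subrK. Qed.

Lemma cmod_half z : cmod (z / 2) = cmod z / 2.
Proof.
by rewrite cmod_div; congr (_ / _); rewrite -(rmorph_nat (real_complex R) 2) cmod_real ger0_norm.
Qed.

Lemma trap_bound F n p q e : (forall t, 0 <= t <= 1 -> cmod (F (seg p q t)) <= e) ->
  cmod (trap F n p q) <= e * cmod (q - p).
Proof.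
elim: n p q => [|n IH] p q H /=.
  rewrite cmodM ler_wpM2r ?cmod_ge0// cmod_half ler_pdivrMr// mulr_natr mulr2n.
  apply: le_trans (cmodD _ _) _.
  have := H 0; have := H 1; rewrite seg0 seg1 !lexx ler01 /=.
  by move=> H1 H0; rewrite lerD ?H0 ?H1.
apply: le_trans (cmodD _ _) _.
rewrite [cmod (q - p)]splitr mulrDr -cmod_half lerD//.
  rewrite (_ : (q - p) / 2 = (p + q) / 2 - p); last by field.
  by apply: IH => t t01; rewrite segL; apply: H; lra.
rewrite (_ : (q - p) / 2 = q - (p + q) / 2); last by field.
by apply: IH => t t01; rewrite segR; apply: H; lra.
Qed.

Lemma ImD z w : complex.Im (z + w) = complex.Im z + complex.Im w.
Proof. by case: z; case: w. Qed.

Lemma ReD z w : complex.Re (z + w) = complex.Re z + complex.Re w.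
Proof. by case: z; case: w. Qed.

Lemma Im_half z : complex.Im (z / 2) = complex.Im z / 2.
Proof.
rewrite -(rmorph_nat (real_complex R) 2) -fmorphV; case: z => x y /=.
by rewrite mulr0 add0r.
Qed.

Lemma trap_Im_lower F n p q e :
  (forall t, 0 <= t <= 1 -> e <= complex.Im (F (seg p q t) * (q - p))) ->
  e <= complex.Im (trap F n p q).
Proof.
elim: n p q e => [|n IH] p q e H /=.
  rewrite mulrAC Im_half mulrDl ImD ler_pdivlMr// mulr_natr mulr2n.
  have := H 0; have := H 1; rewrite seg0 seg1 !lexx ler01 /=.
  by move=> H1 H0; rewrite lerD ?H0 ?H1.
rewrite ImD [e]splitr lerD//; apply: IH => t t01.
  rewrite (_ : (p + q) / 2 - p = (q - p) / 2); last by field.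
  by rewrite mulrA Im_half ler_pM2r// segL H//; lra.
rewrite (_ : q - (p + q) / 2 = (q - p) / 2); last by field.
by rewrite mulrA Im_half ler_pM2r// segR H//; lra.
Qed.

Definition bdry F n c h : R[i] :=
  trap F n c (c + h) + trap F n (c + h) (c + h + 'i * h) +
  trap F n (c + h + 'i * h) (c + 'i * h) + trap F n (c + 'i * h) c.

(** A side of the large square is bisected once, hence [n.+1] against [n]. Each inner edge belongs
    to two small squares with opposite orientations and cancels by [trapC]. *)
Lemma bdry_split F n c h : bdry F n.+1 c (h + h) =
  bdry F n c h + bdry F n (c + h) h + bdry F n (c + h + 'i * h) h +
  bdry F n (c + 'i * h) h.
Proof.
rewrite /bdry /= !mulrDr !addrA.
move: ('i * h) => k.
have -> : (c + c + h + h) / 2 = c + h by field.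
have -> : (c + h + h + c + h + h + k + k) / 2 = c + h + h + k by field.
have -> : (c + h + h + k + k + c + k + k) / 2 = c + h + k + k by field.
have -> : (c + k + k + c) / 2 = c + k by field.
have -> : c + h + k + h = c + h + h + k by ring.
have -> : c + k + h = c + h + k by ring.
rewrite [trap F n (c + k) (c + h + k)]trapC.
rewrite [trap F n (c + h + k) (c + h)]trapC.
rewrite [trap F n (c + h + h + k) (c + h + k)]trapC.
rewrite [trap F n (c + h + k + k) (c + h + k)]trapC.
ring.
Qed.

Lemma bdryD F G n c h : bdry (fun z => F z + G z) n c h = bdry F n c h + bdry G n c h.
Proof. by rewrite /bdry !trapD; ring. Qed.

Lemma bdry_affine (u l : R[i]) n c h : bdry (fun z => u + l * z) n c h = 0.
Proof. by rewrite /bdry !trap_affine; move: ('i * h) => k; field. Qed.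

Definition square c s : set R[i] := [set z |
  0 <= complex.Re (z - c) <= s /\ 0 <= complex.Im (z - c) <= s].

Definition sqside c s : set R[i] := [set z | square c s z /\
  [\/ complex.Re (z - c) = 0, complex.Re (z - c) = s,
      complex.Im (z - c) = 0 | complex.Im (z - c) = s]].

Lemma sqside_seg c s t : 0 <= t <= 1 -> 0 <= s ->
  [/\ sqside c s (seg c (c + s%:C) t),
      sqside c s (seg (c + s%:C) (c + s%:C + 'i * s%:C) t),
      sqside c s (seg (c + s%:C + 'i * s%:C) (c + 'i * s%:C) t) &
      sqside c s (seg (c + 'i * s%:C) c t)].
Proof.
move=> /andP[t0 t1] s0; case: c => x y; rewrite /sqside /square /seg /=.
have ts0 : 0 <= t * s by rewrite mulr_ge0.
have tss : t * s <= s by rewrite ler_piMl.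
split; split; try (split; lra).
- by constructor 3; lra.
- by constructor 2; lra.
- by constructor 4; lra.
- by constructor 1; lra.
Qed.

Lemma bdry_bound F n c s e : 0 <= s ->
  (forall z, sqside c s z -> cmod (F z) <= e) ->
  cmod (bdry F n c s%:C) <= 4 * (e * s).
Proof.
move=> s0 H; rewrite /bdry.
have side p q : cmod (q - p) = s ->
  (forall t, 0 <= t <= 1 -> sqside c s (seg p q t)) -> cmod (trap F n p q) <= e * s.
  by move=> eqs h; rewrite -eqs; apply: trap_bound => t t01; apply: H; exact: h.
have cs : cmod (s%:C : R[i]) = s by rewrite cmod_real ger0_norm.
have ics : cmod ('i * s%:C : R[i]) = s by rewrite cmodM cmod_i cs mul1r.
have h1 : cmod (trap F n c (c + s%:C)) <= e * s.
  apply: side => [|t t01]; first by rewrite addrAC subrr add0r.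
  by case: (sqside_seg c t01 s0).
have h2 : cmod (trap F n (c + s%:C) (c + s%:C + 'i * s%:C)) <= e * s.
  apply: side => [|t t01]; first by rewrite addrAC subrr add0r.
  by case: (sqside_seg c t01 s0).
have h3 : cmod (trap F n (c + s%:C + 'i * s%:C) (c + 'i * s%:C)) <= e * s.
  apply: side => [|t t01]; last by case: (sqside_seg c t01 s0).
  by rewrite -[RHS]cs -[RHS]cmodN; congr cmod; ring.
have h4 : cmod (trap F n (c + 'i * s%:C) c) <= e * s.
  apply: side => [|t t01]; last by case: (sqside_seg c t01 s0).
  by rewrite -[RHS]ics -[RHS]cmodN; congr cmod; ring.
rewrite (_ : 4 * (e * s) = e * s + e * s + e * s + e * s); last by ring.
do 3 (apply: le_trans (cmodD _ _) _; apply: lerD => //).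
Qed.

Lemma nested_intervals (a s : nat -> R) : (forall k, a k <= a k.+1) ->
  (forall k, a k.+1 + s k.+1 <= a k + s k) -> (forall k, 0 <= s k) ->
  exists x, forall k, a k <= x <= a k + s k.
Proof.
move=> ha hs s0.
have mono_a j k : a j <= a (j + k)%N.
  by elim: k => [|k IH]; rewrite ?addn0// addnS (le_trans IH).
have mono_s j k : a (j + k)%N + s (j + k)%N <= a j + s j.
  by elim: k => [|k IH]; rewrite ?addn0// addnS (le_trans _ IH).
have le_as j k : a j <= a k + s k.
  case: (leqP j k) => [jk|/ltnW kj].
    have := mono_a j (k - j)%N; rewrite subnKC// => h.
    by apply: le_trans h _; rewrite lerDl.
  have := mono_s k (j - k)%N; rewrite subnKC// => h.
  by apply: le_trans h; rewrite lerDl.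
have hsup : has_sup (range a).
  by split; [exists (a 0%N), 0%N|exists (a 0%N + s 0%N) => _ [j _ <-]].
exists (sup (range a)) => k; apply/andP; split.
  by apply: ub_le_sup; [exact: hsup.2|exists k].
by apply: ge_sup; [exact: hsup.1|move=> _ [j _ <-]].
Qed.

(** Four estimates on the quarters add up to the estimate on the square, so a failure passes to some
    quarter. The failing squares shrink to a point, near which [F] is affine up to a small error,
    and affine functions have zero boundary sum. *)
Lemma goursat F c s : 0 < s -> (forall z, square c s z -> cdiff F z) ->
  forall e, 0 < e -> exists n0, forall n, (n0 <= n)%N ->
    cmod (bdry F n c s%:C) <= e * s ^+ 2.
Proof.
move=> s0 dF e e0.
pose P c s := exists n0, forall n, (n0 <= n)%N -> cmod (bdry F n c s%:C) <= e * s ^+ 2.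
have [//|nP] := pselect (P c s).
pose Q c s c' := ~ P c' (s / 2) /\
   (complex.Re c <= complex.Re c' <= complex.Re c + s / 2 /\
    complex.Im c <= complex.Im c' <= complex.Im c + s / 2).
(* The hypotheses stand after the existential, so that [choice] yields a total function. *)
have step d r : exists d', 0 <= r -> ~ P d r -> Q d r d'.
  have [r0|] := pselect (0 <= r); last by exists d.
  have [|nPd] := pselect (P d r); first by exists d.
  have [x1|/contrapT [m1 p1]] := pselect (~ P d (r / 2)).
    by exists d => _ _; split=> //; split; lra.
  have [x2|/contrapT [m2 p2]] := pselect (~ P (d + (r / 2)%:C) (r / 2)).
    by exists (d + (r / 2)%:C) => _ _; split=> //; rewrite ReD ImD /=; split; lra.
  have [x3|/contrapT [m3 p3]] := pselect (~ P (d + (r / 2)%:C + 'i * (r / 2)%:C) (r / 2)).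
    exists (d + (r / 2)%:C + 'i * (r / 2)%:C) => _ _; split=> //.
    by rewrite !ReD !ImD /=; split; lra.
  have [x4|/contrapT [m4 p4]] := pselect (~ P (d + 'i * (r / 2)%:C) (r / 2)).
    by exists (d + 'i * (r / 2)%:C) => _ _; split=> //; rewrite !ReD !ImD /=; split; lra.
  case: nPd; exists (maxn (maxn m1 m2) (maxn m3 m4)).+1 => -[//|n].
  rewrite ltnS !geq_max => /andP[/andP[n1 n2] /andP[n3 n4]].
  have -> : r%:C = (r / 2)%:C + (r / 2)%:C :> R[i] by rewrite -rmorphD -splitr.
  rewrite bdry_split.
  have -> : e * r ^+ 2 = e * (r / 2) ^+ 2 + e * (r / 2) ^+ 2 + e * (r / 2) ^+ 2 + e * (r / 2) ^+ 2.
    by field.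
  by do 3 (apply: le_trans (cmodD _ _) _; apply: lerD; last by auto); auto.
have {step} [f Hf] : exists f : R[i] -> R -> R[i], forall d r, 0 <= r -> ~ P d r -> Q d r (f d r).
  have [f Hf] := choice (fun dr : R[i] * R => step dr.1 dr.2).
  by exists (fun d r => f (d, r)) => d r; exact: (Hf (d, r)).
pose s_ k := s / 2 ^+ k.
have s_S k : s_ k.+1 = s_ k / 2 by rewrite /s_ exprS invfM mulrCA mulrC.
have s_ge0 k : 0 <= s_ k by rewrite divr_ge0 ?exprn_ge0// ltW.
pose c_ := fix c_ k := if k is j.+1 then f (c_ j) (s_ j) else c.
have nP_ k : ~ P (c_ k) (s_ k).
  elim: k => [|k IH]; first by rewrite /s_ expr0 divr1.
  by rewrite s_S; case: (Hf _ _ (s_ge0 k) IH).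
have Q_ k : Q (c_ k) (s_ k) (c_ k.+1) by exact: Hf.
have [x Hx] : exists x, forall k, complex.Re (c_ k) <= x <= complex.Re (c_ k) + s_ k.
  apply: nested_intervals => // k; case: (Q_ k) => _ [/andP[A1 A2] _] //.
  by rewrite s_S; lra.
have [y Hy] : exists y, forall k, complex.Im (c_ k) <= y <= complex.Im (c_ k) + s_ k.
  apply: nested_intervals => // k; case: (Q_ k) => _ [_ /andP[A1 A2]] //.
  by rewrite s_S; lra.
have sqxy : square c s (x +i* y).
  have := Hx 0%N; have := Hy 0%N; rewrite /= /s_ expr0 divr1 /square.
  by case: (c) => u v /= ? ?; split; lra.
have [l Hl] := cdiff_eps (dF _ sqxy).
(* Points of the k-th square are within [2 * s_ k] of the limit point, so [e / 8] leads to 4 * (e /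
   8 * 2 s_k) * s_k = e s_k^2. *)
have [d d0 Hd] := Hl (e / 8) (divr_gt0 e0 (ltr0n _ 8)).
have [k Hk] : exists k, 2 * s_ k < d.
  have [k Hk] : exists k, 2 * s / d < k%:R.
    by exists (Num.truncn (2 * s / d)).+1; exact: truncnS_gt.
  exists k; rewrite /s_ mulrA ltr_pdivrMr ?exprn_gt0// -ltr_pdivrMl// mulrC.
  apply: lt_trans Hk _; rewrite -natrX ltr_nat; exact: ltn_expl.
case: (nP_ k); exists 0%N => n _.
pose L := fun z : R[i] => (F (x +i* y) - l * (x +i* y)) + l * z.
have -> : bdry F n (c_ k) (s_ k)%:C = bdry (fun z => F z - L z) n (c_ k) (s_ k)%:C.
  rewrite -[RHS]addr0 -(bdry_affine (F (x +i* y) - l * (x +i* y)) l n (c_ k) (s_ k)%:C).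
  rewrite -bdryD; congr (bdry _ _ _ _); apply/funext => z.
  by rewrite subrK.
have close z : square (c_ k) (s_ k) z -> cmod (z - (x +i* y)) <= 2 * s_ k.
  move=> sqz; apply: le_trans (cmod_ReIm _) _.
  move: sqz (Hx k) (Hy k); rewrite /square; case: (c_ k) => u v; case: z => u' v' /=.
  move=> [/andP[A1 A2] /andP[A3 A4]] /andP[A5 A6] /andP[A7 A8].
  by rewrite mulr_natl mulr2n lerD// ler_norml; lra.
apply: le_trans (_ : 4 * (e / 8 * (2 * s_ k) * s_ k) <= _); last first.
  by rewrite le_eqVlt; apply/orP; left; apply/eqP; field.
apply: bdry_bound => // z [sqz _].
have -> : F z - L z = F z - (F (x +i* y) + l * (z - (x +i* y))) by rewrite /L; ring.
have cz := close z sqz.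
apply: le_trans (Hd _ (le_lt_trans cz Hk)) _.
by rewrite ler_wpM2l// divr_ge0// ltW.
Qed.

End Goursat.

(** * The maximum principle *)

Section MaximumModulus.
Variable R : realType.
Implicit Types (h H F : R[i] -> R[i]) (z w a b c d p q : R[i]) (r s e B M : R).

Lemma expr_small (t e : R) : 0 <= t < 1 -> 0 < e ->
  exists N, forall n, (N <= n)%N -> t ^+ n <= e.
Proof.
move=> /andP[t0 t1] e0.
have ct : (fun n => t ^+ n) @ \oo --> (0 : R) by apply: cvg_expr; rewrite ger0_norm.
have [N _ HN] := (cvgrPdist_le _ _).1 ct e e0.
by exists N => n nN; have := HN n nN; rewrite sub0r normrN ger0_norm ?exprn_ge0.
Qed.

Lemma sqr_cmod z : cmod z ^+ 2 = complex.Re z ^+ 2 + complex.Im z ^+ 2.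
Proof. by rewrite /cmod normc_def /= sqr_sqrtr// addr_ge0 ?sqr_ge0. Qed.

Lemma parallelogram z w :
  cmod (z + w) ^+ 2 + cmod (z - w) ^+ 2 = 2 * cmod z ^+ 2 + 2 * cmod w ^+ 2.
Proof. by rewrite !sqr_cmod; case: z => x y; case: w => x' y' /=; ring. Qed.

Lemma Im_div w d : complex.Im (w^-1 * d) =
  (complex.Im d * complex.Re w - complex.Re d * complex.Im w) / cmod w ^+ 2.
Proof.
rewrite sqr_cmod; case: w => u v; case: d => x y /=; ring.
Qed.

(** The exact integral is 2 pi i; a positive lower bound is all that is used. On each side the
    imaginary part of the integrand times the side vector is 2 r^2 / |w|^2, where |w|^2 <= 2 r^2, so
    each of the four sides contributes at least 1. *)
Lemma Im_bdry_inv a r n : 0 < r -> 4 <= complex.Im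
  (bdry (fun z => (z - a)^-1) n (a - r%:C - 'i * r%:C) (2 * r)%:C).
Proof.
move=> r0; rewrite /bdry !ImD.
have edge p q (dx dy : R) (u v : R -> R) : q - p = dx +i* dy ->
    (forall t, seg p q t - a = u t +i* v t) ->
    (forall t, 0 <= t <= 1 -> 0 < u t ^+ 2 + v t ^+ 2 <= dy * u t - dx * v t) ->
    1 <= complex.Im (trap (fun z => (z - a)^-1) n p q).
  move=> dE sE H; apply: trap_Im_lower => t /H/andP[pos le].
  by rewrite Im_div sE dE sqr_cmod /= ler_pdivlMr// mul1r.
have sq t : 0 <= t <= 1 -> 0 < ((2 * t - 1) * r) ^+ 2 + r ^+ 2 <= 2 * r ^+ 2.
  move=> /andP[t0 t1]; have r2 : 0 < r ^+ 2 by rewrite exprn_gt0.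
  have tt : 0 <= t * (1 - t) * r ^+ 2 by rewrite !mulr_ge0 ?subr_ge0// ltW.
  have := sqr_ge0 ((2 * t - 1) * r).
  by move=> ?; apply/andP; split; lra.
rewrite (_ : 4 = 1 + 1 + 1 + 1); last by ring.
rewrite !lerD//.
- apply: (@edge _ _ (2 * r) 0 (fun t => (2 * t - 1) * r) (fun=> - r)) => [|t|t /sq h].
  + by case: (a) => x y; apply/eqP; rewrite eq_complex /=; apply/andP; split; apply/eqP; ring.
  + by case: (a) => x y; apply/eqP; rewrite eq_complex /=; apply/andP; split; apply/eqP; ring.
  + by move: h => /andP[h1 h2]; apply/andP; split; lra.
- apply: (@edge _ _ 0 (2 * r) (fun=> r) (fun t => (2 * t - 1) * r)) => [|t|t /sq h].
  + by case: (a) => x y; apply/eqP; rewrite eq_complex /=; apply/andP; split; apply/eqP; ring.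
  + by case: (a) => x y; apply/eqP; rewrite eq_complex /=; apply/andP; split; apply/eqP; ring.
  + by move: h => /andP[h1 h2]; apply/andP; split; lra.
- apply: (@edge _ _ (- (2 * r)) 0 (fun t => - ((2 * t - 1) * r)) (fun=> r)) => [|t|t /sq h].
  + by case: (a) => x y; apply/eqP; rewrite eq_complex /=; apply/andP; split; apply/eqP; ring.
  + by case: (a) => x y; apply/eqP; rewrite eq_complex /=; apply/andP; split; apply/eqP; ring.
  + by move: h => /andP[h1 h2]; apply/andP; split; lra.
- apply: (@edge _ _ 0 (- (2 * r)) (fun=> - r) (fun t => - ((2 * t - 1) * r))) => [|t|t /sq h].
  + by case: (a) => x y; apply/eqP; rewrite eq_complex /=; apply/andP; split; apply/eqP; ring.
  + by case: (a) => x y; apply/eqP; rewrite eq_complex /=; apply/andP; split; apply/eqP; ring.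
  + by move: h => /andP[h1 h2]; apply/andP; split; lra.
Qed.

Lemma sqside_center a r z : 0 < r -> sqside (a - r%:C - 'i * r%:C) (2 * r) z ->
  r <= cmod (z - a) <= 2 * r.
Proof.
move=> r0 [sq side]; apply/andP; split.
  have := Re_cmod (z - a); have := Im_cmod (z - a).
  move: sq side; rewrite /square; case: (a) => x y; case: z => u v /=.
  move=> [/andP[A1 A2] /andP[A3 A4]] hs; rewrite !ler_norml => /andP[h1 h2] /andP[h3 h4].
  by case: hs => hs; lra.
apply: le_trans (cmod_ReIm _) _; rewrite mulr_natl mulr2n.
move: sq; rewrite /square; case: (a) => x y; case: z {side} => u v /= [/andP[A1 A2] /andP[A3 A4]].
by rewrite lerD// ler_norml; lra.
Qed.

Lemma square_center a r z : 0 < r -> square (a - r%:C - 'i * r%:C) (2 * r) z ->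
  cmod (z - a) <= 2 * r.
Proof.
move=> r0 sq; apply: le_trans (cmod_ReIm _) _; rewrite mulr_natl mulr2n.
move: sq; rewrite /square; case: (a) => x y; case: z => u v /= [/andP[A1 A2] /andP[A3 A4]].
by rewrite lerD// ler_norml; lra.
Qed.

(* Goursat is applied to (1 - H)^2 / (z - a): the square makes it differentiable
   at a, and on the boundary it is close to 1 / (z - a). *)
Lemma no_peak H a r : 0 < r ->
  (forall z, cmod (z - a) <= 2 * r -> cdiff H z) -> H a = 1 ->
  exists2 z, r <= cmod (z - a) <= 2 * r & 10^-1 < cmod (H z).
Proof.
move=> r0 dH Ha; apply: contrapT => small.
have {}small z : r <= cmod (z - a) <= 2 * r -> cmod (H z) <= 10^-1.
  by move=> hz; rewrite leNgt; apply/negP => h; apply: small; exists z.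
pose F z := (1 - H z) ^+ 2 / (z - a).
have dF z : square (a - r%:C - 'i * r%:C) (2 * r) z -> cdiff F z.
  move=> /(square_center r0)/dH dHz; have [za|za] := eqVneq z a.
    subst z; move: dHz => [phi cphi ephi]; exists (fun z => phi z * phi z).
      exact: ctsM.
    have Fa : F a = 0 by rewrite /F subrr invr0 mulr0.
    near=> z; rewrite Fa add0r /F (near ephi z)// Ha opprD addrA subrr add0r.
    have [->|za] := eqVneq z a; first by rewrite !subrr invr0 !mulr0.
    have za0 : z - a != 0 by rewrite subr_eq0.
    by rewrite sqrrN expr2; field.
  apply: cdiffM.
    by apply: cdiffX; apply: cdiffB => //; exact: cdiff_cst.
  apply: cdiffV; last by rewrite subr_eq0.
  by apply: cdiffB; [exact: cdiff_id|exact: cdiff_cst].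
have s0 : 0 < 2 * r by rewrite mulr_gt0.
(* With this tolerance Goursat's bound for the side [2 * r] equals 1. *)
have e0 : 0 < (4 * r ^+ 2)^-1 by rewrite invr_gt0 mulr_gt0// exprn_gt0.
have [n] := goursat s0 dF e0; move=> /(_ n (leqnn n)).
rewrite (_ : (4 * r ^+ 2)^-1 * (2 * r) ^+ 2 = 1); last by field; rewrite gt_eqF.
pose E z := F z - (z - a)^-1.
have -> : bdry F n (a - r%:C - 'i * r%:C) (2 * r)%:C =
    bdry (fun z => E z + (z - a)^-1) n (a - r%:C - 'i * r%:C) (2 * r)%:C.
  by congr (bdry _ _ _ _); apply/funext => z; rewrite /E subrK.
rewrite bdryD => le1.
(* From |H| <= 1/10 follows |H^2 - 2 H| <= 21/100, hence an error of at most 168/100. Together with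
   the 1 from Goursat it stays below the 4 of [Im_bdry_inv]. *)
have leE : cmod (bdry E n (a - r%:C - 'i * r%:C) (2 * r)%:C) <= 4 * (21 / 100 / r * (2 * r)).
  apply: bdry_bound; first exact: ltW.
  move=> z /(sqside_center r0) hz; have Hz := small z hz.
  have za0 : z - a != 0.
    by rewrite -cmod_gt0; apply: lt_le_trans r0 _; case/andP: hz.
  have -> : E z = (H z ^+ 2 - 2 * H z) / (z - a) by rewrite /E /F; field.
  rewrite cmod_div ler_pM ?cmod_ge0 ?invr_ge0 ?cmod_ge0//; last first.
    by rewrite lef_pV2 ?posrE ?cmod_gt0//; case/andP: hz.
  apply: le_trans (cmodB _ _) _; rewrite cmodX cmodM.
  rewrite -(rmorph_nat (real_complex R) 2) cmod_real ger0_norm//.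
  by have := cmod_ge0 (H z); nra.
have := Im_bdry_inv a n r0.
move: le1 leE; set u := bdry E _ _ _; set v := bdry _ _ _ _ => le1 leE.
have := le_trans (Im_cmod _) le1; have := le_trans (Im_cmod _) leE.
rewrite (ImD u v) (_ : 4 * (21 / 100 / r * (2 * r)) = 168 / 100); last by field; rewrite gt_eqF.
by rewrite !ler_norml => /andP[A1 A2] /andP[A3 A4] A5; lra.
Unshelve. all: by end_near. Qed.

(** The boundary condition is an upper limit taken inside [V], so [h] may be uncontrolled on the
    boundary itself. If [B] were exceeded, |h| would attain a maximum [m0] > [B] in [V]; powers of
    [h] turn such a point into a peak of the kind that [no_peak] forbids. *)
Lemma max_modulus (V : set R[i]) h B M : open V -> (forall z, V z -> cmod z <= M) ->
  (forall z, V z -> cdiff h z) -> 0 <= B ->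
  (forall b, closure V b -> ~ V b -> forall e, 0 < e ->
    exists2 d, 0 < d & forall z, V z -> cmod (z - b) < d -> cmod (h z) <= B + e) ->
  forall z, V z -> cmod (h z) <= B.
Proof.
move=> oV bV dh B0 bd z0 Vz0; rewrite leNgt; apply/negP => Bh.
have ch z : V z -> forall e, 0 < e ->
    exists2 d, 0 < d & forall w, cmod (w - z) < d -> cmod (h w - h z) < e.
  by move=> Vz; apply/continuous_cmod; exact: cdiff_cts (dh z Vz).
have compK beta : B < beta -> compact [set z | V z /\ beta <= cmod (h z)].
  move=> Bb; apply: (@closed_bounded_compact _ _ M); last by move=> z [/bV].
  move=> b /closure_cmod clb; have [Vb|nVb] := pselect (V b).
    split=> //; apply/ler_addgt0Pl => e e0; have [d d0 Hd] := ch b Vb e e0.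
    have [z [_ bz] zb] := clb d d0.
    by have := Hd z zb; have := cmod_sub (h z) (h b); lra.
  have e0 : 0 < (beta - B) / 2 by lra.
  have [|d d0 Hd] := bd b _ nVb _ e0.
    by apply/closure_cmod => d /clb[z [Vz _] zb]; exists z.
  by have [z [Vz bz] zb] := clb d d0; have := Hd z Vz zb; lra.
have cmax (K : set R[i]) : compact K -> K !=set0 -> (K `<=` V) ->
    exists2 a, K a & forall z, K z -> cmod (h z) <= cmod (h a).
  move=> cK K0 KV; apply: (compact_max cK K0) => a /KV Va e e0.
  have [d d0 Hd] := ch a Va e e0; exists d => // z _ /Hd.
  exact: le_lt_trans (cmod_dist _ _).
have [|a0 [Va0 ha0] Hmax] := cmax _ (compK _ Bh) _ (fun z => @proj1 _ _); first by exists z0.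
pose m0 := cmod (h a0).
have m0B : B < m0 by exact: lt_le_trans ha0.
have m0_gt0 : 0 < m0 by exact: le_lt_trans m0B.
have hV z : V z -> cmod (h z) <= m0.
  move=> Vz; have [le|lt] := leP (cmod (h z0)) (cmod (h z)); first exact: Hmax.
  exact: ltW (lt_le_trans lt ha0).
(* Among the points where |h| is maximal, [a] is one farthest from 0. *)
have [||a [Va ha] Hfar] := @compact_max R _ (@cmod R) (compK _ m0B).
- by exists a0; split.
- move=> a _ e e0; exists e => // z _; exact: le_lt_trans (cmod_dist _ _).
have ham : cmod (h a) = m0 by apply/eqP; rewrite eq_le ha hV.
(* The factor E breaks ties among the maximum points of h: a is the only one
   of them where |E| reaches 1. *)
have [E [dE Ea HE]] : exists E : R[i] -> R[i], [/\ forall z, cdiff E z, E a = 1 &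
    forall z, V z -> m0 <= cmod (h z) -> z != a -> cmod (E z) < 1].
  have [a_0|a_0] := eqVneq a 0.
    exists (fun=> 1); split=> [z||z Vz hz]; [exact: cdiff_cst|by []|].
    have := Hfar z (conj Vz hz); rewrite a_0 cmod0 => z_le; rewrite -cmod_gt0.
    by rewrite ltNge z_le.
  have a2 : 2 * a != 0 by rewrite mulf_neq0// pnatr_eq0.
  have ac : 0 < cmod a by rewrite cmod_gt0.
  exists (fun z => (z + a) / (2 * a)); split=> [z||z Vz hz za].
  - apply: cdiffM; last exact: cdiff_cst.
    by apply: cdiffD; [exact: cdiff_id|exact: cdiff_cst].
  - by rewrite (_ : a + a = 2 * a) ?divff//; ring.
  rewrite cmod_div cmodM -(rmorph_nat (real_complex R) 2) cmod_real ger0_norm//.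
  rewrite ltr_pdivrMr ?mulr_gt0// mul1r.
  (* |z + a|^2 = 2 |z|^2 + 2 |a|^2 - |z - a|^2 is less than 4 |a|^2, because |z| <= |a| and z
     differs from a. *)
  have := parallelogram z a; have := Hfar z (conj Vz hz).
  have : 0 < cmod (z - a) by rewrite cmod_gt0 subr_eq0.
  move=> pos far par.
  rewrite ltNge; apply/negP => le2.
  have sq1 : (2 * cmod a) ^+ 2 <= cmod (z + a) ^+ 2.
    by rewrite lerXn2r ?nnegrE ?cmod_ge0 ?mulr_ge0 ?cmod_ge0.
  have sq2 : cmod z ^+ 2 <= cmod a ^+ 2 by rewrite lerXn2r ?nnegrE ?cmod_ge0.
  have sq3 : 0 < cmod (z - a) ^+ 2 by rewrite exprn_gt0.
  by move: sq1; rewrite exprMn; lra.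
have [d d0 Hd] : exists2 d, 0 < d & forall z, cmod (z - a) < d -> V z.
  by apply/nbhs_cmod; rewrite -/(nbhs _ _); exact: open_nbhs_nbhs.
pose r := d / 4; have r0 : 0 < r by rewrite divr_gt0.
have rV z : cmod (z - a) <= 2 * r -> V z by move=> za; apply: Hd; rewrite /r in za; lra.
(* Two powers for two kinds of points of the annulus. Where |h| < [m0] the factor [E] may exceed 1,
   and the inner power beats it; where |h| = [m0] one has |E| < 1 nearby, and the outer power does
   the work. *)
pose H n z := ((h z / h a) ^+ n * E z) ^+ n.
have ha0' : h a != 0 by rewrite -cmod_gt0 ham.
have cS : compact [set z | r <= cmod (z - a) <= 2 * r].
  apply: (@closed_bounded_compact _ _ (2 * r + cmod a)).
    move=> b /closure_cmod clb /=; apply/andP; split; apply/ler_addgt0Pl => e e0.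
      have [z /andP[h1 h2] zb] := clb e e0.
      have := cmod_tri b z a; lra.
    have [z /andP[h1 h2]] := clb e e0; rewrite cmodBC => zb.
    have := cmod_tri z b a; lra.
  by move=> z /andP[_ h2]; have := cmod_sub z a; lra.
have [|N HN] := @compact_uniform R _ (fun n z => cmod (H n z) <= 10^-1) cS.
  move=> z1 /andP[rz zr]; have Vz1 := rV _ zr.
  have z1a : z1 != a by rewrite -subr_eq0 -cmod_gt0; exact: lt_le_trans rz.
  have cmodH n z : cmod (H n z) = ((cmod (h z) / m0) ^+ n * cmod (E z)) ^+ n.
    by rewrite /H cmodX cmodM cmodX cmod_div ham.
  have [d1 d10 Hd1] : exists2 d, 0 < d & forall z, cmod (z - z1) < d -> V z.
    by apply/nbhs_cmod; exact: open_nbhs_nbhs.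
  have [lt|ge] := ltP (cmod (h z1)) m0.
    pose t := (cmod (h z1) + m0) / 2 / m0.
    have t01 : 0 <= t < 1.
      rewrite /t divr_ge0 ?divr_ge0 ?addr_ge0 ?cmod_ge0 ?(ltW m0_gt0)//=.
      by rewrite ltr_pdivrMr// mul1r; lra.
    have h0 : 0 < (m0 - cmod (h z1)) / 2 by lra.
    have [d2 d20 Hd2] := ch z1 Vz1 _ h0.
    have [d3 d30 Hd3] := (continuous_cmod E z1).1 (cdiff_cts (dE z1)) _ ltr01.
    pose K := cmod (E z1) + 1; have K0 : 0 < K by rewrite ltr_wpDl ?cmod_ge0.
    have e0 : 0 < 10^-1 / K :> R by rewrite divr_gt0.
    have [N HN] := expr_small t01 e0.
    exists (Num.min d2 d3); first by rewrite lt_min d20.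
    exists N.+1 => n z nN; rewrite lt_min => /andP[/Hd2 hz /Hd3 Ez].
    have tz : cmod (h z) / m0 <= t.
      by rewrite /t ler_pM2r ?invr_gt0//; have := cmod_sub (h z) (h z1); lra.
    have EK : cmod (E z) <= K by rewrite /K; have := cmod_sub (E z) (E z1); lra.
    rewrite cmodH.
    have b1 : (cmod (h z) / m0) ^+ n * cmod (E z) <= 10^-1.
      apply: le_trans (_ : 10^-1 / K * K <= _); last by rewrite divfK ?gt_eqF.
      apply: ler_pM; rewrite ?cmod_ge0 ?exprn_ge0 ?divr_ge0 ?cmod_ge0 ?(ltW m0_gt0)//.
      apply: le_trans (HN n (ltnW nN)).
      have t0 : 0 <= t by case/andP: t01.
      by apply: lerXn2r => //; rewrite nnegrE divr_ge0 ?cmod_ge0// ltW.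
    case: n nN b1 => // n _ b1.
    have b0 : 0 <= (cmod (h z) / m0) ^+ n.+1 * cmod (E z).
      by rewrite mulr_ge0 ?cmod_ge0 ?exprn_ge0 ?divr_ge0 ?cmod_ge0 ?(ltW m0_gt0).
    rewrite exprS; apply: le_trans (_ : _ <= 10^-1 * 1) _; last by rewrite mulr1.
    by apply: ler_pM => //; [exact: exprn_ge0|apply: exprn_ile1 => //; lra].
  have E1 := HE z1 Vz1 ge z1a.
  pose t := (cmod (E z1) + 1) / 2.
  have t01 : 0 <= t < 1 by rewrite /t; have := cmod_ge0 (E z1); lra.
  have h0 : 0 < (1 - cmod (E z1)) / 2 by lra.
  have [d3 d30 Hd3] := (continuous_cmod E z1).1 (cdiff_cts (dE z1)) _ h0.
  have [N HN] := @expr_small t 10^-1 t01 (ltac:(by rewrite invr_gt0)).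
  exists (Num.min d1 d3); first by rewrite lt_min d10.
  exists N => n z nN; rewrite lt_min => /andP[/Hd1 Vz /Hd3 Ez].
  have EK : cmod (E z) <= t by rewrite /t; have := cmod_sub (E z) (E z1); lra.
  rewrite cmodH; apply: le_trans (HN n nN).
  have hz1 : cmod (h z) / m0 <= 1 by rewrite ler_pdivrMr// mul1r hV.
  have hz0 : 0 <= cmod (h z) / m0 by rewrite divr_ge0 ?cmod_ge0 ?ltW.
  have t0 : 0 <= t by case/andP: t01.
  apply: lerXn2r; rewrite ?nnegrE//.
    by rewrite mulr_ge0 ?exprn_ge0 ?cmod_ge0.
  apply: le_trans EK; rewrite -[X in _ <= X]mul1r ler_wpM2r ?cmod_ge0//.
  exact: exprn_ile1.
have [z|//|z rz] := @no_peak (H N) a r r0.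
- move=> /rV Vz; apply: cdiffX; apply: cdiffM => //; apply: cdiffX.
  by apply: cdiffM; [exact: dh|exact: cdiff_cst].
- by rewrite /H divff// expr1n Ea mulr1 expr1n.
by apply/negP; rewrite -leNgt; exact: HN.
Qed.

End MaximumModulus.

(** * Isolated singularities *)

Section IsolatedSingularities.
Variable R : realType.
Implicit Types (h F : R[i] -> R[i]) (z w a b c l : R[i]) (r s t x y e B M K : R).

(** Taking N-th roots removes both constants. In this way fixed losses, at a puncture or at one
    badly placed point of a potential, cost nothing. *)
Lemma le_of_powers x y (c C : R) : 0 <= x -> 0 <= y -> 0 < c ->
  (forall N, x ^+ N * c <= C * y ^+ N) -> x <= y.
Proof.
move=> x0 y0 c0 H; rewrite leNgt; apply/negP => yx.
have x_gt0 : 0 < x by exact: le_lt_trans yx.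
have C0 : 0 < C by have := H 0%N; rewrite !expr0 mulr1 mul1r; exact: lt_le_trans.
have t01 : 0 <= y / x < 1 by rewrite divr_ge0//= ltr_pdivrMr// mul1r.
have e0 : 0 < c / (2 * C) by rewrite !divr_gt0// mulr_gt0.
have [N HN] := expr_small t01 e0.
have := HN N (leqnn N); rewrite expr_div_n ler_pdivrMr ?exprn_gt0// => h1.
have xN : 0 < x ^+ N by rewrite exprn_gt0.
have := le_trans (H N) (ler_wpM2l (ltW C0) h1).
rewrite (_ : C * (c / (2 * C) * x ^+ N) = x ^+ N * c / 2); last by field; rewrite gt_eqF.
by have := mulr_gt0 xN c0; lra.
Qed.

Lemma boundary_cts h b B : {for b, continuous h} -> cmod (h b) <= B -> forall e, 0 < e ->
  exists2 d, 0 < d & forall z, cmod (z - b) < d -> cmod (h z) <= B + e.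
Proof.
move=> /continuous_cmod ch hB e e0; have [d d0 Hd] := ch e e0; exists d => // z /Hd.
by have := cmod_sub (h z) (h b); lra.
Qed.

Lemma open_annulus x y : open [set z : R[i] | x < cmod z < y].
Proof.
apply: open_cmod => a /andP[xa ay]; exists (Num.min (cmod a - x) (y - cmod a)).
  by rewrite lt_min !subr_gt0 xa.
move=> z; rewrite lt_min => /andP[h1 h2] /=.
have := cmod_sub a z; have := cmod_sub z a; rewrite [cmod (a - z)]cmodBC.
by move=> *; apply/andP; split; lra.
Qed.

Lemma closure_ge (A : set R[i]) x b : (forall z, A z -> x <= cmod z) ->
  closure A b -> x <= cmod b.
Proof.
move=> H /closure_cmod clb; apply/ler_addgt0Pl => e e0.
by have [z /H xz] := clb e e0; have := cmod_sub z b; lra.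
Qed.

Lemma closure_le (A : set R[i]) x b : (forall z, A z -> cmod z <= x) ->
  closure A b -> cmod b <= x.
Proof.
move=> H /closure_cmod clb; apply/ler_addgt0Pl => e e0.
have [z /H xz] := clb e e0; have := cmod_sub b z; rewrite cmodBC; lra.
Qed.

Lemma max_annulus h x y B : (forall z, x <= cmod z <= y -> cdiff h z) -> 0 <= B ->
  (forall z, cmod z = x \/ cmod z = y -> cmod (h z) <= B) ->
  forall z, x <= cmod z <= y -> cmod (h z) <= B.
Proof.
move=> dh B0 HB z /andP[]; rewrite le_eqVlt => /orP[/eqP xz _|xz].
  by apply: HB; left.
rewrite le_eqVlt => /orP[/eqP zy|zy]; first by apply: HB; right.
apply: (max_modulus (M := y) (@open_annulus x y) _ _ B0) => [w /andP[_ /ltW]//|w /andP[/ltW h1 /ltW h2]||].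
- by apply: dh; rewrite h1.
- move=> b clb nVb e e0.
  have bx : x <= cmod b by apply: closure_ge clb => w /andP[/ltW].
  have yb : cmod b <= y by apply: closure_le clb => w /andP[_ /ltW].
  have bxy : x <= cmod b <= y by rewrite bx yb.
  have [|d d0 Hd] := @boundary_cts h b B (cdiff_cts (dh b bxy)) _ e e0.
    apply: HB; move: nVb => /=; rewrite !lt_neqAle bx yb !andbT.
    by case: eqVneq => [->|_]; [left|case: eqVneq => [->|_]; [right|case]].
  by exists d => // w _; exact: Hd.
- by rewrite /= xz.
Qed.

(** * Removable singularities, with a rate *)

Section Puncture.
Variables (h : R[i] -> R[i]) (e B : R).
Hypothesis e0 : 0 < e.
Hypothesis dh : forall w, 0 < cmod w < e -> cdiff h w.
Hypothesis hB : forall w, 0 < cmod w < e -> cmod (h w) <= B.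

Let B0 : 0 <= B.
Proof.
apply: le_trans (hB (w := (e / 2)%:C) _); first exact: cmod_ge0.
rewrite cmod_real ger0_norm ?divr_ge0 ?(ltW e0)//.
by rewrite divr_gt0//= ltr_pdivrMr// ltr_pMr// ltr1n.
Qed.

(* The difference quotient is only bounded at the two punctures 0 and a, so the
   maximum principle is applied to its N-th power times w (w - a). *)
Lemma bounded_puncture_lipschitz a b : 0 < cmod a < e / 4 -> 0 < cmod b < e / 4 ->
  cmod (h b - h a) <= 8 * B / e * cmod (b - a).
Proof.
move=> /andP[a0 ae] /andP[b0 be].
have [->|ba] := eqVneq b a; first by rewrite !subrr cmod0 mulr0.
have ba0 : 0 < cmod (b - a) by rewrite cmod_gt0 subr_eq0.
pose phi w := (h w - h a) / (w - a).
have ha : cmod (h a) <= B by apply: hB; rewrite a0; lra.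
have phiE : cmod (h b - h a) = cmod (phi b) * cmod (b - a).
  by rewrite -cmodM divfK// subr_eq0.
rewrite phiE ler_wpM2r ?cmod_ge0//.
have K0 : 0 <= 8 * B / e by rewrite divr_ge0 ?mulr_ge0// ltW.
(* On |w| = e/2 the distance to [a] is at least e/4, so the quotient is at most 2 B / (e/4) = 8 B /
   e, while |w (w - a)| <= e/2 * e. *)
apply: (@le_of_powers _ _ (cmod b * cmod (b - a)) (e / 2 * e)) => //; first exact: cmod_ge0.
  by rewrite mulr_gt0.
move=> N.
have P0 : 0 <= e / 2 * e * (8 * B / e) ^+ N.
  by rewrite mulr_ge0 ?exprn_ge0//; apply: mulr_ge0; lra.
pose psi w := phi w ^+ N * (w * (w - a)).
have -> : cmod (phi b) ^+ N * (cmod b * cmod (b - a)) = cmod (psi b).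
  by rewrite /psi cmodM cmodX [cmod (b * _)]cmodM.
pose V := [set w | 0 < cmod w < e / 2] `&` [set w | w != a].
have oV : open V.
  apply: openI; first exact: open_annulus.
  apply: open_cmod => w /= wa; exists (cmod (w - a)); first by rewrite cmod_gt0 subr_eq0.
  by move=> z; apply: contraTneq => ->; rewrite cmodBC ltxx.
have dphi w : 0 < cmod w < e -> w != a -> cdiff phi w.
  move=> we wa; apply: cdiffM; first by apply: cdiffB; [exact: dh|exact: cdiff_cst].
  apply: cdiffV; last by rewrite subr_eq0.
  by apply: cdiffB; [exact: cdiff_id|exact: cdiff_cst].
have dpsi w : 0 < cmod w < e -> w != a -> cdiff psi w.
  move=> we wa; apply: cdiffM; first by apply: cdiffX; exact: dphi.
  apply: cdiffM; first exact: cdiff_id.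
  by apply: cdiffB; [exact: cdiff_id|exact: cdiff_cst].
have near_zero b' (K d : R) : 0 < d -> (forall w, V w -> cmod (w - b') < d -> cmod (phi w) <= K) ->
    (b' = 0 \/ b' = a) -> forall e', 0 < e' ->
    exists2 d, 0 < d & forall w, V w -> cmod (w - b') < d ->
      cmod (psi w) <= e / 2 * e * (8 * B / e) ^+ N + e'.
  move=> d0 HK b'0a e' e'0.
  have C0 : 0 < `|K| ^+ N * e + 1 by rewrite ltr_wpDl ?mulr_ge0 ?exprn_ge0// ltW.
  exists (Num.min d (e' / (`|K| ^+ N * e + 1))); first by rewrite lt_min d0 divr_gt0.
  move=> w Vw; rewrite lt_min => /andP[wd we'].
  apply: le_trans (_ : e' <= _); last by rewrite lerDr.
  rewrite /psi cmodM cmodX cmodM.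
  have wwa : cmod w * cmod (w - a) <= e * cmod (w - b').
    case: Vw => /andP[w0 we] _.
    case: b'0a => ->; last by rewrite ler_wpM2r ?cmod_ge0//; lra.
    rewrite subr0 mulrC ler_wpM2r ?cmod_ge0//; have := cmodB w a; lra.
  have Kw : cmod (phi w) ^+ N <= `|K| ^+ N.
    by apply: lerXn2r; rewrite ?nnegrE ?cmod_ge0// (le_trans (HK _ Vw wd))// ler_norm.
  apply: le_trans (ler_pM _ _ Kw wwa) _; rewrite ?exprn_ge0 ?mulr_ge0 ?cmod_ge0//.
  rewrite mulrA; apply: le_trans (_ : _ <= (`|K| ^+ N * e + 1) * cmod (w - b')) _.
    by rewrite ler_wpM2r ?cmod_ge0// lerDl.
  by rewrite mulrC -ler_pdivlMr// ltW.
apply: (max_modulus (V := V) (M := e)) => //.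
- by move=> w [/andP[_ we] _]; lra.
- by move=> w [/andP[w0 we] wa]; apply: dpsi => //; rewrite w0; lra.
- move=> b' clb nVb.
  have b'e : cmod b' <= e / 2 by apply: closure_le clb => w [/andP[_ /ltW]].
  have [b'0|b'0] := eqVneq b' 0.
    apply: (@near_zero _ (4 * B / cmod a) (cmod a / 2)); [lra| |by left].
    move=> w [/andP[w0 we] wa]; rewrite b'0 subr0 => wa2.
    have := cmod_sub a w; rewrite cmodBC => waa.
    have hw : cmod (h w) <= B by apply: hB; rewrite w0; lra.
    rewrite /phi cmod_div ler_pdivrMr ?cmod_gt0 ?subr_eq0//.
    apply: le_trans (cmodB _ _) _.
    apply: le_trans (_ : _ <= 4 * B / cmod a * (cmod a / 2)) _.
      by rewrite (_ : _ * _ = 2 * B); [lra|field; rewrite gt_eqF].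
    by rewrite ler_wpM2l ?divr_ge0 ?mulr_ge0 ?cmod_ge0//; lra.
  have [b'a|b'a] := eqVneq b' a.
    have ae' : 0 < cmod a < e by rewrite a0; lra.
    have [l Hl] := cdiff_eps (dh ae').
    have [d d0 Hd] := Hl 1 ltr01.
    apply: (@near_zero _ (cmod l + 1) d) => //; last by right.
    move=> w [_ wa]; rewrite b'a => /Hd; rewrite mul1r => hw.
    rewrite /phi cmod_div ler_pdivrMr ?cmod_gt0 ?subr_eq0// mulrDl mul1r -cmodM.
    have := cmodD (h w - (h a + l * (w - a))) (l * (w - a)).
    by rewrite (_ : _ + _ = h w - h a); [lra|ring].
  have b'pos : 0 < cmod b' by rewrite cmod_gt0.
  have b'eq : cmod b' = e / 2.
    apply/eqP; rewrite eq_le b'e /= leNgt; apply/negP => b'lt; apply: nVb.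
    by split => //=; rewrite b'pos.
  move=> e' e'0.
  have [||d d0 Hd] := @boundary_cts psi b' (e / 2 * e * (8 * B / e) ^+ N) _ _ e' e'0.
  + by apply: cdiff_cts; apply: dpsi => //; rewrite b'pos; lra.
  + have hb' : cmod (h b') <= B by apply: hB; rewrite b'pos; lra.
    have := cmod_sub b' a; have := cmodB b' a => h1 h2.
    rewrite /psi cmodM cmodX cmodM mulrC b'eq; apply: ler_pM.
    * by rewrite mulr_ge0 ?cmod_ge0//; lra.
    * by rewrite exprn_ge0 ?cmod_ge0.
    * by rewrite ler_wpM2l; lra.
    apply: lerXn2r; rewrite ?nnegrE ?cmod_ge0//.
    rewrite /phi cmod_div ler_pdivrMr ?cmod_gt0 ?subr_eq0//.
    apply: le_trans (cmodB _ _) _.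
    apply: le_trans (_ : _ <= 8 * B / e * (e / 4)) _.
      by rewrite (_ : _ * _ = 2 * B); [lra|field; rewrite gt_eqF].
    by rewrite ler_wpM2l//; lra.
  by exists d => // w _; exact: Hd.
- by split => /=; [rewrite b0; lra|].
Qed.

(** The values along a sequence tending to 0 stay in the compact disc |l| <= [B]. If every [l] there
    were refuted by some [w], the Lipschitz estimate would keep the late values h(v_n) away from a
    neighbourhood of each [l], hence out of the disc. *)
Lemma bounded_puncture_limit : exists l, forall w, 0 < cmod w < e / 4 ->
  cmod (h w - l) <= 8 * B / e * cmod w.
Proof.
apply: contrapT => nl.
pose v n : R[i] := (e / (n + 8)%N%:R)%:C.
have vE n : cmod (v n) = e / (n + 8)%N%:R by rewrite cmod_real ger0_norm// divr_ge0// ltW.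
have v0 n : 0 < cmod (v n) < e / 4.
  rewrite vE divr_gt0//= ?ltr0n ?addn_gt0 ?orbT//.
  rewrite ltr_pM2l// ltf_pV2 ?posrE ?ltr0n ?addn_gt0 ?orbT// ltr_nat.
  by rewrite addnS ltnS (leq_trans _ (leq_addl _ _)).
have K0 : 0 <= 8 * B / e by rewrite divr_ge0 ?mulr_ge0// ltW.
have cB : compact [set l : R[i] | cmod l <= B].
  by apply: (@closed_bounded_compact _ _ B) => // l; apply: closure_le.
have [|N HN] := @compact_uniform R _ (fun n l => l != h (v n)) cB.
  move=> l _; have [w we hw] : exists2 w, 0 < cmod w < e / 4 &
      8 * B / e * cmod w < cmod (h w - l).
    apply: contrapT => H; apply: nl; exists l => w we; rewrite leNgt; apply/negP => lt.
    by apply: H; exists w.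
  pose g := cmod (h w - l) - 8 * B / e * cmod w.
  have g0 : 0 < g by rewrite subr_gt0.
  exists (g / 2); first by rewrite divr_gt0.
  exists (Num.truncn (16 * B / g)).+1 => n z nN zl; apply/eqP => zE; subst z.
  have := bounded_puncture_lipschitz (v0 n) we.
  have := cmod_tri (h (v n)) (h w) l => tri lip.
  have := cmodB w (v n) => wv.
  have : 8 * B / e * cmod (v n) < g / 2.
    rewrite vE mulrA divfK ?gt_eqF// ltr_pdivrMr ?ltr0n ?addn_gt0 ?orbT//.
    have : 16 * B / g < (n + 8)%N%:R.
      apply: lt_le_trans (truncnS_gt _) _; rewrite ler_nat.
      by rewrite (leq_trans nN)// leq_addr.
    by rewrite ltr_pdivrMr//; lra.
  have : 8 * B / e * cmod (w - v n) <= 8 * B / e * (cmod w + cmod (v n)) by rewrite ler_wpM2l.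
  by rewrite mulrDr /g in g0 *; rewrite /g in zl; lra.
have := HN N (h (v N)) (leqnn N); rewrite eqxx => /(_ _)/negP; apply => //.
by apply: hB; case/andP: (v0 N) => -> /= v4; move: e0; lra.
Qed.

End Puncture.

(** If no quotient h / w^m has a nonzero limit, then by induction each of them tends to 0, so that h
    vanishes to every order at 0; the maximum principle then forces h = 0 on a fixed punctured
    disc. *)
Lemma finite_order h e B : 0 < e -> (forall w, 0 < cmod w < e -> cdiff h w) ->
  (forall w, 0 < cmod w < e -> cmod (h w) <= B) ->
  (exists2 d, 0 < d & forall w, 0 < cmod w < d -> h w = 0) \/
  (exists m l K d, [/\ l != 0, 0 < d & forall w, 0 < cmod w < d ->
     cmod (h w / w ^+ m - l) <= K * cmod w]).
Proof.
move=> e0 dh hB; apply: contrapT => /not_orP[nz nm].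
have dhm m w : 0 < cmod w < e -> cdiff (fun w => h w / w ^+ m) w.
  move=> we; apply: cdiffM; first exact: dh.
  apply: cdiffV; first by apply: cdiffX; exact: cdiff_id.
  by rewrite expf_neq0// -cmod_gt0; case/andP: we.
have claim m : exists K d, [/\ 0 < d, d <= e & forall w, 0 < cmod w < d ->
    cmod (h w) <= K * cmod w ^+ m].
  elim: m => [|m [K [d [d0 de HK]]]].
    by exists B, e; split=> // w /hB; rewrite expr0 mulr1.
  have sub w : 0 < cmod w < d -> 0 < cmod w < e.
    by move=> /andP[-> wd] /=; exact: lt_le_trans wd de.
  have hK w : 0 < cmod w < d -> cmod (h w / w ^+ m) <= K.
    move=> wd; rewrite cmod_div cmodX ler_pdivrMr ?exprn_gt0//; first exact: HK.
    by case/andP: wd.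
  have [l Hl] := bounded_puncture_limit d0 (fun w wd => dhm m w (sub w wd)) hK.
  have d4 : 0 < d / 4 by rewrite divr_gt0.
  have l0 : l = 0.
    apply/eqP; apply/negPn/negP => l0; apply: nm.
    by exists m, l, (8 * K / d), (d / 4).
  exists (8 * K / d), (d / 4); split=> //; first lra.
  move=> w wd; have := Hl w wd; rewrite l0 subr0 cmod_div cmodX.
  have w0 : 0 < cmod w by case/andP: wd.
  by rewrite ler_pdivrMr ?exprn_gt0// exprS mulrA.
apply: nz; exists (e / 2); first by rewrite divr_gt0.
move=> w /andP[w0 we]; apply/eqP; rewrite -cmod_eq0 eq_le cmod_ge0 andbT.
have B0 : 0 <= B by apply: le_trans (hB w _); [exact: cmod_ge0|rewrite w0; lra].
(* The radii in [claim] shrink with [m]. They serve only at the puncture; the bound itself comes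
   from the fixed circle of radius e/2. *)
have bound m : cmod (h w / w ^+ m) <= B / (e / 2) ^+ m.
  apply: (max_modulus (V := [set w | 0 < cmod w < e / 2]) (M := e)
    (h := fun w => h w / w ^+ m)).
  - exact: open_annulus.
  - by move=> z /andP[_ ze]; lra.
  - by move=> z /andP[z0 ze]; apply: dhm; rewrite z0; lra.
  - by rewrite divr_ge0 ?exprn_ge0//; lra.
  - move=> b clb nVb e' e'0.
    have be : cmod b <= e / 2 by apply: closure_le clb => z /andP[_ /ltW].
    have [b_0|b0] := eqVneq b 0.
      have [K [d [d0 de HK]]] := claim m.+1.
      have C0 : 0 < `|K| + 1 by rewrite ltr_wpDl.
      exists (Num.min d (e' / (`|K| + 1))); first by rewrite lt_min d0 divr_gt0.
      move=> z /andP[z0 ze]; rewrite b_0 subr0 lt_min => /andP[zd ze'].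
      apply: le_trans (_ : e' <= _); last by rewrite lerDr divr_ge0 ?exprn_ge0//; lra.
      rewrite cmod_div cmodX ler_pdivrMr ?exprn_gt0//.
      apply: le_trans (HK z _) _; first by rewrite z0.
      rewrite exprS mulrA ler_wpM2r ?exprn_ge0 ?cmod_ge0//.
      apply: le_trans (_ : _ <= (`|K| + 1) * cmod z) _.
        by rewrite ler_wpM2r ?cmod_ge0// (le_trans (ler_norm K))// lerDl.
      by rewrite mulrC -ler_pdivlMr// ltW.
    have b_gt0 : 0 < cmod b by rewrite cmod_gt0.
    have bE : cmod b = e / 2.
      apply/eqP; rewrite eq_le be /= leNgt; apply/negP => b'lt; apply: nVb.
      by rewrite /= b_gt0.
    have bb : 0 < cmod b < e by rewrite b_gt0; lra.
    have [|d d0 Hd] := @boundary_cts (fun w => h w / w ^+ m) b (B / (e / 2) ^+ m)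
        (cdiff_cts (dhm m b bb)) _ e' e'0.
      by rewrite cmod_div cmodX bE ler_wpM2r ?invr_ge0 ?exprn_ge0 ?hB//; lra.
    by exists d => // z _; exact: Hd.
  - by rewrite /= w0.
pose t := cmod w / (e / 2).
have t01 : 0 <= t < 1 by rewrite /t divr_ge0 ?cmod_ge0//=; [rewrite ltr_pdivrMr ?mul1r; lra|lra].
apply/ler_addgt0Pl => e' e'0; rewrite addr0.
have C0 : 0 < B + 1 by rewrite ltr_wpDl.
have [N HN] := expr_small t01 (divr_gt0 e'0 C0).
have := bound N; rewrite cmod_div cmodX ler_pdivrMr ?exprn_gt0// => /le_trans; apply.
rewrite mulrAC -mulrA -expr_div_n -/t.
apply: le_trans (_ : _ <= (B + 1) * (e' / (B + 1))) _; last by rewrite mulrC divfK ?gt_eqF.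
by apply: ler_pM; rewrite ?exprn_ge0 ?lerDl//; [case/andP: t01|exact: HN].
Qed.

End IsolatedSingularities.

(** * Sphere-valued maps: finite values, neighbourhoods of infinity, order of a pole *)

Section SphereValued.
Variable R : realType.
Implicit Types (f : R[i] -> sphere R) (F h : R[i] -> R[i]).
Implicit Types (z w a b c l p : R[i]) (r s t x y e B M K : R).

(* Junk value 0 at infinity: finpart f is only meaningful where f is finite. *)
Definition finpart f : R[i] -> R[i] := fun z => odflt 0 (f z).

Lemma derivable_cdiff F a : derivable F a 1 -> cdiff F a.
Proof.
rewrite /derivable => /cvg_ex[/= l Hl].
exists (fun z => if z == a then l else (F z - F a) / (z - a)).
  apply/continuous_cmod => e e0.
  have nl : nbhs l [set w : R[i] | cmod (w - l) < e] by apply/nbhs_cmod; exists e.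
  have /nbhs_cmod[d d0 Hd] : nbhs (0 : R[i])
      [set k | k != 0 -> cmod (k^-1 * (F (k * 1 + a) - F a) - l) < e].
    exact: (Hl _ nl).
  exists d => // z zd; rewrite eqxx; case: eqVneq => [_|za]; first by rewrite subrr cmod0.
  have := Hd (z - a); rewrite subr0 => /(_ zd) /=; rewrite subr_eq0 => /(_ za).
  by rewrite mulr1 subrK mulrC.
apply/nbhs_cmod; exists 1 => // z _; case: eqVneq => [->|za].
  by rewrite subrr mulr0 addr0.
by rewrite divfK ?subr_eq0// addrC subrK.
Qed.

Lemma holomorphic_finite f a : holomorphic_at f a -> f a = Some (finpart f a).
Proof.
by move=> /nbhs_singleton[+ _]; rewrite /finpart; case: (f a).
Qed.

Lemma holomorphic_cdiff f a : holomorphic_at f a -> cdiff (finpart f) a.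
Proof. by move=> /nbhs_singleton[_ /derivable_cdiff]. Qed.

Lemma nbhs_infinity (A : set (sphere R)) : nbhs (infinity R) A ->
  A None /\ exists B, forall w, B < cmod w -> A (Some w).
Proof.
move=> [U [cU clU] sub]; split; first by apply: sub; right.
have [|N HN] := @compact_uniform R U (fun n z => cmod z <= n%:R) cU.
  move=> a _; exists 1 => //; exists (Num.truncn (cmod a + 1)).+1 => n z nN za.
  have := truncnS_gt (cmod a + 1);
  have : ((Num.truncn (cmod a + 1)).+1%:R : R) <= n%:R by rewrite ler_nat.
  by have := cmod_sub z a; lra.
exists N%:R => w Bw; apply: sub; left; exists w => //= Uw.
by have := HN N w (leqnn N) Uw; lra.
Qed.

Lemma infinity_nbhs B : nbhs (infinity R) [set v | forall w, v = Some w -> B < cmod w].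
Proof.
exists [set z : R[i] | cmod z <= B].
  have cl : closed [set z : R[i] | cmod z <= B] by move=> b; apply: closure_le.
  by split=> //; exact: (closed_bounded_compact cl (fun z H => H)).
by move=> v [[u /= nB <-] w [<-]|-> //]; rewrite ltNge; apply/negP.
Qed.

Lemma pole_near_infinity f p B : pole f p -> exists2 d, 0 < d &
  forall w, 0 < cmod (w - p) < d -> [/\ f w = Some (finpart f w),
    cdiff (finpart f) w & B < cmod (finpart f w)].
Proof.
move=> [_ hol lim].
have /nbhs_cmod[d1 d10 H1] : nbhs p [set w | w != p -> holomorphic_at f w].
  by move: hol; rewrite /dnbhs /within.
have /nbhs_cmod[d2 d20 H2] := lim _ (infinity_nbhs B).
exists (Num.min d1 d2); first by rewrite lt_min d10.
move=> w; rewrite lt_min => /andP[w0 /andP[w1 w2]].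
have wp : w != p by rewrite -subr_eq0 -cmod_gt0.
have hw := H1 w w1 wp; split; [exact: holomorphic_finite|exact: holomorphic_cdiff|].
exact: (H2 w w2 wp _ (holomorphic_finite hw)).
Qed.

Lemma pole_order f p : pole f p -> exists n d, 0 < d /\
  forall w, cmod (w - p) < d -> forall v, f w = Some v ->
    cmod v * cmod (w - p) ^+ n <= n%:R /\ cmod (w - p) < 1.
Proof.
move=> pp; have fp : f p = None by case: pp.
have [e e0 He] := pole_near_infinity 1 pp.
pose h w := (finpart f (p + w))^-1.
have hE w : 0 < cmod w < e -> [/\ f (p + w) = Some (finpart f (p + w)),
    cdiff (finpart f) (p + w) & 1 < cmod (finpart f (p + w))].
  by move=> we; apply: He; rewrite addrAC subrr add0r.
have f0 w : 0 < cmod w < e -> finpart f (p + w) != 0.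
  by move=> /hE[_ _ h1]; rewrite -cmod_gt0; apply: lt_trans h1.
have dh w : 0 < cmod w < e -> cdiff h w.
  move=> we; apply: cdiffV; last exact: f0.
  apply: (@cdiff_comp _ (finpart f) (fun w => p + w)); last by case: (hE w we).
  by apply: cdiffD; [exact: cdiff_cst|exact: cdiff_id].
have hB w : 0 < cmod w < e -> cmod (h w) <= 1.
  move=> we; have [_ _ h1] := hE w we; rewrite cmodV invf_le1 ?ltW//.
  by apply: lt_trans h1.
case: (finite_order e0 dh hB) => [[d d0 Hd]|[m [l [K [d [l0 d0 Hd]]]]]].
  pose t := Num.min d e / 2.
  have t0 : 0 < t by rewrite divr_gt0// lt_min d0.
  have de0 : 0 < Num.min d e by rewrite lt_min d0.
  have tde : t < Num.min d e by rewrite /t; lra.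
  move: (tde); rewrite lt_min => /andP[td te].
  have tC : cmod (t%:C : R[i]) = t by rewrite cmod_real ger0_norm// ltW.
  have tn : h t%:C != 0 by rewrite invr_eq0 f0// tC t0.
  by move: tn; rewrite Hd ?eqxx// tC t0.
have lp : 0 < cmod l by rewrite cmod_gt0.
have K0 : 0 < `|K| + 1 by rewrite ltr_wpDl.
pose n := maxn m (Num.truncn (2 / cmod l)).+1.
exists n, (Num.min (Num.min d e) (Num.min 1 (cmod l / 2 / (`|K| + 1)))); split.
  by rewrite !lt_min d0 e0 ltr01 !divr_gt0.
move=> w; rewrite !lt_min => /andP[/andP[wd we] /andP[w1 wK]] v fw.
split=> //; have wp : 0 < cmod (w - p).
  by rewrite cmod_gt0 subr_eq0; apply/eqP => wp; rewrite wp fp in fw.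
have wE : p + (w - p) = w by rewrite addrC subrK.
have [|fE _ _] := hE (w - p); first by rewrite wp.
have := f0 (w - p); rewrite wp => /(_ we).
rewrite wE in fE *; move: fE; rewrite fw => -[<-] v0.
have := Hd (w - p); rewrite wp => /(_ wd).
have -> : h (w - p) = v^-1 by rewrite /h wE /finpart fw.
set u := w - p in wp wd we w1 wK *.
have v_gt0 : 0 < cmod v by rewrite cmod_gt0.
have um0 : 0 < cmod u ^+ m by rewrite exprn_gt0.
move=> near_l.
have : cmod l / 2 <= cmod (v^-1 / u ^+ m).
  have := cmod_sub l (v^-1 / u ^+ m); rewrite cmodBC.
  have : K * cmod u <= cmod l / 2.
    apply: le_trans (_ : _ <= (`|K| + 1) * cmod u) _.
      by rewrite ler_wpM2r ?cmod_ge0// (le_trans (ler_norm K))// lerDl.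
    by rewrite mulrC -ler_pdivlMr// ltW.
  by lra.
rewrite cmod_div cmodV cmodX -invfM -[(_ * _)^-1]div1r ler_pdivlMr ?mulr_gt0// => h1.
have un : cmod u ^+ n <= cmod u ^+ m.
  by apply: ler_wiXn2l; rewrite ?cmod_ge0 ?leq_maxl// ltW.
have h2 : cmod v * cmod u ^+ n <= cmod v * cmod u ^+ m by rewrite ler_wpM2l ?cmod_ge0.
have h3 : 2 / cmod l <= n%:R.
  by apply: ltW (lt_le_trans (truncnS_gt _) _); rewrite ler_nat leq_maxr.
apply: le_trans h2 (le_trans _ h3).
by rewrite ler_pdivlMr//; lra.
Qed.

End SphereValued.

(** * Growth of transcendental functions *)

Section Growth.
Variable R : realType.
Implicit Types (f : R[i] -> sphere R) (F : R[i] -> R[i]).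
Implicit Types (z w a b c l p : R[i]) (r s t x y e B M K C : R).

Lemma cvg_infty_finite f v :
  (forall e, 0 < e -> exists M, forall z, M < cmod z ->
     f z = Some (finpart f z) /\ cmod (finpart f z - v) < e) ->
  f w @[w --> @at_infty R] --> (Some v : sphere R).
Proof.
move=> H A /nbhs_cmod[e e0 sub]; have [M HM] := H e e0.
by exists M => z /HM[fz /sub]; rewrite /= -fz.
Qed.

Lemma cvg_infty_infinity f :
  (forall B, exists M, forall z, M < cmod z ->
     f z = Some (finpart f z) /\ B < cmod (finpart f z)) ->
  f w @[w --> @at_infty R] --> infinity R.
Proof.
move=> H A /nbhs_infinity[_ [B HB]]; have [M HM] := H B.
by exists M => z /HM[fz /HB]; rewrite -fz.
Qed.

(** Under a polynomial bound, w^n F(1/w) is bounded near 0 and has a finite order m or vanishes. So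
    F vanishes or behaves like l z^(n-m), and [f] has a limit at infinity: infinity, 0 or l
    according to the sign of n - m. *)
Lemma transcendental_not_poly f r : 0 < r -> (forall z, r <= cmod z -> holomorphic_at f z) ->
  essential_singularity_at_infty f -> forall C n,
  ~ (forall z, r <= cmod z -> cmod (finpart f z) <= C * cmod z ^+ n).
Proof.
move=> r0 hol ess C n poly; apply: ess.
pose F := finpart f.
pose h w := F w^-1 * w ^+ n.
have wE w : 0 < cmod w < r^-1 -> w != 0 /\ r <= cmod w^-1.
  move=> /andP[w0 wr]; rewrite -cmod_gt0; split => //.
  by rewrite cmodV ltW// -[r]invrK ltf_pV2 ?posrE ?invr_gt0.
have ri0 : 0 < r^-1 by rewrite invr_gt0.
have dh w : 0 < cmod w < r^-1 -> cdiff h w.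
  move=> /wE[w0 wr]; apply: cdiffM; last by apply: cdiffX; exact: cdiff_id.
  apply: (@cdiff_comp _ F (fun w => w^-1)); last exact: holomorphic_cdiff (hol _ wr).
  by apply: cdiffV => //; exact: cdiff_id.
have hC w : 0 < cmod w < r^-1 -> cmod (h w) <= C.
  move=> /wE[w0 wr]; rewrite cmodM cmodX.
  apply: le_trans (ler_wpM2r _ (poly _ wr)) _; first by rewrite exprn_ge0// cmod_ge0.
  by rewrite cmodV exprVn -mulrA mulVf ?mulr1// expf_neq0// cmod_eq0.
have fE z : r < cmod z -> f z = Some (F z) by move=> /ltW/hol/holomorphic_finite.
have hE z : z != 0 -> F z = h z^-1 * z ^+ n.
  by move=> z0; rewrite /h invrK exprVn -mulrA mulVf ?mulr1// expf_neq0.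
have small d z : 0 < d -> d^-1 < cmod z -> 0 < cmod z^-1 < d.
  move=> d0 dz; have z0 : 0 < cmod z by apply: lt_trans dz; rewrite invr_gt0.
  by rewrite cmodV invr_gt0 z0 -[d]invrK ltf_pV2 ?posrE ?invr_gt0.
case: (finite_order ri0 dh hC) => [[d d0 Hd]|[m [l [K [d [l0 d0 Hd]]]]]].
  exists (Some 0); apply: cvg_infty_finite => e e0.
  exists (Num.max r d^-1) => z; rewrite gt_max => /andP[rz dz].
  have z0 : z != 0 by rewrite -cmod_gt0; exact: lt_trans rz.
  by rewrite -/F fE// hE// Hd ?small// mul0r subr0 cmod0.
have l_gt0 : 0 < cmod l by rewrite cmod_gt0.
have K0 : 0 < `|K| + 1 by rewrite ltr_wpDl.
have close e : 0 < e -> exists2 M, r < M & forall z, M < cmod z ->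
    cmod (F z * z ^+ m / z ^+ n - l) < e.
  move=> e0; exists (Num.max (r + 1) (Num.max d^-1 ((`|K| + 1) / e))).
    by rewrite lt_max ltrDl ltr01.
  move=> z; rewrite !gt_max => /andP[rz /andP[dz ze]].
  have z0 : 0 < cmod z by apply: lt_trans rz; rewrite ltr_wpDl// ltW.
  have zn0 : z != 0 by rewrite -cmod_gt0.
  have := Hd _ (small _ _ d0 dz).
  have -> : h z^-1 / z^-1 ^+ m = F z * z ^+ m / z ^+ n.
    by rewrite /h invrK !exprVn invrK mulrAC.
  move=> /le_lt_trans; apply; rewrite cmodV.
  apply: le_lt_trans (_ : _ <= (`|K| + 1) / cmod z) _.
    by rewrite ler_wpM2r ?invr_ge0 ?cmod_ge0// (le_trans (ler_norm K))// lerDl.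
  by rewrite ltr_pdivrMr// mulrC -ltr_pdivrMr.
have [nm|mn|mn] := ltngtP m n.
- exists None; apply: cvg_infty_infinity => B.
  have l2 : 0 < cmod l / 2 by rewrite divr_gt0.
  have [M rM HM] := close _ l2.
  exists (Num.max M (Num.max 1 (B / (cmod l / 2)))) => z.
  rewrite !gt_max => /andP[Mz /andP[z1 ze]]; have rz := lt_trans rM Mz.
  have z0 : 0 < cmod z by exact: lt_trans rz.
  rewrite -/F fE//; split => //.
  have zm0 : z ^+ m != 0 by rewrite expf_neq0// -cmod_gt0.
  have E1 : F z * z ^+ m / z ^+ n = F z / z ^+ (n - m).
    by rewrite -{1}(subnK (ltnW nm)) exprD invfM mulrACA mulfV// mulr1.
  have := HM z Mz; rewrite E1.
  set u := F z / _ => ul.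
  have : cmod l / 2 < cmod u by have := cmod_sub l u; rewrite [cmod (l - u)]cmodBC; lra.
  rewrite cmod_div cmodX ltr_pdivlMr ?exprn_gt0// => lF; apply: lt_trans lF.
  apply: lt_le_trans (_ : cmod l / 2 * cmod z <= _).
    by rewrite mulrC -ltr_pdivrMr.
  rewrite ler_wpM2l ?(ltW l2)// -{1}[cmod z]expr1.
  by rewrite ler_weXn2l ?subn_gt0// ltW.
- exists (Some 0); apply: cvg_infty_finite => e e0; have [M rM HM] := close 1 ltr01.
  exists (Num.max M (Num.max 1 ((cmod l + 1) / e))) => z.
  rewrite !gt_max => /andP[Mz /andP[z1 ze]]; have rz := lt_trans rM Mz.
  have z0 : 0 < cmod z by exact: lt_trans rz.
  rewrite -/F fE//; split => //; rewrite subr0.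
  have zn0 : z ^+ n != 0 by rewrite expf_neq0// -cmod_gt0.
  have E1 : F z * z ^+ m / z ^+ n = F z * z ^+ (m - n).
    by rewrite -{1}(subnK (ltnW mn)) exprD mulrA mulfK.
  have := HM z Mz; rewrite E1.
  set u := F z * _ => ul.
  have : cmod u <= cmod l + 1 by have := cmod_sub u l; lra.
  rewrite cmodM cmodX => u1.
  have : cmod (F z) * cmod z <= cmod l + 1.
    apply: le_trans u1; rewrite ler_wpM2l ?cmod_ge0//.
    by rewrite -{1}[cmod z]expr1 ler_weXn2l ?subn_gt0// ltW.
  rewrite -ler_pdivlMr// => /le_lt_trans; apply.
  by rewrite ltr_pdivrMr// mulrC -ltr_pdivrMr.
- exists (Some l); apply: cvg_infty_finite => e e0; have [M rM HM] := close e e0.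
  exists M => z Mz; have rz := lt_trans rM Mz; have := HM z Mz; rewrite mn.
  rewrite mulfK ?expf_neq0// -?cmod_gt0; last exact: lt_trans rz.
  by rewrite fE.
Qed.

End Growth.

(** * The maximum modulus: growth beyond powers, and doubling *)

Section MaximumGrowth.
Variable R : realType.
Implicit Types (z w a b c l p : R[i]) (s t x y e B M K C L : R).

(** The inner radius is there to leave out the poles. For x < r the set is empty and [sup] gives 0,
    so nonnegativity and monotonicity hold for every real x. *)
Definition maxmod (F : R[i] -> R[i]) (r x : R) : R :=
  sup [set cmod (F z) | z in [set z : R[i] | r <= cmod z <= x]].

Variables (F : R[i] -> R[i]) (r : R).
Hypothesis r0 : 0 < r.
Hypothesis dF : forall z, r <= cmod z -> cdiff F z.

Lemma compact_annulus x y : compact [set z : R[i] | x <= cmod z <= y].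
Proof.
apply: (@closed_bounded_compact _ _ y); last by move=> z /andP[].
move=> b clb /=; apply/andP; split.
  by apply: closure_ge clb => z /andP[].
by apply: closure_le clb => z /andP[].
Qed.

Lemma maxmod_attained x : r <= x -> exists2 z, r <= cmod z <= x &
  cmod (F z) = maxmod F r x.
Proof.
move=> rx; have [||a /= Aa Ha] := @compact_max R _ (fun z => cmod (F z)) (@compact_annulus r x).
- by exists r%:C; rewrite /= cmod_real gtr0_norm// lexx.
- move=> a /andP[ra _] e e0.
  have [d d0 Hd] := (continuous_cmod F a).1 (cdiff_cts (dF ra)) _ e0.
  by exists d => // z _ /Hd; exact: le_lt_trans (cmod_dist _ _).
exists a => //; apply/eqP; rewrite eq_le; apply/andP; split.
  by apply: ub_le_sup; [exists (cmod (F a)) => _ [z /Ha ? <-]|exists a].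
by apply: ge_sup; [exists (cmod (F a)), a|move=> _ [z /Ha ? <-]].
Qed.

Lemma maxmod_ge z x : r <= cmod z <= x -> cmod (F z) <= maxmod F r x.
Proof.
move=> /andP[rz zx]; have rx := le_trans rz zx.
apply: ub_le_sup; last by exists z; rewrite //= rz.
have [||a /= Aa Ha] := @compact_max R _ (fun z => cmod (F z)) (@compact_annulus r x).
- by exists r%:C; rewrite /= cmod_real gtr0_norm// lexx.
- move=> a /andP[ra _] e e0.
  have [d d0 Hd] := (continuous_cmod F a).1 (cdiff_cts (dF ra)) _ e0.
  by exists d => // w _ /Hd; exact: le_lt_trans (cmod_dist _ _).
by exists (cmod (F a)) => _ [w /Ha ? <-].
Qed.

Lemma maxmod_ge0 x : 0 <= maxmod F r x.
Proof.
have [rx|xr] := leP r x.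
  by have [z _ <-] := maxmod_attained rx; exact: cmod_ge0.
rewrite /maxmod [X in sup X](_ : _ = set0) ?sup0//.
by apply/seteqP; split => // _ [z /= /andP[rz zx] _]; have := le_trans rz zx; rewrite leNgt xr.
Qed.

Lemma maxmod_mono x y : x <= y -> maxmod F r x <= maxmod F r y.
Proof.
move=> xy; have [rx|xr] := leP r x.
  have [z /andP[rz zx] <-] := maxmod_attained rx.
  by apply: maxmod_ge; rewrite rz (le_trans zx).
rewrite {1}/maxmod [X in sup X](_ : _ = set0) ?sup0 ?maxmod_ge0//.
by apply/seteqP; split => // _ [z /= /andP[rz zx] _]; have := le_trans rz zx; rewrite leNgt xr.
Qed.

Hypothesis not_poly : forall C n,
  ~ (forall z, r <= cmod z -> cmod (F z) <= C * cmod z ^+ n).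

Let annulus_power n y B : 0 <= B ->
  (forall z, cmod z = r \/ cmod z = y -> cmod (F z) <= B * cmod z ^+ n) ->
  forall z, r <= cmod z <= y -> cmod (F z) <= B * cmod z ^+ n.
Proof.
move=> B0 HB z rzy; have z0 w : r <= cmod w -> 0 < cmod w by exact: lt_le_trans.
have : cmod (F z / z ^+ n) <= B.
  apply: (@max_annulus R (fun z => F z / z ^+ n) r y) => //.
  - move=> w /andP[rw _]; apply: cdiffM; first exact: dF.
    apply: cdiffV; first by apply: cdiffX; exact: cdiff_id.
    by rewrite expf_neq0// -cmod_gt0; exact: z0.
  - move=> w hw; have w0 : 0 < cmod w.
      by case: hw => -> //; case/andP: rzy => rz zy; exact: lt_le_trans r0 (le_trans rz zy).
    by rewrite cmod_div cmodX ler_pdivrMr ?exprn_gt0// HB.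
have zp : 0 < cmod z by case/andP: rzy => rz _; exact: z0.
by rewrite cmod_div cmodX ler_pdivrMr ?exprn_gt0.
Qed.

(** If the maximum modulus were at most y^n for arbitrarily large y, the maximum principle for F /
    z^n on the annuli up to these y would bound F by a multiple of |z|^n everywhere outside the
    disc. *)
Lemma growth_power n : exists y0, forall y, y0 <= y -> y ^+ n < maxmod F r y.
Proof.
apply: contrapT => H.
pose B := Num.max 1 (maxmod F r r / r ^+ n).
have B0 : 0 <= B by rewrite le_max ler01.
apply: (not_poly (C := B) (n := n)) => z rz.
have [y zy yn] : exists2 y, cmod z <= y & maxmod F r y <= y ^+ n.
  apply: contrapT => H'; apply: H; exists (cmod z) => y zy; rewrite ltNge; apply/negP => le.
  by apply: H'; exists y.
have ry := le_trans rz zy.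
apply: (@annulus_power n y) => //; last by rewrite rz.
move=> w [wE|wE].
  have := @maxmod_ge w r; rewrite wE lexx => /(_ isT) /le_trans; apply.
  by rewrite -ler_pdivrMr ?exprn_gt0// le_max lexx orbT.
have := @maxmod_ge w y; rewrite wE lexx ry => /(_ isT) /le_trans; apply.
apply: le_trans yn _; rewrite -{1}[y ^+ n]mul1r ler_wpM2r ?exprn_ge0 ?le_max ?lexx//.
exact: le_trans (ltW r0) ry.
Qed.

(** Comparison with z^n takes the place of convexity in log x. If doubling failed at y, with 2^n >
    L, the maximum principle for F / z^n up to 2 y, read where the maximum for y is attained, would
    bound it by L / 2^n < 1 times itself or by y^(n+1). *)
Lemma growth_double L : exists y0, forall y, y0 <= y -> L * maxmod F r y < maxmod F r (2 * y).
Proof.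
pose n := (Num.truncn `|L|).+1.
have Ln : L < 2 ^+ n.
  apply: le_lt_trans (ler_norm L) (lt_trans (truncnS_gt _) _).
  by rewrite -natrX ltr_nat ltn_expl.
have [y0 Hy0] := growth_power n.+1.
pose A := maxmod F r r / r ^+ n.
have A0 : 0 <= A by rewrite divr_ge0 ?maxmod_ge0 ?exprn_ge0// ltW.
exists (Num.max y0 (Num.max r A)) => y; rewrite !ge_max => /andP[yy0 /andP[ry Ay]].
rewrite ltNge; apply/negP => le.
have y_gt0 : 0 < y by exact: lt_le_trans ry.
have My := Hy0 y yy0.
have M0 : 0 < maxmod F r y by apply: lt_trans My; rewrite exprn_gt0.
have [z /andP[rz zy] zM] := maxmod_attained ry.
pose B := Num.max A (L * maxmod F r y / (2 * y) ^+ n).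
have y2 : 0 < 2 * y by rewrite mulr_gt0.
have := @annulus_power n (2 * y) B _ _ z; rewrite le_max A0 rz => /(_ isT).
have z2y : cmod z <= 2 * y by lra.
move=> /(_ _ z2y); rewrite zM => H.
have {}H : maxmod F r y <= B * cmod z ^+ n.
  apply: H => w [wE|wE].
    have := @maxmod_ge w r; rewrite wE lexx => /(_ isT) /le_trans; apply.
    by rewrite -ler_pdivrMr ?exprn_gt0// le_max lexx.
  have := @maxmod_ge w (2 * y); rewrite wE lexx andbT => /(_ _)/le_trans; apply; first lra.
  apply: le_trans le _.
  by rewrite -ler_pdivrMr ?exprn_gt0// le_max lexx orbT.
have zn : cmod z ^+ n <= y ^+ n by apply: lerXn2r; rewrite ?nnegrE ?cmod_ge0// ltW.
have : maxmod F r y <= B * y ^+ n.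
  by apply: le_trans H _; rewrite ler_wpM2l// le_max A0.
rewrite /B; case: (leP A) => AL.
  have -> : L * maxmod F r y / (2 * y) ^+ n * y ^+ n = L / 2 ^+ n * maxmod F r y.
    by rewrite exprMn; field; rewrite !expf_neq0 ?gt_eqF.
  rewrite leNgt => /negP; apply.
  rewrite -{2}[maxmod F r y]mul1r ltr_pM2r// ltr_pdivrMr ?exprn_gt0// mul1r//.
rewrite leNgt => /negP; apply; apply: le_lt_trans My.
by rewrite exprS ler_wpM2r ?exprn_ge0// ltW.
Qed.

End MaximumGrowth.

(** * Connected components *)

Section Components.
Variable R : realType.
Implicit Types (F h : R[i] -> R[i]) (O Q V A : set R[i]).
Implicit Types (z w a b c y p q : R[i]) (r s t e B M : R).

Lemma connected_ivt V (phi : R[i] -> R) a b t : connected V ->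
  (forall z, V z -> forall e, 0 < e -> exists2 d, 0 < d & forall w, V w ->
     cmod (w - z) < d -> `|phi w - phi z| < e) ->
  V a -> V b -> phi a <= t <= phi b -> exists2 q, V q & phi q = t.
Proof.
move=> cV cphi Va Vb /andP[at_ tb].
have : connected (phi @` V).
  apply: connected_continuous_connected => //.
  apply/subspace_continuousP => z Vz; apply/cvgrPdist_lt => e e0.
  have [d d0 H] := cphi z Vz e e0.
  rewrite near_withinE; apply/nbhs_cmod; exists d => // w wd Vw.
  by rewrite distrC; exact: H.
move=> /connected_intervalP /(_ (phi a) (phi b)) H.
have [q Vq qt] : (phi @` V) t by apply: H; [exists a|exists b|rewrite at_].
by exists q.
Qed.

Lemma connected_moduli V a b t : connected V -> V a -> V b -> cmod a <= t <= cmod b ->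
  exists2 q, V q & cmod q = t.
Proof.
move=> cV; apply: connected_ivt => // z _ e e0; exists e => // w _.
exact: le_lt_trans (cmod_dist _ _).
Qed.

Lemma convex_connected A :
  (forall a b t, A a -> A b -> 0 <= t <= 1 -> A (seg a b t)) -> connected A.
Proof.
move=> cA; have [[a Aa]|A0] := pselect (exists a, A a); last first.
  rewrite (_ : A = set0); first exact: connected0.
  by apply/seteqP; split => // z Az; apply: A0; exists z.
have -> : A = \bigcup_(b in A) (seg a b @` `[0, 1]).
  apply/seteqP; split => [b Ab|z [b Ab] [t t01 <-]].
    by exists b => //; exists 1; rewrite ?seg1//= in_itv /= ler01 lexx.
  by apply: cA => //; move: t01; rewrite /= in_itv.
apply: bigcup_connected.
  by exists a => b Ab; exists 0; rewrite ?seg0//= in_itv /= ler01 lexx.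
move=> b Ab; apply: connected_continuous_connected.
  by apply/connected_intervalP; exact: interval_is_interval.
apply: continuous_subspaceT => t A' /nbhs_cmod[e e0 sub].
have C0 : 0 < cmod (b - a) + 1 by rewrite ltr_wpDl ?cmod_ge0.
apply/nbhs_ballP; exists (e / (cmod (b - a) + 1)); first by rewrite /= divr_gt0.
move=> s; rewrite -ball_normE /= => st; apply: sub.
rewrite (_ : _ - _ = (s - t)%:C * (b - a)); last by rewrite /seg rmorphB; ring.
rewrite cmodM cmod_real distrC.
apply: le_lt_trans (_ : _ <= `|t - s| * (cmod (b - a) + 1)) _.
  by rewrite ler_wpM2l// lerDl.
by rewrite -ltr_pdivlMr.
Qed.

Lemma ball_connected a e : connected [set z | cmod (z - a) < e].
Proof.
apply: convex_connected => p q t /= pe qe /andP[t0 t1].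
rewrite (_ : _ - a = (1 - t)%:C * (p - a) + t%:C * (q - a)); last first.
  by rewrite /seg rmorphB rmorph1; ring.
apply: le_lt_trans (cmodD _ _) _; rewrite !cmodM !cmod_real !ger0_norm ?subr_ge0//.
have [->|tn0] := eqVneq t 0; first by rewrite subr0 mul1r mul0r addr0.
have tp : 0 < t by rewrite lt_def tn0.
have h1 : t * cmod (q - a) < t * e by rewrite ltr_pM2l.
have h2 : (1 - t) * cmod (p - a) <= (1 - t) * e by rewrite ler_wpM2l ?subr_ge0// ltW.
by lra.
Qed.

Lemma component_extends O b z e : O b -> closure (connected_component O b) z ->
  0 < e -> (forall w, cmod (w - z) < e -> O w) ->
  forall w, cmod (w - z) < e -> connected_component O b w.
Proof.
move=> Ob /closure_cmod clz e0 sub w we.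
have [v Vv vz] := clz e e0.
have cU : connected (connected_component O b `|` [set w | cmod (w - z) < e]).
  apply: connectedU; [by exists v| exact: component_connected|exact: ball_connected].
apply: (connected_component_max _ _ cU); last by right.
- by left; exact: connected_component_refl.
- by move=> u [|/sub//]; exact: connected_component_sub.
Qed.

Lemma open_ball O z : open O -> O z -> exists2 e, 0 < e & forall w, cmod (w - z) < e -> O w.
Proof. by move=> oO Oz; apply/nbhs_cmod; exact: open_nbhs_nbhs. Qed.

Lemma component_open O b : open O -> O b -> open (connected_component O b).
Proof.
move=> oO Ob; apply: open_cmod => z Vz.
have [e e0 sub] := open_ball oO (connected_component_sub Vz).
by exists e => //; apply: component_extends => //; exact: subset_closure.
Qed.

Lemma component_boundary O b z : open O -> O b -> closure (connected_component O b) z ->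
  O z -> connected_component O b z.
Proof.
move=> oO Ob clz Oz; have [e e0 sub] := open_ball oO Oz.
by apply: (component_extends Ob clz e0 sub); rewrite subrr cmod0.
Qed.

(** The maximum principle on a component: its boundary points lie outside [O], where |h| is at most
    [B], so a bounded component cannot contain a point with |h| > [B]. *)
Lemma component_escape O b h M B : open O -> O b ->
  (forall z, connected_component O b z -> cmod z <= M) ->
  (forall z, connected_component O b z -> cdiff h z) -> 0 <= B -> B < cmod (h b) ->
  (forall z, closure (connected_component O b) z -> ~ O z ->
     {for z, continuous h} /\ cmod (h z) <= B) -> False.
Proof.
move=> oO Ob bV dh B0 hb H.
have := @max_modulus R (connected_component O b) h B M (component_open oO Ob) bV dh B0.
move=> /(_ _ b (connected_component_refl Ob)); rewrite leNgt hb => /(_ _)/negP; apply => //.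
move=> z clz nVz e e0.
have nOz : ~ O z by move=> Oz; apply: nVz; exact: component_boundary.
have [cz Bz] := H z clz nOz.
by have [d d0 Hd] := boundary_cts cz Bz e0; exists d => // w _; exact: Hd.
Qed.

(** [Q] is the closure of the component at [b] of {|z| > r, |F| > B}. By [component_escape] it is
    unbounded, and by connectedness it then meets every circle beyond [b]. *)
Lemma unbounded_continuum F r b B : (forall z, r <= cmod z -> cdiff F z) ->
  r <= cmod b -> 0 <= B -> (forall z, cmod z = r -> cmod (F z) <= B) -> B < cmod (F b) ->
  exists Q, [/\ closed Q, forall q, Q q -> r <= cmod q /\ B <= cmod (F q) &
    forall t, cmod b <= t -> exists2 q, Q q & cmod q = t].
Proof.
move=> dF rb B0 HB Fb.
pose O := [set z | r < cmod z /\ B < cmod (F z)].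
have cF z e : r <= cmod z -> 0 < e ->
    exists2 d, 0 < d & forall w, cmod (w - z) < d -> cmod (F w - F z) < e.
  move=> rz; move: e.
  by apply/continuous_cmod; exact: cdiff_cts (dF _ rz).
have oO : open O.
  apply: open_cmod => z [rz Bz].
  have e0 : 0 < cmod (F z) - B by rewrite subr_gt0.
  have [d d0 Hd] := cF z _ (ltW rz) e0.
  exists (Num.min d (cmod z - r)); first by rewrite lt_min d0 subr_gt0.
  move=> w; rewrite lt_min => /andP[/Hd h1 h2]; split.
    by have := cmod_sub z w; rewrite cmodBC; lra.
  by have := cmod_sub (F z) (F w); rewrite cmodBC; lra.
have Ob : O b.
  split => //; rewrite lt_neqAle rb andbT; apply/eqP => /esym/HB.
  by rewrite leNgt Fb.
pose V := connected_component O b.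
have clV z : closure V z -> r <= cmod z /\ B <= cmod (F z).
  move=> clz; have rz : r <= cmod z.
    by apply: closure_ge clz => w /connected_component_sub[/ltW].
  split => //; apply/ler_addgt0Pl => e e0; have [d d0 Hd] := cF z e rz e0.
  have [w /connected_component_sub[_ Bw] /Hd] := (closure_cmod _ _).1 clz d d0.
  by have := cmod_sub (F w) (F z); lra.
have unb M : exists2 z, V z & M < cmod z.
  apply: contrapT => H.
  have VM z : V z -> cmod z <= M.
    by move=> Vz; rewrite leNgt; apply/negP => Mz; apply: H; exists z.
  have dFV z : V z -> cdiff F z by move=> /connected_component_sub[/ltW/dF].
  apply: (component_escape oO Ob VM dFV B0 Fb) => z clz nOz.
  have [rz Bz] := clV z clz; split; first exact: cdiff_cts (dF _ rz).
  rewrite leNgt; apply/negP => lt; have [zr|zr] := eqVneq (cmod z) r.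
    by have := HB z zr; rewrite leNgt lt.
  by apply: nOz; split => //; rewrite lt_neqAle eq_sym zr.
exists (closure V); split => //; first exact: closed_closure.
move=> t bt; have [z Vz tz] := unb t.
have [||q Vq qt] := @connected_moduli V b z t (@component_connected _ O b) _ Vz.
- exact: connected_component_refl.
- by rewrite bt ltW.
by exists q => //; exact: subset_closure.
Qed.

End Components.

(** * A two-constants theorem *)

Section ProductLowerBound.
Variable R : realType.

Lemma bin_le_exp n k : ('C(n, k) <= 2 ^ n)%N.
Proof.
have [nk|kn] := ltnP n k; first by rewrite bin_small.
rewrite -[2%N]/(1 + 1)%N expnDn (bigD1 (Ordinal (kn : k < n.+1)%N)) //=.
by rewrite !exp1n !muln1 leq_addr.
Qed.

(** A crude Stirling bound: (n+1)^n <= (2n)(2n-1)...(n+1) = C(2n, n) n!, and C(2n, n) <= 4^n. *)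
Lemma fact_lower n : (n.+1 ^ n <= n`! * 4 ^ n)%N.
Proof.
have h : (n.+1 ^ n <= (n + n) ^_ n)%N.
  rewrite ffact_prod -[X in (_ ^ X <= _)%N]card_ord -prod_nat_const.
  apply: leq_prod => i _; rewrite -addnBA ?(ltnW (ltn_ord i))//.
  by rewrite -addn1 leq_add2l subn_gt0.
apply: leq_trans h _; rewrite -bin_ffact mulnC leq_mul2l.
by rewrite (leq_trans (bin_le_exp _ _)) ?orbT// addnn -mul2n expnM.
Qed.

Lemma fact_split_lower n k : (k <= n)%N ->
  (n.+1 ^ n <= k`! * (n - k)`! * 8 ^ n)%N.
Proof.
move=> kn; apply: leq_trans (fact_lower n) _.
rewrite -(bin_fact kn) -[8%N]/(2 * 4)%N expnMn.
rewrite [(_ * 4 ^ n)%N]mulnC [leqRHS]mulnA [leqRHS]mulnC leq_mul2l.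
by rewrite [leqRHS]mulnC leq_mul2r bin_le_exp !orbT.
Qed.

Lemma nearest_index (t : R) n : exists2 k, (k <= n)%N &
  forall l, (l <= n)%N -> `|t - k%:R| <= `|t - l%:R|.
Proof.
elim: n => [|n [k kn Hk]]; first by exists 0%N => // l; rewrite leqn0 => /eqP ->.
have [le|lt] := leP `|t - k%:R| `|t - n.+1%:R|.
  exists k; first exact: leqW.
  by move=> l; rewrite leq_eqVlt => /orP[/eqP ->//|]; rewrite ltnS => /Hk.
exists n.+1 => // l; rewrite leq_eqVlt => /orP[/eqP ->//|]; rewrite ltnS => /Hk.
exact: le_trans (ltW lt).
Qed.

Lemma prod_ge_exp (u : nat -> R) (c : R) (v : nat -> nat) i j : 0 <= c ->
  (forall l, (i <= l < j)%N -> c * (v l)%:R <= u l) ->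
  c ^+ (j - i) * (\prod_(i <= l < j) v l)%N%:R <= \prod_(i <= l < j) u l.
Proof.
move=> c0 H; rewrite natr_prod -prodr_const_nat -big_split /=.
rewrite !big_nat; apply: ler_prod => l lij; rewrite H// mulr_ge0 ?ler0n//.
Qed.

(* Points on the circles of radius rho (1 + l / (n + 1)): their moduli are evenly
   spaced, so at most one of them can be very close to w. *)
Lemma prod_dist_lower (y : nat -> R[i]) (w : R[i]) (rho kappa : R) n :
  0 < rho -> 0 <= kappa ->
  (forall l, (l <= n)%N -> cmod (y l) = rho * (1 + l%:R / n.+1%:R)) ->
  (forall l, (l <= n)%N -> kappa <= cmod (w - y l)) ->
  kappa * (rho / 16) ^+ n <= \prod_(0 <= l < n.+1) cmod (w - y l).
Proof.
move=> rho0 kappa0 Hy Hk.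
have n0 : 0 < n.+1%:R :> R by rewrite ltr0n.
pose t := (cmod w / rho - 1) * n.+1%:R.
have [k kn Hnear] := nearest_index t n.
(* As [k] is the index nearest to [t], |t - l| >= |l - k| / 2, which explains the 2. The indices
   below and above [k] then contribute k! and (n - k)!, and [fact_split_lower] turns c (n + 1) / 8
   into rho / 16. *)
pose c := rho / (2 * n.+1%:R).
have c0 : 0 <= c by rewrite divr_ge0 ?mulr_ge0 ?(ltW rho0).
have dist l : (l <= n)%N -> c * `|l%:R - k%:R| <= cmod (w - y l).
  move=> ln; apply: le_trans (cmod_dist _ _); rewrite Hy//.
  have -> : cmod w - rho * (1 + l%:R / n.+1%:R) = rho / n.+1%:R * (t - l%:R).
    by rewrite /t; field; rewrite !gt_eqF.
  have cn : 0 <= rho / n.+1%:R by rewrite ltW// divr_gt0.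
  rewrite normrM (ger0_norm cn).
  have -> : c * `|l%:R - k%:R| = rho / n.+1%:R * (`|l%:R - k%:R| / 2).
    by rewrite /c; field; rewrite gt_eqF.
  rewrite ler_wpM2l// ler_pdivrMr// mulr_natr mulr2n.
  have := ler_normD (t - k%:R) (l%:R - t); have := Hnear l ln.
  rewrite [`|l%:R - t|]distrC.
  have -> : t - k%:R + (l%:R - t) = l%:R - k%:R by ring.
  by lra.
rewrite (@big_cat_nat _ _ _ k) //=; last exact: leqW.
rewrite (@big_ltn _ _ _ k) ?ltnS//.
have P1 : c ^+ (k - 0) * k`!%:R <= \prod_(0 <= l < k) cmod (w - y l).
  have <- : (\prod_(0 <= l < k) (k - l) = k`!)%N.
    by rewrite big_mkord -ffact_prod ffactnn.
  apply: prod_ge_exp => // l /andP[_ lk].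
  apply: le_trans (dist l (leq_trans (ltnW lk) kn)).
  by rewrite distrC natrB ?(ltnW lk)// ger0_norm// subr_ge0 ler_nat ltnW.
have P2 : c ^+ (n.+1 - k.+1) * (n - k)`!%:R <= \prod_(k.+1 <= l < n.+1) cmod (w - y l).
  have <- : (\prod_(k.+1 <= l < n.+1) (l - k) = (n - k)`!)%N.
    rewrite fact_prod -{1}[k.+1]add1n -[n.+1](subnK (leqW kn)) subSn// big_addn.
    rewrite addnK; apply: eq_big_nat => l _; rewrite addnK//.
  apply: prod_ge_exp => // l /andP[kl ln]; rewrite ltnS in ln.
  apply: le_trans (dist l ln).
  by rewrite natrB ?(ltnW kl)// ger0_norm// subr_ge0 ler_nat ltnW.
have : (c ^+ (k - 0) * k`!%:R) * (kappa * (c ^+ (n.+1 - k.+1) * (n - k)`!%:R)) <=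
  \prod_(0 <= l < k) cmod (w - y l) *
    (cmod (w - y k) * \prod_(k.+1 <= l < n.+1) cmod (w - y l)).
  apply: ler_pM => //; rewrite ?mulr_ge0 ?exprn_ge0 ?ler0n//.
  by apply: ler_pM => //; rewrite ?mulr_ge0 ?exprn_ge0 ?ler0n ?Hk.
apply: le_trans; rewrite subn0 subSS.
have -> : c ^+ k * k`!%:R * (kappa * (c ^+ (n - k) * (n - k)`!%:R)) =
    kappa * (c ^+ n * (k`! * (n - k)`!)%N%:R).
  by rewrite -{3}(subnKC kn) exprD natrM; ring.
rewrite ler_wpM2l//.
have -> : (rho / 16) ^+ n = c ^+ n * ((n.+1 ^ n)%N%:R / 8 ^+ n).
  rewrite natrX -expr_div_n -exprMn; congr (_ ^+ n).
  by rewrite /c; field; rewrite gt_eqF.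
rewrite ler_wpM2l ?exprn_ge0// ler_pdivrMr ?exprn_gt0// -natrX -natrM ler_nat.
exact: fact_split_lower.
Qed.

End ProductLowerBound.

(** * Potentials with poles on a continuum *)

Section TwoConstants.
Variable R : realType.
Implicit Types (h F : R[i] -> R[i]) (Y : set R[i]) (z w a b q : R[i]).

(** [h] is at most [delta] on [Y] and at least [2 * delta] at the points z, so continuity and
    compactness keep them apart. No size of [kappa] is known. *)
Lemma uniform_separation h Y (r x rho delta : R) : closed Y ->
  (forall z, r <= cmod z <= rho -> cdiff h z) -> 0 < delta ->
  (forall y, Y y -> cmod y <= x -> r <= cmod y <= rho /\ cmod (h y) <= delta) ->
  exists2 kappa : R, 0 < kappa & forall z y, r <= cmod z <= rho -> 2 * delta <= cmod (h z) ->
    Y y -> cmod y <= x -> kappa <= cmod (z - y).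
Proof.
move=> clY dh d0 HY.
have cY : compact [set y | Y y /\ cmod y <= x].
  apply: (@closed_bounded_compact _ _ x); last by move=> y [].
  apply: closedI => // b; exact: closure_le.
have [|N HN] := @compact_uniform R _ (fun n y => forall z, r <= cmod z <= rho ->
    2 * delta <= cmod (h z) -> n.+1%:R^-1 <= cmod (z - y)) cY.
  move=> a [Ya ax]; have [ra ha] := HY a Ya ax.
  have [d dp Hd] := (continuous_cmod h a).1 (cdiff_cts (dh a ra)) _ d0.
  exists (d / 2); first by rewrite divr_gt0.
  exists (Num.truncn (2 / d)) => n y nN ya z rz hz; rewrite leNgt; apply/negP => zy.
  have nd : n.+1%:R^-1 <= d / 2.
    rewrite -[d / 2]invrK lef_pV2 ?posrE ?invr_gt0 ?divr_gt0// invf_div.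
    by apply: ltW (lt_le_trans (truncnS_gt _) _); rewrite ler_nat ltnS.
  have zy' : cmod (z - y) < d / 2 by exact: lt_le_trans zy nd.
  have za : cmod (z - a) < d by have := cmod_tri y z a; lra.
  by have := Hd z za; have := cmod_sub (h z) (h a); lra.
exists N.+1%:R^-1; first by rewrite invr_gt0 ltr0n.
by move=> z y rz hz Yy yx; exact: (HN N y (leqnn N) (conj Yy yx)).
Qed.

Lemma prodV_le (u : nat -> R[i]) (c : R) m : 0 < c ->
  (forall l, (l < m)%N -> c <= cmod (u l)) ->
  cmod (\prod_(0 <= l < m) (u l)^-1) <= c^-1 ^+ m.
Proof.
move=> c0 H; rewrite cmod_prod -[X in _ <= _ ^+ X]subn0 -prodr_const_nat.
rewrite !big_nat; apply: ler_prod => l /andP[_ lm]; rewrite cmod_ge0 cmodV.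
by rewrite lef_pV2 ?posrE// ?H// (lt_le_trans c0)// H.
Qed.

Lemma radii_bounds (rho : R) l m : 0 <= rho -> (l < m)%N ->
  rho <= rho * (1 + l%:R / m%:R) <= 2 * rho.
Proof.
move=> rho0 lm; have l0 : 0 <= l%:R / m%:R :> R by rewrite divr_ge0.
have l1 : l%:R / m%:R <= 1 :> R.
  by rewrite ler_pdivrMr ?ltr0n ?(leq_ltn_trans _ lm)// mul1r ler_nat ltnW.
apply/andP; split; first by rewrite ler_peMr// lerDl.
by rewrite mulrC ler_wpM2r// -[2]/(1 + 1) lerD2l.
Qed.

Lemma choose_radii Y (rho : R) m : 0 <= rho ->
  (forall u, rho <= u <= 2 * rho -> exists2 y, Y y & cmod y = u) ->
  exists y : nat -> R[i], forall l, (l < m)%N ->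
    Y (y l) /\ cmod (y l) = rho * (1 + l%:R / m%:R).
Proof.
move=> rho0 HY.
have ex l : exists y, (l < m)%N -> Y y /\ cmod y = rho * (1 + l%:R / m%:R).
  case: ltnP => [lm|_]; last by exists 0.
  by have [y Yy yE] := HY _ (radii_bounds rho0 lm); exists y.
by have [y Hy] := choice ex; exists y.
Qed.

(** The numerators satisfy |y_l| <= 2 rho, and [prod_dist_lower] bounds the denominators by (rho /
    16)^(m-1) kappa: each index costs 32, and [kappa] enters once. *)
Lemma potential_le (y : nat -> R[i]) w (rho kappa : R) m : 0 < rho -> 0 < kappa ->
  (forall l, (l < m)%N -> cmod (y l) = rho * (1 + l%:R / m%:R)) ->
  (forall l, (l < m)%N -> kappa <= cmod (w - y l)) ->
  cmod (\prod_(0 <= l < m) (1 - w / y l)^-1) <= (1 + rho / (16 * kappa)) * 32 ^+ m.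
Proof.
move=> rho0 kappa0 Hy Hw; rewrite cmod_prod.
case: (posnP m) => [->|m0].
  by rewrite big_geq// expr0 mulr1 lerDl divr_ge0 ?mulr_ge0 ?(ltW rho0) ?(ltW kappa0).
have ybd l : (l < m)%N -> 0 < cmod (y l) <= 2 * rho.
  by move=> lm; rewrite Hy//; have /andP[h1 ->] := radii_bounds (ltW rho0) lm; rewrite (lt_le_trans rho0).
have yE l : (l <= m.-1)%N -> cmod (y l) = rho * (1 + l%:R / m.-1.+1%:R).
  by rewrite prednK// => lm; apply: Hy; rewrite -(prednK m0).
have wy l : (l <= m.-1)%N -> kappa <= cmod (w - y l).
  by move=> lm; apply: Hw; rewrite -(prednK m0).
have := prod_dist_lower rho0 (ltW kappa0) yE wy; rewrite prednK// => low.
have low0 : 0 < kappa * (rho / 16) ^+ m.-1 by rewrite mulr_gt0// exprn_gt0// divr_gt0.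
have -> : \prod_(0 <= l < m) cmod (1 - w / y l)^-1 =
    (\prod_(0 <= l < m) cmod (y l)) / \prod_(0 <= l < m) cmod (w - y l).
  rewrite -prodfV -big_split /= !big_nat; apply: eq_bigr => l /andP[_ lm].
  rewrite -cmodV -cmodM -cmodN; congr cmod.
  have yn : y l != 0 by rewrite -cmod_gt0; case/andP: (ybd l lm).
  have [->|zyl] := eqVneq w (y l); first by rewrite divff// !subrr invr0 mulr0 oppr0.
  by field; rewrite subr_eq0 zyl /= yn subr_eq0 eq_sym.
rewrite ler_pdivrMr; last exact: lt_le_trans low.
have C0 : 0 <= 1 + rho / (16 * kappa).
  by rewrite addr_ge0// divr_ge0 ?mulr_ge0 ?(ltW rho0) ?(ltW kappa0).
apply: le_trans (_ : (1 + rho / (16 * kappa)) * 32 ^+ m * (kappa * (rho / 16) ^+ m.-1) <= _);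
  last by rewrite ler_wpM2l// mulr_ge0 ?exprn_ge0.
apply: le_trans (_ : (2 * rho) ^+ m <= _).
  rewrite -[X in _ <= _ ^+ X]subn0 -prodr_const_nat !big_nat; apply: ler_prod => l /andP[_ lm].
  by rewrite cmod_ge0; case/andP: (ybd l lm).
have -> : (1 + rho / (16 * kappa)) * 32 ^+ m * (kappa * (rho / 16) ^+ m.-1) =
    (1 + 16 * kappa / rho) * (2 * rho) ^+ m.
  have -> : (2 * rho) ^+ m = 32 ^+ m * (rho / 16) ^+ m by rewrite -exprMn; congr (_ ^+ _); field.
  rewrite -[in X in _ = _ * (_ * _ ^+ X)](prednK m0) exprS; field.
  by rewrite !gt_eqF.
rewrite ler_peMl ?exprn_ge0 ?mulr_ge0 ?(ltW rho0)//.
by rewrite lerDl divr_ge0 ?mulr_ge0 ?(ltW rho0) ?(ltW kappa0).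
Qed.

(* A quantitative two-constants theorem: h is small on a continuum Y crossing
   x <= |z| <= 2x.  Instead of harmonic measure one uses the explicit potential
   prod (1 - z / y_l) with y_l in Y, and the factor z^s damps the inner circle. *)
Lemma two_constants h Y z0 (r x A B delta : R) (q t s0 : nat) :
  0 < r -> r < x -> 1 <= cmod z0 -> 2 * r <= cmod z0 -> cmod z0 < x ->
  (0 < q)%N -> ((1 + cmod z0 / x) / (1 - r / x)) ^+ q <= 5 / 4 ->
  8 * x <= (11 / 10) ^+ q ->
  closed Y -> (forall u, x <= u <= 2 * x -> exists2 y, Y y & cmod y = u) ->
  (forall y, Y y -> cmod y <= 2 * x -> r <= cmod y /\ cmod (h y) <= delta) ->
  (forall z, r <= cmod z <= 8 * x -> cdiff h z) ->
  0 < delta ->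
  (forall z, cmod z = r -> cmod (h z) <= B) ->
  (forall z, cmod z = 8 * x -> cmod (h z) <= A) ->
  cmod (h z0) <= Num.max (B / 2 ^+ s0)
    (Num.max (A * (8 * x) ^+ s0 / 2 ^+ t) (2 * delta * (8 * x) ^+ s0 * 64 ^+ t)).
Proof.
move=> r0 rx z01 rz0 z0x q0 Hq1 Hq2 clY HY Ysmall dh delta0 hB hA.
have x0 : 0 < x by exact: lt_trans rx.
have x1 : 1 <= x by apply: le_trans z01 (ltW z0x).
have z0r : r <= cmod z0 <= 8 * x by apply/andP; split; lra.
have rE : cmod (r%:C : R[i]) = r by rewrite cmod_real gtr0_norm.
have xE : cmod ((8 * x)%:C : R[i]) = 8 * x by rewrite cmod_real ger0_norm// mulr_ge0// ltW.
have B0 : 0 <= B by apply: le_trans (hB r%:C rE); exact: cmod_ge0.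
have A0 : 0 <= A by apply: le_trans (hA (8 * x)%:C xE); exact: cmod_ge0.
set T := Num.max _ _.
have x8 : 1 <= 8 * x by lra.
have x8p : 0 <= 8 * x by lra.
have x8n n : 1 <= (8 * x) ^+ n by exact: exprn_ege1.
have n64 n : 1 <= 64 ^+ n :> R by apply: exprn_ege1; rewrite ler1n.
have [small|big] := leP (cmod (h z0)) (2 * delta).
  rewrite /T !le_max; apply/orP; right; apply/orP; right; apply: le_trans small _.
  have d2 : 0 <= 2 * delta by rewrite mulr_ge0 ?(ltW delta0).
  by rewrite -mulrA ler_peMr// mulr_ege1.
have T0 : 0 <= T by rewrite /T le_max divr_ge0// exprn_ge0.
have x28 : 2 * x <= 8 * x by lra.
have YS y : Y y -> cmod y <= 2 * x -> r <= cmod y <= 8 * x /\ cmod (h y) <= delta.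
  by move=> Yy yx; have [-> ->] := Ysmall y Yy yx; rewrite (le_trans yx).
have [kappa kappa0 Hkappa] := uniform_separation clY dh delta0 YS.
pose D := 1 + cmod z0 / x; pose E := 1 - r / x.
have D1 : 1 <= D by rewrite lerDl divr_ge0 ?cmod_ge0// ltW.
have D0 : 0 < D by exact: lt_le_trans D1.
have E0 : 0 < E by rewrite subr_gt0 ltr_pdivrMr// mul1r.
have E1 : E <= 1 by rewrite gerBl divr_ge0// ltW.
pose C := 1 + x / (16 * kappa).
have C1 : 1 <= C by rewrite lerDl divr_ge0 ?mulr_ge0// ltW.
have Cp : 0 <= C by exact: le_trans ler01 C1.
have Dp m : 0 <= D ^+ m by rewrite exprn_ge0// ltW.
(* The exponents q k, t q k and (s0 q + t) k are scaled by k: letting k tend to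
   infinity removes C, the cost of the one y_l that may be close to z. *)
suff key k : (cmod (h z0) ^+ q) ^+ k * 1 <= C * (T ^+ q) ^+ k.
  have : cmod (h z0) ^+ q <= T ^+ q.
    by apply: (le_of_powers _ _ ltr01 key); rewrite exprn_ge0 ?cmod_ge0.
  by rewrite ler_pXn2r ?nnegrE ?cmod_ge0.
rewrite mulr1 -!exprM.
set N := (q * k)%N; pose m := (t * q * k)%N; pose s := ((s0 * q + t) * k)%N.
have [y Hy] := choose_radii m (ltW x0) HY.
have ybd l : (l < m)%N -> x <= cmod (y l) <= 2 * x.
  by move=> lm; have [_ ->] := Hy l lm; exact: radii_bounds (ltW x0) lm.
have y0 l : (l < m)%N -> y l != 0.
  by move=> /ybd/andP[xy _]; rewrite -cmod_gt0; exact: lt_le_trans xy.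
pose P z : R[i] := \prod_(0 <= l < m) (1 - z / y l)^-1.
(* At [z0] the middle factor is 1 and |P| is at least D^(-m). The maximum principle is applied where
   |h| > 2 delta, a region free of the poles y_l; its boundary lies on the two circles and on |h| =
   2 delta, one for each entry of [T]. *)
pose psi z := h z ^+ N * (z / z0) ^+ s * P z.
have z0n : z0 != 0 by rewrite -cmod_gt0; exact: lt_le_trans z01.
have z0p : 0 < cmod z0 by rewrite cmod_gt0.
have psiE z : cmod (psi z) = cmod (h z) ^+ N * (cmod z / cmod z0) ^+ s * cmod (P z).
  by rewrite /psi !cmodM !cmodX cmod_div.
have psi_le z (a b c : R) : cmod (h z) <= a -> cmod z / cmod z0 <= b -> cmod (P z) <= c ->
    cmod (psi z) <= a ^+ N * b ^+ s * c.
  move=> ha hb hc; have q0z : 0 <= cmod z / cmod z0 by rewrite divr_ge0 ?cmod_ge0.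
  have a0 : 0 <= a by apply: le_trans ha; exact: cmod_ge0.
  have b0 : 0 <= b by exact: le_trans hb.
  rewrite psiE; apply: ler_pM => //; rewrite ?cmod_ge0 ?mulr_ge0 ?exprn_ge0 ?cmod_ge0//.
  apply: ler_pM; rewrite ?exprn_ge0 ?cmod_ge0//.
    by apply: lerXn2r; rewrite ?nnegrE ?cmod_ge0.
  by apply: lerXn2r; rewrite ?nnegrE ?cmod_ge0.
have Dm : D ^+ m <= (5 / 4) ^+ m.
  apply: lerXn2r; rewrite ?nnegrE ?(ltW D0) ?divr_ge0//.
  apply: le_trans Hq1; rewrite -/D -/E; apply: le_trans (_ : D / E <= _).
    by rewrite ler_pdivlMr// ler_piMr// ltW.
  by rewrite -{1}[D / E]expr1 ler_weXn2l// ler_pdivlMr// mul1r (le_trans E1).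
have sE : s = (s0 * N + t * k)%N by rewrite /s /N mulnDl mulnA.
have mE : m = (q * (t * k))%N by rewrite /m [(t * q)%N]mulnC mulnA.
have x8s : (8 * x) ^+ s <= ((8 * x) ^+ s0) ^+ N * (11 / 10) ^+ m.
  rewrite sE exprD exprM ler_wpM2l ?exprn_ge0//.
  rewrite mE [(11 / 10) ^+ _]exprM; apply: lerXn2r => //; rewrite nnegrE.
  by rewrite exprn_ge0// divr_ge0.
have TN (a : R) : 0 <= a -> a <= T -> a ^+ N <= T ^+ N by move=> a0 aT; apply: lerXn2r.
pose Bd := C * T ^+ N / D ^+ m.
have TBd : T ^+ N / D ^+ m <= Bd.
  by rewrite /Bd -mulrA ler_peMl// divr_ge0 ?exprn_ge0// ltW.
have Dm0 : 0 < D ^+ m by rewrite exprn_gt0.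
(* Here |z / z0| <= 1/2. The part [s0 * N] of the exponent [s] produces B / 2^s0, and the part
   [t * k] absorbs (D / E)^m <= (5/4)^(t k). *)
have inner z : cmod z = r -> cmod (psi z) <= Bd.
  move=> zr; apply: le_trans TBd.
  have hP : cmod (P z) <= E^-1 ^+ m.
    apply: prodV_le => // l lm; have /andP[xy _] := ybd l lm.
    have := cmod_sub 1 (z / y l); rewrite cmod1 cmod_div zr.
    have : r / cmod (y l) <= r / x.
      by rewrite ler_pM2l// lef_pV2 ?posrE//; exact: lt_le_trans xy.
    by rewrite /E; clear; lra.
  have hz : cmod z / cmod z0 <= 2^-1 by rewrite zr ler_pdivrMr//; move: rz0; clear; lra.
  apply: le_trans (psi_le z _ _ _ (hB z zr) hz hP) _.
  rewrite ler_pdivlMr// -[X in X <= _]mulrA -exprMn [E^-1 * D]mulrC.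
  have Tm : (D / E) ^+ m <= (5 / 4) ^+ (t * k).
    rewrite mE [(D / E) ^+ _]exprM; apply: lerXn2r => //; rewrite nnegrE ?divr_ge0//.
    by rewrite exprn_ge0// divr_ge0// ltW.
  apply: le_trans (_ : (B / 2 ^+ s0) ^+ N * (2^-1 ^+ (t * k) * (5 / 4) ^+ (t * k)) <= _).
    rewrite sE exprD [(B / _) ^+ _]expr_div_n -exprM -exprVn -!mulrA.
    by rewrite ler_wpM2l ?exprn_ge0// ler_wpM2l ?exprn_ge0 ?invr_ge0// ler_wpM2l ?exprn_ge0 ?invr_ge0.
  apply: le_trans (_ : (B / 2 ^+ s0) ^+ N * 1 <= _).
    rewrite ler_wpM2l ?exprn_ge0 ?divr_ge0 ?exprn_ge0// -exprMn.
    by apply: exprn_ile1; rewrite ?mulr_ge0 ?invr_ge0 ?divr_ge0//; clear; lra.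
  by rewrite mulr1; apply: TN; rewrite ?divr_ge0 ?exprn_ge0// /T le_max lexx.
(* Now |z / y_l| >= 4, so |P| <= 3^(-m), and (11/10) (5/4) / 3 < 1/2 leaves the 2^t in the
   denominator. *)
have outer z : cmod z = 8 * x -> cmod (psi z) <= Bd.
  move=> zx; apply: le_trans TBd.
  have hP : cmod (P z) <= 3^-1 ^+ m.
    apply: prodV_le => // l lm; have /andP[xy yx] := ybd l lm.
    have := cmod_sub (z / y l) 1; rewrite cmodBC cmod1 cmod_div zx.
    have : 4 <= 8 * x / cmod (y l).
      by rewrite ler_pdivlMr; [move: yx; clear; lra|exact: lt_le_trans xy].
    by clear; lra.
  have hz : cmod z / cmod z0 <= 8 * x by rewrite zx ler_pdivrMr// ler_peMr.
  apply: le_trans (psi_le z _ _ _ (hA z zx) hz hP) _.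
  rewrite ler_pdivlMr// -[X in X <= _]mulrA -exprMn.
  apply: le_trans (_ : A ^+ N * (((8 * x) ^+ s0) ^+ N * (11 / 10) ^+ m) * (3^-1 ^+ m * (5 / 4) ^+ m) <= _).
    rewrite [(3^-1 * D) ^+ m]exprMn; apply: ler_pM.
    - by rewrite mulr_ge0 ?exprn_ge0.
    - by rewrite mulr_ge0 ?Dp ?exprn_ge0 ?invr_ge0.
    - by rewrite ler_wpM2l ?exprn_ge0.
    by rewrite ler_wpM2l ?exprn_ge0 ?invr_ge0.
  apply: le_trans (_ : (A * (8 * x) ^+ s0 / 2 ^+ t) ^+ N <= _); last first.
    have x8n0 : 0 <= (8 * x) ^+ s0 by exact: le_trans (x8n s0).
    apply: TN; last by rewrite /T !le_max lexx orbT.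
    by rewrite divr_ge0 ?mulr_ge0 ?exprn_ge0.
  have -> : (A * (8 * x) ^+ s0 / 2 ^+ t) ^+ N = A ^+ N * ((8 * x) ^+ s0) ^+ N * 2^-1 ^+ m.
    by rewrite !exprMn -exprVn -[in X in _ * _ * X = _]exprM /N /m mulnA.
  rewrite -!mulrA ler_wpM2l ?exprn_ge0// ler_wpM2l ?exprn_ge0 ?(le_trans _ (x8n s0))//.
  rewrite -!exprMn; apply: lerXn2r; rewrite ?nnegrE; clear; lra.
(* The potential costs 32 per factor; (11/10) * 32 * (5/4) = 44 is covered by the base 64. *)
have level z : r <= cmod z <= 8 * x -> cmod (h z) = 2 * delta -> cmod (psi z) <= Bd.
  move=> rz hz.
  have hP : cmod (P z) <= C * 32 ^+ m.
    apply: potential_le => // l lm; have [Yy yE] := Hy l lm; first by [].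
    by apply: Hkappa; rewrite ?hz//; case/andP: (ybd l lm).
  have hz' : cmod z / cmod z0 <= 8 * x.
    by rewrite ler_pdivrMr//; case/andP: rz => _ /le_trans; apply; rewrite ler_peMr.
  have hz2 : cmod (h z) <= 2 * delta by rewrite hz.
  apply: le_trans (psi_le z _ _ _ hz2 hz' hP) _.
  have d2 : 0 <= 2 * delta by rewrite mulr_ge0 ?(ltW delta0).
  rewrite ler_pdivlMr//.
  apply: le_trans (_ : (2 * delta) ^+ N * (((8 * x) ^+ s0) ^+ N * (11 / 10) ^+ m) *
      (C * 32 ^+ m * (5 / 4) ^+ m) <= _).
    rewrite -[X in X <= _]mulrA; apply: ler_pM.
    - by rewrite mulr_ge0 ?exprn_ge0.
    - by rewrite mulr_ge0 ?Dp// mulr_ge0 ?exprn_ge0.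
    - by rewrite ler_wpM2l ?exprn_ge0.
    by rewrite ler_wpM2l// mulr_ge0 ?exprn_ge0.
  apply: le_trans (_ : C * (2 * delta * (8 * x) ^+ s0 * 64 ^+ t) ^+ N <= _); last first.
    have x8n0 : 0 <= (8 * x) ^+ s0 by exact: le_trans (x8n s0).
    rewrite ler_wpM2l//.
    apply: TN; last by rewrite /T !le_max lexx !orbT.
    by rewrite !mulr_ge0 ?exprn_ge0 ?(ltW delta0).
  have -> : (2 * delta * (8 * x) ^+ s0 * 64 ^+ t) ^+ N = (2 * delta) ^+ N * ((8 * x) ^+ s0) ^+ N * 64 ^+ m.
    by rewrite !exprMn -[in X in _ * _ * X = _]exprM /N /m mulnA.
  rewrite (_ : _ * _ * _ = C * ((2 * delta) ^+ N * ((8 * x) ^+ s0) ^+ N *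
    ((11 / 10) ^+ m * 32 ^+ m * (5 / 4) ^+ m))); last by ring.
  rewrite ler_wpM2l//.
  rewrite ler_wpM2l ?mulr_ge0 ?exprn_ge0 ?(le_trans _ (x8n s0))//.
  rewrite -!exprMn; apply: lerXn2r; rewrite ?nnegrE; clear; lra.
suff : cmod (psi z0) <= Bd.
  rewrite psiE divff ?gt_eqF// expr1n mulr1 /Bd ler_pdivlMr// => H.
  apply: le_trans H; rewrite -mulrA ler_peMr ?exprn_ge0 ?cmod_ge0//.
  rewrite /P cmod_prod -[X in D ^+ X]subn0 -prodr_const_nat -big_split /=.
  rewrite big_nat; apply: (big_ind (fun u : R => 1 <= u)) => [//|u v u1 v1|l /andP[_ lm]].
    exact: mulr_ege1.
  have /andP[xy _] := ybd l lm; have yp := lt_le_trans x0 xy.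
  have : cmod (1 - z0 / y l) <= D.
    apply: le_trans (cmodB _ _) _; rewrite cmod1 cmod_div lerD2l ler_pM2l//.
    by rewrite lef_pV2 ?posrE.
  rewrite cmodV => le; rewrite mulrC ler_pdivlMr ?mul1r//.
  rewrite cmod_gt0 subr_eq0; apply/eqP => z0y.
  have yz : y l = z0 by rewrite -[RHS](divfK (y0 l lm)) -z0y mul1r.
  by move: xy; rewrite yz leNgt z0x.
pose V := [set z | r < cmod z < 8 * x] `&` [set z | r <= cmod z <= 8 * x /\ 2 * delta < cmod (h z)].
have noty z l : r <= cmod z <= 8 * x -> 2 * delta <= cmod (h z) -> (l < m)%N -> z != y l.
  move=> rz hz lm; have [Yy _] := Hy l lm; have /andP[_ y2] := ybd l lm.
  have := Hkappa z (y l) rz hz Yy y2; apply: contraTneq => ->.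
  by rewrite subrr cmod0 -ltNge.
have dP z : r <= cmod z <= 8 * x -> 2 * delta <= cmod (h z) -> cdiff psi z.
  move=> rz hz; apply: cdiffM.
    apply: cdiffM; first by apply: cdiffX; exact: dh.
    by apply: cdiffX; apply: cdiffM; [exact: cdiff_id|exact: cdiff_cst].
  apply: cdiff_prod => l lm; apply: cdiffV.
    apply: cdiffB; first exact: cdiff_cst.
    by apply: cdiffM; [exact: cdiff_id|exact: cdiff_cst].
  rewrite subr_eq0; apply/eqP => /esym zy; move: (noty z l rz hz lm) => /eqP; apply.
  by rewrite -[LHS](divfK (y0 l lm)) zy mul1r.
have ch z e : r <= cmod z <= 8 * x -> 0 < e ->
    exists2 d, 0 < d & forall w, cmod (w - z) < d -> cmod (h w - h z) < e.
  by move=> rz; move: e; apply/continuous_cmod; exact: cdiff_cts (dh z rz).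
have oV : open V.
  apply: open_cmod => z [rz [rz' hz]].
  have e0 : 0 < cmod (h z) - 2 * delta by rewrite subr_gt0.
  have [d d0 Hd] := ch z _ rz' e0.
  have [d' d'0 Hd'] := open_ball (@open_annulus R r (8 * x)) rz.
  exists (Num.min d d'); first by rewrite lt_min d0.
  move=> w; rewrite lt_min => /andP[/Hd h1 /Hd' /= rw]; split => //; split.
    by case/andP: rw => /ltW -> /ltW ->.
  by have := cmod_sub (h z) (h w); rewrite cmodBC; move: h1; clear; lra.
have Bd0 : 0 <= Bd by rewrite divr_ge0// mulr_ge0// exprn_ge0.
apply: (max_modulus (V := V) (M := 8 * x) (h := psi)) => //.
- by move=> z [/andP[_ /ltW]].
- by move=> z [_ [rz /ltW hz]]; exact: dP.
- move=> b clb nVb e e0.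
  have rb : r <= cmod b by apply: closure_ge clb => w [/andP[/ltW]].
  have bx : cmod b <= 8 * x by apply: closure_le clb => w [/andP[_ /ltW]].
  have rbx : r <= cmod b <= 8 * x by rewrite rb.
  have hb : 2 * delta <= cmod (h b).
    apply/ler_addgt0Pl => e1 e10; have [d d0 Hd] := ch b e1 rbx e10.
    have [w [_ [_ hw]] /Hd] := (closure_cmod _ _).1 clb d d0.
    by have := cmod_sub (h w) (h b); move: hw; clear; lra.
  have [|d d0 Hd] := @boundary_cts R psi b Bd (cdiff_cts (dP b rbx hb)) _ e e0.
    have [br|br] := eqVneq (cmod b) r; first exact: inner.
    have [b8|b8] := eqVneq (cmod b) (8 * x); first exact: outer.
    apply: level => //; apply/eqP; rewrite eq_le hb andbT leNgt; apply/negP => hlt.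
    apply: nVb; split; last by split.
    by rewrite /= !lt_neqAle rb bx !andbT eq_sym br.
  by exists d => // w _; exact: Hd.
split; last by split.
by rewrite /=; apply/andP; split; move: rz0 r0 z0x x0; clear; lra.
Qed.

End TwoConstants.

(** * Covering of continua *)

Section Covering.
Variable R : realType.
Implicit Types (h F : R[i] -> R[i]) (Q Y : set R[i]) (z w a b : R[i]).

Lemma Bernoulli_upper (v : R) n : 0 <= v -> (1 + v) ^+ n * (1 - n%:R * v) <= 1.
Proof.
move=> v0; elim: n => [|n IH]; first by rewrite expr0 mul0r subr0 mulr1.
apply: le_trans IH; rewrite exprSr -mulrA ler_wpM2l ?exprn_ge0 ?addr_ge0//.
by rewrite -natr1; have := mulr_ge0 (ler0n R n) (mulr_ge0 v0 v0); have := mulr_ge0 v0 v0; lra.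
Qed.

Lemma Bernoulli_lower (v : R) n : 0 <= v -> 1 + n%:R * v <= (1 + v) ^+ n.
Proof.
move=> v0; elim: n => [|n IH]; first by rewrite expr0 mul0r addr0.
rewrite exprSr; apply: le_trans (ler_wpM2r _ IH); last by rewrite addr_ge0.
by rewrite -natr1; have := mulr_ge0 (ler0n R n) (mulr_ge0 v0 v0); lra.
Qed.

(** [q] must be small against x / c for the first bound and large against log x for the second. It
    is 2 p with p about x / (40 c): Bernoulli gives 1 / (1 - 1/5) = 5/4, and the square in
    (11/10)^(2 p) makes the lower bound quadratic in p, hence above 8 x. *)
Lemma scale_exponent (c : R) : 0 < c -> exists x0, forall x, x0 <= x ->
  exists q, [/\ (0 < q)%N, c < x, ((1 + c / x) / (1 - c / x)) ^+ q <= 5 / 4 &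
    8 * x <= (11 / 10) ^+ q].
Proof.
move=> c0; exists (40 * c * (100 * (640 * c) + 2)) => x xc.
pose p := Num.truncn (x / (40 * c)).
have c40 : 0 < 40 * c by rewrite mulr_gt0.
have xcp : 100 * (640 * c) + 2 <= x / (40 * c) by rewrite ler_pdivlMr// mulrC.
have px : p%:R <= x / (40 * c) by rewrite truncn_le; lra.
have xp : x / (40 * c) < p%:R + 1 by rewrite natr1; exact: truncnS_gt.
have p0 : 100 * (640 * c) <= p%:R by lra.
have p1 : 1 <= p%:R :> R by lra.
have cx : 80 * c <= x by move: xcp; rewrite ler_pdivlMr//; have := mulr_gt0 c0 c0; lra.
have x0 : 0 < x by lra.
exists (2 * p)%N; split.
- by rewrite muln_gt0 /= -(ltr0n R); lra.
- lra.
- have u0 : 0 <= c / x by rewrite divr_ge0 ?ltW.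
  have u1 : c / x <= 1 / 2 by rewrite ler_pdivrMr//; lra.
  have u2 : (1 + c / x) / (1 - c / x) <= 1 + 4 * (c / x).
    by rewrite ler_pdivrMr; [nra|lra].
  have v0 : 0 <= 4 * (c / x) by rewrite mulr_ge0.
  apply: le_trans (_ : (1 + 4 * (c / x)) ^+ (2 * p) <= _).
    by apply: lerXn2r => //; rewrite nnegrE ?divr_ge0//; lra.
  have := Bernoulli_upper (2 * p) v0.
  have : (2 * p)%:R * (4 * (c / x)) <= 1 / 5.
    move: px; rewrite ler_pdivlMr// natrM => px.
    rewrite (_ : _ * _ = (8 * (p%:R * c)) / x); last by ring.
    by rewrite ler_pdivrMr//; lra.
  have : 0 <= (1 + 4 * (c / x)) ^+ (2 * p) by rewrite exprn_ge0//; lra.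
  set X := _ ^+ _; set W := _ * (4 * _); nra.
have v0 : 0 <= 10^-1 :> R by rewrite invr_ge0.
have := Bernoulli_lower p v0; rewrite mulnC exprM.
have -> : 1 + 10^-1 = 11 / 10 :> R by field.
set X := (11 / 10) ^+ p => XB.
have X2 : (p%:R / 10) ^+ 2 <= X ^+ 2.
  apply: lerXn2r; rewrite ?nnegrE ?divr_ge0 ?exprn_ge0//; lra.
apply: le_trans X2.
move: xp; rewrite ltr_pdivrMr// => xp.
rewrite expr2; set P := p%:R in p0 p1 xp *.
have h1 : 100 * (640 * c) * P <= P * P by rewrite ler_wpM2r//; lra.
have h2 : c <= c * P by rewrite ler_peMr// ltW.
lra.
Qed.

Lemma ratio_mono (a b c x : R) q : 0 <= a -> a <= c -> 0 <= b -> b <= c -> c < x ->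
  ((1 + a / x) / (1 - b / x)) ^+ q <= ((1 + c / x) / (1 - c / x)) ^+ q.
Proof.
move=> a0 ac b0 bc cx; have c0 := le_trans a0 ac; have x0 := le_lt_trans c0 cx.
have E1 : 0 < 1 - b / x by rewrite subr_gt0 ltr_pdivrMr// mul1r (le_lt_trans bc).
have E2 : 0 < 1 - c / x by rewrite subr_gt0 ltr_pdivrMr// mul1r.
have D1 : 0 <= 1 + a / x by rewrite addr_ge0// divr_ge0// ltW.
have D2 : 0 <= 1 + c / x by rewrite addr_ge0// divr_ge0// ltW.
have le1 : (1 + a / x) / (1 - b / x) <= (1 + c / x) / (1 - c / x).
  apply: ler_pM => //; first by rewrite invr_ge0 ltW.
    by rewrite lerD2l ler_pM2r ?invr_gt0.
  by rewrite lef_pV2 ?posrE// lerD2l lerN2 ler_pM2r ?invr_gt0.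
by apply: lerXn2r le1; rewrite nnegrE divr_ge0// ltW.
Qed.

Lemma separation_annulus F Q (r s : R) : closed Q ->
  (forall z, r <= cmod z <= s -> cdiff F z) -> (forall z, r <= cmod z <= s -> ~ Q (F z)) ->
  exists2 kappa : R, 0 < kappa & forall z q, r <= cmod z <= s -> Q q -> kappa <= cmod (F z - q).
Proof.
move=> clQ dF nQ.
have [|N HN] := @compact_uniform R _ (fun n z => forall q, Q q -> n.+1%:R^-1 <= cmod (F z - q))
    (@compact_annulus R r s).
  move=> a ra; have [d d0 Hd] : exists2 d, 0 < d & forall q, cmod (q - F a) < d -> ~ Q q.
    apply: contrapT => H; apply: (nQ a ra); apply: clQ.
    apply/closure_cmod => e e0; apply: contrapT => H'; apply: H; exists e => // q qe Qq.
    by apply: H'; exists q.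
  have d2 : 0 < d / 2 by rewrite divr_gt0.
  have [e e0 He] := (continuous_cmod F a).1 (cdiff_cts (dF a ra)) _ d2.
  exists e => //; exists (Num.truncn (2 / d)) => n z nN ze q Qq.
  rewrite leNgt; apply/negP => zq; apply: (Hd q) => //.
  have nd : n.+1%:R^-1 <= d / 2.
    rewrite -[d / 2]invrK lef_pV2 ?posrE ?invr_gt0 ?divr_gt0// invf_div.
    by apply: ltW (lt_le_trans (truncnS_gt _) _); rewrite ler_nat ltnS.
  have zq' : cmod (F z - q) < d / 2 by exact: lt_le_trans zq nd.
  rewrite cmodBC in zq'.
  by have := cmod_tri (F z) q (F a); have := He z ze; move: zq'; clear; lra.
exists N.+1%:R^-1; first by rewrite invr_gt0 ltr0n.
by move=> z q rz Qq; exact: (HN N z (leqnn N) rz q Qq).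
Qed.

(* Polya's lemma on compositions, in the form: F maps r <= |z| <= 8 x onto some
   point of any continuum crossing rho <= |w| <= 2 rho, rho = maxmod F r x / K. *)
Lemma continuum_covering F (r : R) : 0 < r -> (forall z, r <= cmod z -> cdiff F z) ->
  (forall C n, ~ (forall z, r <= cmod z -> cmod (F z) <= C * cmod z ^+ n)) ->
  exists2 K : R, 1 <= K & exists x0, forall x, x0 <= x -> forall Q, closed Q ->
    (forall u, maxmod F r x / K <= u <= 2 * (maxmod F r x / K) ->
       exists2 q, Q q & cmod q = u) ->
    exists2 z, r <= cmod z <= 8 * x & Q (F z).
Proof.
move=> r0 dF np.
(* With t = 7 n the outer circle is harmless, since 32 * (11/10) / 2^7 = 11/40 < 1/2; [L] is what
   delta = L^(-n) needs to beat 64^(7 n). *)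
have [L L1 HL] : exists2 L : R, 1 <= L & forall n, L^-1 ^+ n * 64 ^+ (7 * n) = 8^-1 ^+ n.
  exists (8 * 64 ^+ 7); first by rewrite mulr_ege1 ?exprn_ege1// ler1n.
  move=> n; rewrite exprM -exprMn; congr (_ ^+ _).
  by rewrite invfM -mulrA mulVf ?mulr1// expf_neq0// pnatr_eq0.
(* On the continuum [Y] below, |F| >= K rho / 2 = (L + 1) * 2 rho, while 2 rho bounds the |y_l|;
   hence |1 - F / y_l| >= L. *)
pose K := 4 * (L + 1); have K8 : 8 <= K by rewrite /K; lra.
exists K; first lra.
pose c0 := Num.max 1 (2 * r); pose z0 : R[i] := c0%:C.
have c01 : 1 <= c0 by rewrite le_max lexx.
have c02 : 2 * r <= c0 by rewrite le_max lexx orbT.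
have z0E : cmod z0 = c0 by rewrite cmod_real ger0_norm//; lra.
pose c := c0 + maxmod F r c0.
have M0 := maxmod_ge0 r0 dF c0.
have rc0 : r <= c0 by lra.
have c_gt0 : 0 < c by rewrite /c; lra.
have [x1 Hx1] := scale_exponent c_gt0.
have [x2 Hx2] := growth_power r0 dF np 2.
exists (Num.max x1 (Num.max x2 K)) => x; rewrite !ge_max => /andP[xx1 /andP[xx2 xK]] Q clQ HQ.
apply: contrapT => noz.
set rho := maxmod F r x / K in HQ.
have [q [q0 cx Hq1 Hq2]] := Hx1 x xx1.
have Mx := Hx2 x xx2.
have x0 : 0 < x by lra.
have K0 : 0 < K by lra.
have xrho : x <= rho.
  rewrite ler_pdivlMr//; apply: le_trans (ltW Mx); rewrite expr2 ler_wpM2l//; lra.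
have rho0 : 0 < rho by lra.
have rhoE : maxmod F r x = K * rho by rewrite /rho mulrCA divff ?mulr1// gt_eqF.
have rx : r <= x by rewrite /c in cx; lra.
have [z1 /andP[rz1 z1x] z1M] := maxmod_attained r0 dF rx.
have [|||Y [clY Ysub HY]] := @unbounded_continuum R F r z1 (K * rho / 2) dF rz1.
- by rewrite divr_ge0// ltW// mulr_gt0.
- move=> z zr; apply: le_trans (_ : maxmod F r c0 <= _).
    by apply: maxmod_ge => //; rewrite zr lexx.
  have : 8 * rho <= K * rho by rewrite ler_wpM2r//; lra.
  by rewrite /c in cx; lra.
- by rewrite z1M rhoE; have := mulr_gt0 K0 rho0; lra.
have [kappa kappa0 Hkappa] := separation_annulus clQ
  (fun z rz => dF z (proj1 (andP rz))) (fun z rz Qz => noz (ex_intro2 _ _ z rz Qz)).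
pose C := 1 + rho / (16 * kappa).
have C1 : 1 <= C by rewrite lerDl ltW// divr_gt0// mulr_gt0.
have t01 : 0 <= (11 / 20 : R) < 1 by apply/andP; split; lra.
have e0 : 0 < (2 * C)^-1 by rewrite invr_gt0; lra.
have [N HN] := expr_small t01 e0.
(* [N] lets (11/20)^N absorb [C], which contains the separation constant. As [n] is a multiple of
   [q], (8 x)^k <= (11/10)^n. *)
pose k := N.+1; pose n := (q * k)%N.
have [y Hy] := choose_radii n (ltW rho0) HQ.
have ybd l : (l < n)%N -> rho <= cmod (y l) <= 2 * rho.
  by move=> ln; have [_ ->] := Hy l ln; exact: radii_bounds (ltW rho0) ln.
(* Differentiable because F misses [Q]. It is at most L^(-n) on [Y], where F is far larger than rho,
   but at least (1 + c / x)^(-n) at [z0], where F is small against rho. *)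
pose h z : R[i] := \prod_(0 <= l < n) (1 - F z / y l)^-1.
have y0 l : (l < n)%N -> 0 < cmod (y l).
  by move=> /ybd/andP[ry _]; exact: lt_le_trans ry.
pose B := (1 - c / x)^-1 ^+ n; pose A := C * 32 ^+ n; pose delta := L^-1 ^+ n.
have cx1 : c / x < 1 by rewrite ltr_pdivrMr// mul1r.
have crho : c / rho <= c / x by rewrite ler_pM2l// lef_pV2 ?posrE.
have Fy_le z l : r <= cmod z <= c0 -> (l < n)%N -> cmod (F z / y l) <= c / x.
  move=> rz ln; rewrite cmod_div; apply: le_trans crho; apply: ler_pM; rewrite ?cmod_ge0 ?invr_ge0 ?cmod_ge0//.
    by have := maxmod_ge r0 dF rz; rewrite /c; lra.
  by rewrite lef_pV2 ?posrE ?y0//; case/andP: (ybd l ln).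
have L0 : 0 < L by lra.
have rx' : r < x by rewrite /c in cx; lra.
have z01 : 1 <= cmod z0 by rewrite z0E.
have z02 : 2 * r <= cmod z0 by rewrite z0E.
have z0x : cmod z0 < x by rewrite z0E; rewrite /c in cx; lra.
have Hq : ((1 + cmod z0 / x) / (1 - r / x)) ^+ q <= 5 / 4.
  apply: le_trans Hq1; apply: ratio_mono; rewrite ?cmod_ge0 ?(ltW r0)//.
    by rewrite z0E lerDl.
  by apply: le_trans rc0 _; rewrite lerDl.
have {rx' Hq}: cmod (h z0) <= Num.max (B / 2 ^+ k)
    (Num.max (A * (8 * x) ^+ k / 2 ^+ (7 * n)) (2 * delta * (8 * x) ^+ k * 64 ^+ (7 * n))).
  apply: (@two_constants R h Y z0 r x A B delta q (7 * n) k r0 rx' z01 z02 z0x q0 Hq Hq2 clY).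
  - move=> u /andP[xu ux]; apply: HY; lra.
  - move=> p Yp p2; have [rp Fp] := Ysub p Yp; split => //.
    apply: prodV_le => // l ln.
    have := cmod_sub (F p / y l) 1; rewrite cmodBC cmod1 cmod_div.
    have : L + 1 <= cmod (F p) / cmod (y l).
      rewrite ler_pdivlMr ?y0//; apply: le_trans Fp.
      rewrite /K (_ : _ / 2 = (L + 1) * (2 * rho)); last by field.
      by rewrite ler_wpM2l//; [lra|case/andP: (ybd l ln)].
    by lra.
  - move=> z rz; apply: cdiff_prod => l ln; apply: cdiffV.
      apply: cdiffB; first exact: cdiff_cst.
      by apply: cdiffM; [apply: dF; case/andP: rz|exact: cdiff_cst].
    have yn : y l != 0 by rewrite -cmod_gt0 y0.
    rewrite subr_eq0; apply/eqP => /esym Fy; have [Qy _] := Hy l ln.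
    have := Hkappa z (y l) rz Qy.
    by rewrite -[F z](divfK yn) Fy mul1r subrr cmod0 leNgt kappa0.
  - by rewrite exprn_gt0// invr_gt0.
  - move=> z zr; apply: prodV_le => [|l ln]; first by rewrite subr_gt0.
    have rz : r <= cmod z <= c0 by rewrite zr lexx.
    by have := Fy_le z l rz ln; have := cmod_sub 1 (F z / y l); rewrite cmod1; lra.
  - move=> z zx; apply: potential_le => // l ln; have [Qy yE] := Hy l ln; first by [].
    by apply: Hkappa => //; rewrite zx; lra.
have D0 : 0 < 1 + c / x by rewrite ltr_wpDr// divr_ge0// ltW.
have hz0 : (1 + c / x)^-1 ^+ n <= cmod (h z0).
  rewrite /h cmod_prod -[X in _ ^+ X]subn0 -prodr_const_nat !big_nat.
  apply: ler_prod => l /andP[_ ln]; rewrite invr_ge0 (ltW D0) /= cmodV.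
  have rz : r <= cmod z0 <= c0 by rewrite z0E lexx andbT.
  have Fl := Fy_le z0 l rz ln.
  have := cmod_sub 1 (F z0 / y l); have := cmodB 1 (F z0 / y l); rewrite cmod1 => h1 h2.
  by rewrite lef_pV2 ?posrE//; lra.
have x8k : (8 * x) ^+ k <= (11 / 10) ^+ n.
  by rewrite /n exprM; apply: lerXn2r; rewrite ?nnegrE ?exprn_ge0 ?divr_ge0 ?mulr_ge0 ?(ltW x0).
have half : 2^-1 ^+ n <= (1 + c / x)^-1 ^+ n.
  apply: lerXn2r; rewrite ?nnegrE ?invr_ge0 ?(ltW D0)//.
  by rewrite lef_pV2 ?posrE// -[leRHS]/(1 + 1) lerD2l ltW.
have n1 : (N < n)%N by rewrite /n /k (leq_trans (ltnSn N))// leq_pmull.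
have pow0 (u : R) : 0 < u -> 0 < u ^+ n by exact: exprn_gt0.
(* The inner entry would give 2^k <= (5/4)^k. The other two are below 2^(-n), whereas |h(z0)| is at
   least 2^(-n). *)
move: hz0 => /le_trans H /H{H}; rewrite !le_max => /orP[|/orP[]].
- rewrite /B ler_pdivlMr ?exprn_gt0// => h1.
  have Ex0 : 0 < 1 - c / x by rewrite subr_gt0.
  have : 2 ^+ k <= (5 / 4) ^+ k :> R.
    apply: le_trans (_ : (((1 + c / x) / (1 - c / x)) ^+ q) ^+ k <= _); last first.
      apply: lerXn2r Hq1; rewrite nnegrE ?exprn_ge0 ?divr_ge0 ?(ltW Ex0) ?(ltW D0)//.
    rewrite -exprM -/n exprMn -ler_pdivrMl ?exprn_gt0// -exprVn.
    by rewrite mulrC [leLHS]mulrC.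
  rewrite leNgt => /negP; apply; rewrite ltrXn2r//; clear; lra.
- rewrite /A => /(le_trans half) h1.
  have : 2^-1 ^+ n <= C * (11 / 40) ^+ n.
    apply: le_trans h1 _.
    apply: le_trans (_ : C * 32 ^+ n * (11 / 10) ^+ n / 2 ^+ (7 * n) <= _).
      by rewrite ler_pM2r ?invr_gt0 ?exprn_gt0// ler_wpM2l// mulr_ge0 ?exprn_ge0// (le_trans _ C1).
    have <- : 32 ^+ n * (11 / 10) ^+ n / (2 ^+ 7) ^+ n = (11 / 40) ^+ n :> R.
      by rewrite -exprMn -expr_div_n; congr (_ ^+ n); field.
    by rewrite exprM !mulrA.
  rewrite leNgt => /negP; apply.
  have -> : (11 / 40) ^+ n = (11 / 20) ^+ n * 2^-1 ^+ n :> R.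
    by rewrite -exprMn; congr (_ ^+ n); field.
  rewrite mulrA -[ltRHS]mul1r ltr_pM2r ?pow0 ?invr_gt0//.
  apply: le_lt_trans (_ : _ <= C * (2 * C)^-1) _.
    by rewrite ler_wpM2l ?(le_trans _ C1)// HN// ltnW.
  have C0 : C != 0 by rewrite gt_eqF// (lt_le_trans _ C1).
  by rewrite invfM mulrCA divff// mulr1 invf_lt1// ltr1n.
- rewrite /delta => /(le_trans half) h1.
  have : 2^-1 ^+ n <= 2 * (11 / 80) ^+ n :> R.
    apply: le_trans h1 _.
    apply: le_trans (_ : 2 * L^-1 ^+ n * (11 / 10) ^+ n * 64 ^+ (7 * n) <= _).
      rewrite ler_pM2r ?exprn_gt0// ler_wpM2l// mulr_ge0 ?exprn_ge0 ?invr_ge0 ?(ltW L0)//.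
    rewrite mulrAC -[2 * _ * _]mulrA HL -mulrA -exprMn ler_wpM2l//.
    by rewrite (_ : 8^-1 * (11 / 10) = 11 / 80)//; field.
  rewrite leNgt => /negP; apply.
  have -> : (11 / 80) ^+ n = (11 / 40) ^+ n * 2^-1 ^+ n :> R.
    by rewrite -exprMn; congr (_ ^+ n); field.
  rewrite mulrA -[ltRHS]mul1r ltr_pM2r ?pow0 ?invr_gt0//.
  apply: le_lt_trans (_ : _ <= 2 * (11 / 40)) _; last by clear; lra.
  rewrite ler_pM2l// -[leRHS]expr1 ler_wiXn2l// ?(leq_ltn_trans _ n1)//; clear; lra.
Qed.

End Covering.

(** * Growth of commuting functions *)

Section NearPoles.
Variable R : realType.
Implicit Types (f g : R[i] -> sphere R) (Y : set R[i]) (z w a b c p v : R[i]).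

Lemma finite_uniform (T : choiceType) (S : set T) (P : nat -> T -> Prop) : finite_set S ->
  (forall p : T, S p -> exists N, forall n, (N <= n)%N -> P n p) ->
  exists N, forall n (p : T), (N <= n)%N -> S p -> P n p.
Proof.
move=> /finite_seqP[s ->]; elim: s => [|p s IH] H; first by exists 0%N => n p.
have [|N1 H1] := IH; first by move=> q qs; apply: H; rewrite /= inE qs orbT.
have [|N2 H2] := H p; first by rewrite /= inE eqxx.
exists (maxn N1 N2) => n q; rewrite geq_max => /andP[n1 n2] /=.
by rewrite inE => /orP[/eqP ->|]; [exact: H2|exact: H1].
Qed.

(** Local bounds at points of holomorphy and pole orders at poles, merged by compactness of the
    disc. The condition |w - p| < 1 is what lets a single exponent replace the different orders. *)
Lemma meromorphic_bound_near_poles f (r : R) : meromorphic f -> exists n : nat,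
  forall w v, cmod w <= r -> f w = Some v -> cmod v <= n%:R \/
    exists p, [/\ pole f p, cmod v * cmod (w - p) ^+ n <= n%:R & cmod (w - p) < 1].
Proof.
move=> mf.
have cD : compact [set w : R[i] | cmod w <= r].
  by apply: (@closed_bounded_compact _ _ r) => // b; exact: closure_le.
have [|N HN] := @compact_uniform R _ (fun n w => forall v, f w = Some v -> cmod v <= n%:R \/
    exists p, [/\ pole f p, cmod v * cmod (w - p) ^+ n <= n%:R & cmod (w - p) < 1]) cD.
  move=> a _; case: (mf a) => [ha|pa].
    have ca := cdiff_cts (holomorphic_cdiff ha).
    have [d d0 Hd] := (continuous_cmod _ a).1 ca 1 ltr01.
    exists d => //; exists (Num.truncn (cmod (finpart f a) + 1)).+1 => n w nN wd v fw.
    left; have := Hd w wd; rewrite {1}/finpart fw /= => va.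
    apply: le_trans (_ : cmod (finpart f a) + 1 <= _); first by have := cmod_sub v (finpart f a); lra.
    by apply: ltW (lt_le_trans (truncnS_gt _) _); rewrite ler_nat.
  have [m [d [d0 Hd]]] := pole_order pa.
  exists d => //; exists m => n w mn wd v fw; right; exists a.
  have [h1 h2] := Hd w wd v fw; split => //.
  apply: le_trans (_ : m%:R <= _); last by rewrite ler_nat.
  apply: le_trans h1; rewrite ler_wpM2l ?cmod_ge0//.
  by apply: ler_wiXn2l; rewrite ?cmod_ge0 ?ltW.
by exists N => w v wr fw; exact: (HN N w (leqnn N) wr v fw).
Qed.

Lemma dyadic_between (X : R) : 1 <= X -> exists t, X < 2 ^+ t <= 2 * X.
Proof.
move=> X1.
have ex : exists t, X < 2 ^+ t.
  exists (Num.truncn X).+1; apply: lt_trans (truncnS_gt _) _.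
  by rewrite -natrX ltr_nat ltn_expl.
exists (ex_minn ex); case: ex_minnP => [[|t]] Xt Hmin.
  by move: Xt; rewrite expr0 ltNge X1.
rewrite Xt /= exprS ler_pM2l// leNgt; apply/negP => /Hmin.
by rewrite ltnn.
Qed.

(** Two constants for G - p at a fixed [z0] with G z0 different from p: [s0] makes the inner entry
    smaller than |G z0 - p| and [t] does so for the outer one. The entry with [delta] must then
    carry the estimate, and its other factors are powers of the maximum modulus. *)
Lemma tract_lower_bound (G : R[i] -> R[i]) (r : R) (p : R[i]) : 0 < r ->
  (forall z, r <= cmod z -> cdiff G z) ->
  (forall C n, ~ (forall z, r <= cmod z -> cmod (G z) <= C * cmod z ^+ n)) ->
  exists N : nat, forall n, (N <= n)%N -> forall x, n%:R <= x ->
    forall Y (delta : R), 0 < delta -> closed Y ->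
    (forall u, x <= u <= 2 * x -> exists2 y, Y y & cmod y = u) ->
    (forall y, Y y -> cmod y <= 2 * x -> r <= cmod y /\ cmod (G y - p) <= delta) ->
    1 <= delta * maxmod G r (8 * x) ^+ n.
Proof.
move=> r0 dG np; pose M := maxmod G r.
(* Otherwise G equals p far out and is bounded, against [np] with exponent 0. *)
have [z0 [z01 z0r z0p]] : exists z0, [/\ 1 <= cmod z0, 2 * r <= cmod z0 & G z0 != p].
  apply: contrapT => H; pose c0 := Num.max 1 (2 * r).
  apply: (np (Num.max (cmod p) (M c0)) 0%N) => z rz; rewrite expr0 mulr1 le_max.
  have [zc|cz] := leP (cmod z) c0.
    by rewrite maxmod_ge ?orbT// rz.
  suff -> : G z = p by rewrite lexx.
  apply/eqP/negPn/negP => Gp; apply: H; exists z; split=> //.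
    by apply: le_trans (ltW cz); rewrite le_max lexx.
  by apply: le_trans (ltW cz); rewrite le_max lexx orbT.
pose d0 := cmod (G z0 - p); have d00 : 0 < d0 by rewrite cmod_gt0 subr_eq0.
pose B := M r + cmod p.
have Mr0 : 0 <= M r by exact: maxmod_ge0.
have B0 : 0 <= B by rewrite addr_ge0 ?cmod_ge0.
have [s0 Hs0] : exists s0, B / 2 ^+ s0 < d0.
  exists (Num.truncn (B / d0)).+1; rewrite ltr_pdivrMr ?exprn_gt0//.
  rewrite mulrC -ltr_pdivrMr//; apply: lt_trans (truncnS_gt _) _.
  by rewrite -natrX ltr_nat ltn_expl.
have c0 : 0 < cmod z0 + r by rewrite ltr_wpDl// cmod_ge0.
have [x1 Hx1] := scale_exponent c0.
have [x2 Hx2] := growth_power r0 dG np 1.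
(* One W each for 1 / d0 and for the factor 2, W^s0 for (8 x)^s0, and (W^(s0 + 4))^6 for 64^t. *)
pose m := (2 + s0 + 6 * (s0 + 4))%N.
pose X := Num.max x1 (Num.max x2 (2 + cmod p + d0^-1 + d0)).
exists (maxn m (Num.truncn X).+1) => n; rewrite geq_max => /andP[mn Xn] x nx Y delta delta0 clY HY Ysub.
have : X <= x.
  by apply: le_trans nx; apply: ltW (lt_le_trans (truncnS_gt _) _); rewrite ler_nat.
rewrite /X !ge_max => /andP[xx1 /andP[xx2 xbig]] {X Xn}.
have [q [q0 cx Hq1 Hq2]] := Hx1 x xx1.
have p0 := cmod_ge0 p; have di0 : 0 < d0^-1 by rewrite invr_gt0.
have x0 : 0 < x by move: xbig p0 di0 d00; clear; lra.
have M8 : 8 * x < M (8 * x) by rewrite -[X in X < _]expr1; apply: Hx2; move: xx2 x0; clear; lra.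
set W := M (8 * x) in M8 *.
have W1 : 1 <= W by move: M8 xbig p0 di0 d00; clear; lra.
pose A := W + cmod p.
have A0 : 0 <= A by move: W1 p0; rewrite /A; clear; lra.
have A2 : A <= 2 * W by move: M8 xbig p0 di0 d00 x0; rewrite /A; clear; lra.
have x8 : 1 <= 8 * x by move: xbig p0 di0 d00; clear; lra.
have AX1 : 1 <= A * (8 * x) ^+ s0 / d0.
  rewrite ler_pdivlMr// mul1r; apply: le_trans (_ : A * 1 <= _).
    by rewrite mulr1 /A; move: M8 xbig p0 di0 d00 x0; clear; lra.
  by rewrite ler_wpM2l// exprn_ege1.
(* The lower bound on 2^t brings the outer entry below [d0]; the upper bound keeps 64^t = (2^t)^6
   within a power of W. *)
have [t /andP[t1 t2]] := dyadic_between AX1.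
have dh z : r <= cmod z <= 8 * x -> cdiff (fun z => G z - p) z.
  by move=> /andP[rz _]; apply: cdiffB; [exact: dG|exact: cdiff_cst].
have rx : r < x by move: cx (cmod_ge0 z0); clear; lra.
have z0x : cmod z0 < x by move: cx r0; clear; lra.
have Hq : ((1 + cmod z0 / x) / (1 - r / x)) ^+ q <= 5 / 4.
  apply: le_trans Hq1; apply: ratio_mono; rewrite ?cmod_ge0 ?(ltW r0)//.
    by rewrite lerDl ltW.
  by rewrite lerDr cmod_ge0.
have hB z : cmod z = r -> cmod (G z - p) <= B.
  by move=> zr; apply: le_trans (cmodB _ _) _; rewrite lerD2r; apply: maxmod_ge => //; rewrite zr lexx.
have hA z : cmod z = 8 * x -> cmod (G z - p) <= A.
  move=> zx; apply: le_trans (cmodB _ _) _; rewrite lerD2r; apply: maxmod_ge => //.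
  by rewrite zx lexx andbT; move: rx x0; clear; lra.
have := @two_constants R (fun z => G z - p) Y z0 r x A B delta q t s0 r0 rx z01 z0r z0x q0 Hq Hq2 clY HY Ysub dh delta0 hB hA.
rewrite -/d0 !le_max leNgt Hs0 /= => /orP[|].
  by rewrite ler_pdivlMr ?exprn_gt0// mulrC -ler_pdivlMr// leNgt t1.
have t6 : 64 ^+ t = (2 ^+ t) ^+ 6 :> R by rewrite exprAC; congr (_ ^+ _); rewrite -natrX.
rewrite t6 => key.
have W2 : 2 <= W by move: M8 xbig p0 di0 d00; clear; lra.
have Wd : d0^-1 <= W by move: M8 xbig p0 di0 d00; clear; lra.
have W0 : 0 <= W by exact: le_trans W1.
have x8p : 0 <= 8 * x by exact: le_trans x8.
have x8W : (8 * x) ^+ s0 <= W ^+ s0 by apply: lerXn2r; rewrite ?nnegrE// ltW.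
have tW : 2 ^+ t <= W ^+ (s0 + 4).
  apply: le_trans t2 _; rewrite addnC exprD.
  rewrite (_ : 2 * _ = (2 * A * d0^-1) * (8 * x) ^+ s0); last by ring.
  apply: ler_pM => //; rewrite ?mulr_ge0 ?exprn_ge0 ?(ltW di0)//.
  rewrite (_ : W ^+ 4 = (W * (W * W)) * W); last by ring.
  apply: ler_pM => //; rewrite ?mulr_ge0 ?(ltW di0)//.
  apply: ler_pM => //; apply: le_trans A2 _.
  by rewrite ler_wpM2r.
have : d0 <= delta * W ^+ (1 + s0 + 6 * (s0 + 4)).
  apply: le_trans key _.
  rewrite (_ : 2 * delta * _ * _ = delta * (2 * (8 * x) ^+ s0 * (2 ^+ t) ^+ 6)); last by ring.
  rewrite ler_wpM2l ?(ltW delta0)//.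
  have -> : W ^+ (1 + s0 + 6 * (s0 + 4)) = W * W ^+ s0 * (W ^+ (s0 + 4)) ^+ 6.
    by rewrite -exprM -exprS -exprD add1n [(6 * _)%N]mulnC.
  apply: ler_pM; rewrite ?mulr_ge0 ?exprn_ge0//.
    by apply: ler_pM; rewrite ?exprn_ge0.
  by apply: lerXn2r; rewrite ?nnegrE ?exprn_ge0.
move=> key2.
have : 1 <= W * d0 by rewrite -ler_pdivrMr// div1r.
move=> /le_trans; apply.
apply: le_trans (_ : W * (delta * W ^+ (1 + s0 + 6 * (s0 + 4))) <= _).
  by rewrite ler_wpM2l.
rewrite mulrCA ler_wpM2l ?(ltW delta0)// -exprS.
by apply: ler_weXn2l.
Qed.

End NearPoles.

(** * The growth inequality for a commuting pair *)

Section CommutingGrowth.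
Variable R : realType.
Implicit Types (f g : R[i] -> sphere R) (z w a b c p v q : R[i]).

(* A component of {|G - p| < 2 delta} around a either contains a zero of G - p
   or, by the maximum principle for 1 / (G - p), crosses a dyadic annulus. *)
Lemma small_component (G : R[i] -> R[i]) (r delta : R) a p : 0 < r -> 2 * r <= cmod a ->
  (forall z, r <= cmod z -> cdiff G z) -> 0 < delta -> cmod (G a - p) <= delta ->
  let V := connected_component
    [set z | cmod a / 2 < cmod z < 2 * cmod a /\ cmod (G z - p) < 2 * delta] a in
  (forall z, V z -> G z != p) ->
  exists2 x, cmod a / 2 <= x <= cmod a &
    forall u, x <= u <= 2 * x -> exists2 y, closure V y & cmod y = u.
Proof.
move=> r0 ra dG delta0 Ga.
set O := [set z | _]; move=> V noz.
have a0 : 0 < cmod a by lra.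
have ra2 : r <= cmod a / 2 by lra.
have cG z e : r <= cmod z -> 0 < e ->
    exists2 d, 0 < d & forall w, cmod (w - z) < d -> cmod (G w - G z) < e.
  by move=> rz; move: e; apply/continuous_cmod; exact: cdiff_cts (dG z rz).
have Oa : O a by split; [apply/andP; split; lra|lra].
have oO : open O.
  apply: open_cmod => z [rz hz].
  have rz' : r <= cmod z by case/andP: rz => h _; apply: le_trans ra2 (ltW h).
  have e0 : 0 < 2 * delta - cmod (G z - p) by rewrite subr_gt0.
  have [d d0 Hd] := cG z _ rz' e0.
  have [d' d'0 Hd'] := open_ball (@open_annulus R (cmod a / 2) (2 * cmod a)) rz.
  exists (Num.min d d'); first by rewrite lt_min d0.
  move=> w; rewrite lt_min => /andP[/Hd h1 /Hd' /= rw]; split => //.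
  by have := cmod_tri (G z) (G w) p; move: h1; clear; lra.
have Va : V a by exact: connected_component_refl.
have clV z : closure V z -> cmod a / 2 <= cmod z <= 2 * cmod a.
  move=> clz; apply/andP; split.
    by apply: closure_ge clz => w /connected_component_sub[/andP[/ltW]].
  by apply: closure_le clz => w /connected_component_sub[/andP[_ /ltW]].
have [e [cle e_eq]] : exists e, closure V e /\ (cmod e = cmod a / 2 \/ cmod e = 2 * cmod a).
  apply: contrapT => noe.
  have VM z : V z -> cmod z <= 2 * cmod a by move=> /connected_component_sub[/andP[_ /ltW]].
  pose h z := (G z - p)^-1.
  have dh z : r <= cmod z -> G z != p -> cdiff h z.
    move=> rz Gz; apply: cdiffV; last by rewrite subr_eq0.
    by apply: cdiffB; [exact: dG|exact: cdiff_cst].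
  have dhV z : V z -> cdiff h z.
    move=> Vz; apply: dh; last exact: noz.
    by have [/andP[/ltW h1 _] _] := connected_component_sub Vz; exact: le_trans h1.
  have B0 : 0 <= (2 * delta)^-1 by rewrite invr_ge0 mulr_ge0// ltW.
  have Gap : 0 < cmod (G a - p) by rewrite cmod_gt0 subr_eq0; exact: noz.
  have ha : (2 * delta)^-1 < cmod (h a).
    by rewrite cmodV ltf_pV2 ?posrE ?mulr_gt0//; lra.
  apply: (component_escape oO Oa VM dhV B0 ha) => z clz nOz.
  have /andP[z1 z2] := clV z clz.
  have Gz : 2 * delta <= cmod (G z - p).
    rewrite leNgt; apply/negP => lt; apply: nOz; split => //.
    rewrite !lt_neqAle z1 z2 !andbT; apply/andP; split; apply/eqP => eq.
      by apply: noe; exists z; split => //; left.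
    by apply: noe; exists z; split => //; right.
  have Gz0 : 0 < cmod (G z - p) by apply: lt_le_trans Gz; rewrite mulr_gt0.
  split; last by rewrite cmodV lef_pV2 ?posrE ?mulr_gt0.
  apply: cdiff_cts; apply: dh; first exact: le_trans z1.
  by rewrite -subr_eq0 -cmod_gt0.
have cV : connected (closure V) by apply: connected_closure; exact: component_connected.
have cla : closure V a by exact: subset_closure.
(* If the closure of [V] reaches |z| = |a| / 2, it crosses the annulus from |a| / 2 to |a|; if it
   reaches 2 |a|, the one from |a| to 2 |a|. *)
case: e_eq => eE.
  exists (cmod a / 2); first by apply/andP; split; lra.
  move=> u /andP[u1 u2]; apply: (connected_moduli cV cle cla).
  by rewrite eE u1; lra.
exists (cmod a); first by apply/andP; split; lra.
by move=> u hu; apply: (connected_moduli cV cla cle); rewrite eE.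
Qed.

Lemma pole_not_holomorphic f p (r : R) : (forall z, r <= cmod z -> holomorphic_at f z) ->
  f p = None -> cmod p < r.
Proof.
move=> hol fp; rewrite ltNge; apply/negP => /hol/holomorphic_finite.
by rewrite fp.
Qed.

Lemma commuting_growth f g (r : R) : 0 < r -> meromorphic f -> finitely_many_poles f ->
  commuting f g ->
  (forall z, r <= cmod z -> holomorphic_at f z) ->
  (forall z, r <= cmod z -> holomorphic_at g z) ->
  (forall C n, ~ (forall z, r <= cmod z -> cmod (finpart f z) <= C * cmod z ^+ n)) ->
  (forall C n, ~ (forall z, r <= cmod z -> cmod (finpart g z) <= C * cmod z ^+ n)) ->
  exists2 K : R, 1 <= K & exists x0, forall x, x0 <= x ->
    maxmod (finpart g) r (maxmod (finpart f) r x / K) <=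
    2 * maxmod (finpart f) r (maxmod (finpart g) r (64 * x)).
Proof.
move=> r0 mf pf comm holf holg npf npg.
pose F := finpart f; pose G := finpart g.
have dF z : r <= cmod z -> cdiff F z by move=> /holf/holomorphic_cdiff.
have dG z : r <= cmod z -> cdiff G z by move=> /holg/holomorphic_cdiff.
have fE z : r <= cmod z -> f z = Some (F z) by move=> /holf/holomorphic_finite.
have gE z : r <= cmod z -> g z = Some (G z) by move=> /holg/holomorphic_finite.
have comm_at z : r <= cmod z -> f (G z) = g (F z).
  by move=> rz; have := comm z; rewrite (gE z rz) (fE z rz) /= => -[].
have [K K1 [xK HK]] := continuum_covering r0 dF npf.
exists K => //.
have [n1 Hn1] := meromorphic_bound_near_poles r mf.
(* The second half says that near p the values of f exceed the maximum of |g| on |z| = r; it serves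
   to exclude zeros of G - p. The poles being finite in number, one [n2] works for all. *)
pose P (n : nat) p := (forall x, n%:R <= x ->
    forall Y (delta : R), 0 < delta -> closed Y ->
    (forall u, x <= u <= 2 * x -> exists2 y, Y y & cmod y = u) ->
    (forall y, Y y -> cmod y <= 2 * x -> r <= cmod y /\ cmod (G y - p) <= delta) ->
    1 <= delta * maxmod G r (8 * x) ^+ n) /\
  (forall w, cmod (w - p) < n.+1%:R^-1 -> forall v, f w = Some v -> maxmod G r r < cmod v).
have [|n2 Hn2] := @finite_uniform _ _ P pf.
  move=> p pp; have [N1 HN1] := tract_lower_bound p r0 dG npg.
  have [d d0 Hd] := pole_near_infinity (maxmod G r r) pp.
  exists (maxn N1 (Num.truncn d^-1).+1) => n; rewrite geq_max => /andP[nN1 nd].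
  split; first by move=> x nx Y delta; exact: HN1 nx Y delta.
  move=> w wp v fw.
  have wpn : w != p by apply/eqP => wE; case: pp => fp _ _; rewrite wE fp in fw.
  have [|fw' _ big] := Hd w.
    rewrite cmod_gt0 subr_eq0 wpn /=; apply: lt_le_trans wp _.
    rewrite -[d]invrK lef_pV2 ?posrE ?invr_gt0//.
    by apply: ltW (lt_le_trans (truncnS_gt _) _); rewrite ler_nat leqW.
  by rewrite fw in fw'; case: fw' => ->.
have {Hn2} HP p : pole f p -> P n2 p by exact: Hn2 (leqnn n2).
(* Near a pole T / 2 <= n1 / delta^n1 and 1 / delta <= 2 M^n2. As [n1] and 2 are at most M, this is
   at most M to the exponent chosen here. *)
have [y1 Hy1] := growth_power r0 dF npf (1 + (n2 + 1) * n1).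
have [y2 Hy2] := growth_power r0 dG npg 1.
have [y3 Hy3] := growth_power r0 dF npf 2.
pose R0 := 2 * r + 2 * n2%:R.
(* Since T / 2 * delta^n1 <= n1, the second entry forces 2 delta < 1 / (n2 + 1), the range in which
   [P] applies. *)
pose T0 := Num.max (maxmod G r r) (n1%:R * (2 * n2.+1%:R) ^+ n1).
pose rho0 := Num.max r (Num.max y2 (Num.max (2 * T0 + 2 * n1%:R + 2) (maxmod F r R0 + 1))).
exists (Num.max xK (Num.max y3 (Num.max K (Num.max rho0 (Num.max y1 (Num.max y2 (n1%:R + 2))))))) => x.
rewrite !ge_max => /andP[xxK /andP[xy3 /andP[Kx /andP[rhox /andP[xy1 /andP[xy2 xn1]]]]]].
set rho := maxmod F r x / K; set M := maxmod G r (64 * x).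
have K0 : 0 < K by lra.
have x0 : 0 < x by lra.
have xrho : x <= rho.
  by rewrite ler_pdivlMr//; apply: le_trans (ltW (Hy3 x xy3)); rewrite expr2 ler_wpM2l// ltW.
case/and4P: rhox => rx y2x Tx Rx.
have rrho := le_trans rx xrho; have rhoy2 := le_trans y2x xrho.
have rhoT := le_trans Tx xrho; have rhoR := le_trans Rx xrho.
have rhoG : rho < maxmod G r rho by rewrite -[X in X < _]expr1; exact: Hy2.
have [b /andP[rb brho] bE] := maxmod_attained r0 dG rrho.
set T := maxmod G r rho in rhoG bE *.
have MGr := maxmod_ge0 r0 dG r.
have T0r : maxmod G r r <= T0 by rewrite le_max lexx.
have T0n : n1%:R * (2 * n2.+1%:R) ^+ n1 <= T0 by rewrite le_max lexx orbT.
have n10 : 0 <= n1%:R :> R by exact: ler0n.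
have T2 : T0 + n1%:R + 1 <= T / 2 by move: rhoT rhoG; clear; lra.
have [|||Q [clQ Qsub HQ]] := @unbounded_continuum R G r b (T / 2) dG rb.
- by move: T2 MGr T0r n10; clear; lra.
- move=> z zr; apply: le_trans (_ : maxmod G r r <= _).
    by apply: maxmod_ge => //; rewrite zr lexx.
  by move: T2 T0r n10; clear; lra.
- by rewrite bE; move: T2 MGr T0r n10; clear; lra.
(* Cutting [Q] down to |q| >= rho gives |F a| >= rho as well. This puts [a] far out and F a beyond
   |z| = r, as the case near a pole requires. *)
have [||a /andP[ra ax] [Qa rhoa]] := HK x xxK (Q `&` [set q | rho <= cmod q]).
- by apply: closedI => // c; exact: closure_ge.
- move=> u /andP[u1 u2]; have [q Qq qu] := HQ u (le_trans brho u1).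
  by exists q => //; split => //=; rewrite qu.
have [rc Gc] := Qsub _ Qa.
have fv : f (G a) = Some (G (F a)) by rewrite comm_at// gE.
have Ma : cmod (G a) <= M.
  by apply: maxmod_ge => //; rewrite ra /=; move: ax x0; clear; lra.
have M64 : 64 * x < M by rewrite -[X in X < _]expr1; apply: Hy2; move: xy2 x0; clear; lra.
suff : T / 2 <= maxmod F r M by clear; lra.
have [rv|vr] := leP r (cmod (G a)).
  apply: le_trans Gc _; apply: le_trans (_ : _ <= cmod (F (G a))) _.
    by move: fv; rewrite fE// => -[->].
  by apply: maxmod_ge => //; rewrite rv.
case: (Hn1 (G a) _ (ltW vr) fv) => [small|[p [pp Gp Gp1]]].
  by move: small Gc T2 MGr T0r; clear; lra.
have fp : f p = None by case: pp.
have [HP1 HP2] := HP p pp.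
pose delta := cmod (G a - p).
have delta0 : 0 < delta.
  by rewrite cmod_gt0 subr_eq0; apply/eqP => Gap; rewrite Gap fp in fv.
have Td : T / 2 * delta ^+ n1 <= n1%:R.
  by apply: le_trans Gp; rewrite ler_wpM2r ?exprn_ge0// ltW.
have n2p : 0 < 2 * n2.+1%:R :> R by rewrite mulr_gt0// ltr0n.
have dn2 : 2 * delta < n2.+1%:R^-1.
  rewrite ltNge; apply/negP => le.
  have h1 : 1 <= delta * (2 * n2.+1%:R).
    by move: le; rewrite -div1r ler_pdivrMr ?ltr0n// mulrA [delta * 2]mulrC.
  have : T / 2 <= T0.
    apply: le_trans (_ : T / 2 * (delta * (2 * n2.+1%:R)) ^+ n1 <= _).
      by rewrite ler_peMr ?exprn_ege1//; move: T2 MGr T0r n10; clear; lra.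
    rewrite exprMn mulrA; apply: le_trans T0n.
    by rewrite ler_wpM2r ?exprn_ge0// ltW.
  by move: T2 n10; clear; lra.
have R0a : R0 < cmod a.
  rewrite ltNge; apply/negP => aR.
  have : cmod (F a) <= maxmod F r R0 by apply: maxmod_ge => //; rewrite ra.
  by move: rhoa rhoR => /=; clear; lra.
have n20 : 0 <= n2%:R :> R by exact: ler0n.
have ra2 : 2 * r <= cmod a by move: R0a n20; rewrite /R0; clear; lra.
pose V := connected_component
    [set z | cmod a / 2 < cmod z < 2 * cmod a /\ cmod (G z - p) < 2 * delta] a.
have Oa : [set z | cmod a / 2 < cmod z < 2 * cmod a /\ cmod (G z - p) < 2 * delta] a.
  by split; [apply/andP; split|]; move: ra2 r0 delta0; rewrite /delta; clear; lra.
have Vr z : V z -> r <= cmod z.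
  by move=> /connected_component_sub[/andP[h _] _]; move: h ra2; clear; lra.
(* At a zero of G - p the function g o F = f o G has a pole, so F maps it into
   |z| < r; but F a is far out, so F V meets |z| = r, where g is bounded. *)
have noz z : V z -> G z != p.
  move=> Vz; apply/eqP => Gz.
  have Fz : cmod (F z) < r.
    by apply: (pole_not_holomorphic holg); rewrite -comm_at ?Gz//; exact: Vr.
  have [|||||w Vw Fw] := @connected_ivt R V (fun z => cmod (F z)) z a r.
  - exact: component_connected.
  - move=> w Vw e e0.
    have [d d0 Hd] := (continuous_cmod F w).1 (cdiff_cts (dF w (Vr w Vw))) e e0.
    by exists d => // w' _ /Hd; exact: le_lt_trans (cmod_dist _ _).
  - by [].
  - exact: connected_component_refl.
  - by rewrite (ltW Fz) (le_trans rrho).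
  have [_ Gw] := connected_component_sub Vw.
  have := HP2 (G w) (lt_trans Gw dn2); rewrite comm_at ?Vr// gE ?Fw// => /(_ _ erefl).
  by rewrite ltNge; move=> /negP; apply; apply: maxmod_ge => //; rewrite Fw lexx.
have [x' /andP[x'1 x'2] HY] := small_component r0 ra2 dG delta0 (lexx _) noz.
have d20 : 0 < 2 * delta by rewrite mulr_gt0.
have key : 1 <= 2 * delta * maxmod G r (8 * x') ^+ n2.
  apply: (HP1 x' _ (closure V) (2 * delta) d20 (@closed_closure _ V) HY).
    by apply: le_trans x'1; move: R0a r0; rewrite /R0; clear; lra.
  move=> y cly _; have ry : r <= cmod y by apply: closure_ge cly; exact: Vr.
  split=> //; apply/ler_addgt0Pl => e e0.
  have [d d0 Hd] := (continuous_cmod G y).1 (cdiff_cts (dG y ry)) e e0.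
  have [w /connected_component_sub[_ Gw] /Hd] := (closure_cmod _ _).1 cly d d0.
  have := cmod_tri (G w) (G y) p; rewrite [cmod (G y - G w)]cmodBC; move: Gw; clear; lra.
have x'64 : 8 * x' <= 64 * x by move: x'2 ax; clear; lra.
have {}key : 1 <= 2 * delta * M ^+ n2.
  apply: le_trans key _; rewrite ler_wpM2l ?(ltW d20)//.
  by apply: lerXn2r; rewrite ?nnegrE ?maxmod_ge0//; exact: maxmod_mono.
have M1 : 1 <= M by move: M64 xn1 n10; clear; lra.
have M0 : 0 <= M by exact: le_trans M1.
have M2 : 2 <= M by move: M64 xn1 n10; clear; lra.
have Mn1 : n1%:R <= M by move: M64 xn1 n10; clear; lra.
apply: le_trans (_ : M ^+ (1 + (n2 + 1) * n1) <= _); last first.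
  by apply: ltW; apply: Hy1; move: M64 xy1 x0; clear; lra.
have T20 : 0 <= T / 2 by move: T2 MGr T0r n10; clear; lra.
apply: le_trans (_ : T / 2 * (2 * delta * M ^+ n2) ^+ n1 <= _).
  by rewrite ler_peMr// exprn_ege1.
have -> : T / 2 * (2 * delta * M ^+ n2) ^+ n1 = T / 2 * delta ^+ n1 * (2 * M ^+ n2) ^+ n1.
  by rewrite -[RHS]mulrA -exprMn; congr (_ * _ ^+ _); ring.
have -> : M ^+ (1 + (n2 + 1) * n1) = M * (M * M ^+ n2) ^+ n1.
  by rewrite -exprS -exprM -exprS add1n addn1.
apply: ler_pM.
- by rewrite mulr_ge0// exprn_ge0// ltW.
- by rewrite exprn_ge0// mulr_ge0// exprn_ge0.
- exact: le_trans Td Mn1.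
apply: lerXn2r; rewrite ?nnegrE ?mulr_ge0 ?exprn_ge0//.
by rewrite ler_wpM2r ?exprn_ge0.
Qed.

End CommutingGrowth.

(** * Outer sets and outer sequences *)

Section OuterSets.
Variable R : realType.
Implicit Types (f g : R[i] -> sphere R) (gamma : set R[i]) (z w a b c p v q : R[i]).

Lemma jordan_curve_bounded gamma : jordan_curve gamma ->
  exists D : R, forall z, gamma z -> cmod z <= D.
Proof.
move=> [c [cc _ _ ->]].
have cK : compact (c @` `[0, 1]) by apply: continuous_compact => //; exact: segment_compact.
have [|N HN] := @compact_uniform R _ (fun n z => cmod z <= n%:R) cK.
  move=> a _; exists 1 => //; exists (Num.truncn (cmod a + 1)).+1 => n z nN za.
  have h1 := truncnS_gt (cmod a + 1).
  have h2 : ((Num.truncn (cmod a + 1)).+1%:R : R) <= n%:R by rewrite ler_nat.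
  have h3 := cmod_sub z a; apply: ltW; apply: le_lt_trans (lt_le_trans h1 h2).
  by move: za h3; clear; lra.
by exists N%:R => z cz; exact: (HN N z (leqnn N) cz).
Qed.

Lemma dist0_le gamma z : gamma z -> dist0 gamma <= cmod z.
Proof.
move=> gz; apply: ge_inf; last by exists z.
by exists 0 => _ [w _ <-]; exact: cmod_ge0.
Qed.

(** The ray from z away from 0 avoids the curve, so the component of z is unbounded. *)
Lemma exterior_outer gamma (D : R) z : (forall w, gamma w -> cmod w <= D) -> D < cmod z ->
  outer_set gamma z.
Proof.
move=> gD zD; apply: subset_closure.
have [D0|D0] := ltP D 0.
  have g0 w : (~` gamma) w.
    by move=> gw; have := le_lt_trans (gD w gw) D0; rewrite ltNge cmod_ge0.
  split=> //; move=> /bounded_cmod[M HM].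
  have := HM (`|M| + 1)%:C; rewrite cmod_real.
  have -> : `| `|M| + 1 | = `|M| + 1 by rewrite ger0_norm// addr_ge0.
  have c : connected_component (~` gamma) z (`|M| + 1)%:C.
    have cT : connected [set: R[i]] by apply: convex_connected.
    by apply: (connected_component_max _ _ cT).
  by move=> /(_ c); have := ler_norm M; lra.
have z0 : 0 < cmod z by exact: le_lt_trans zD.
pose ray := [set w | exists2 t : R, 1 <= t & w = t%:C * z].
have rayg : ray `<=` ~` gamma.
  move=> w [t t1 ->] /gD; rewrite cmodM cmod_real ger0_norm ?(le_trans ler01)//.
  by rewrite leNgt => /negP; apply; apply: lt_le_trans zD _; rewrite ler_peMl// cmod_ge0.
have rz : ray z by exists 1; rewrite ?mul1r.
have cray : connected ray.
  apply: convex_connected => _ _ t [x x1 ->] [y y1 ->] /andP[t0 t1].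
  exists (x + t * (y - x)); last by rewrite /seg rmorphD rmorphM rmorphB; ring.
  have : 0 <= t * (y - 1) by rewrite mulr_ge0// subr_ge0.
  have : 0 <= (1 - t) * (x - 1) by rewrite mulr_ge0// subr_ge0.
  lra.
split; first exact: rayg.
move=> /bounded_cmod[M HM].
have c : connected_component (~` gamma) z ((1 + `|M| / cmod z)%:C * z).
  apply: (connected_component_max rz rayg cray).
  by exists (1 + `|M| / cmod z); rewrite // lerDl divr_ge0// ltW.
have := HM _ c; rewrite cmodM cmod_real ger0_norm ?addr_ge0 ?divr_ge0 ?(ltW z0)//.
rewrite mulrDl mul1r divfK ?gt_eqF//.
by have := ler_norm M; lra.
Qed.

(** The disc |w| < d misses the curve and is connected. It contains a point of the surrounded
    circle, so all of it lies in a bounded component. *)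
Lemma outer_away gamma (r d : R) : 0 < r -> r < d ->
  surrounds gamma [set z | cmod z = r] -> (forall z, gamma z -> d <= cmod z) ->
  forall z, outer_set gamma z -> d <= cmod z.
Proof.
move=> r0 rd sur gd b; apply: closure_ge => z [gz unb]; rewrite leNgt; apply/negP => zd.
have ballg : [set w : R[i] | cmod (w - 0) < d] `<=` ~` gamma.
  by move=> w /=; rewrite subr0 => wd /gd; rewrite leNgt wd.
have rE : cmod (r%:C : R[i]) = r by rewrite cmod_real gtr0_norm.
have [gr bd] := sur r%:C rE.
apply: unb; have rz : connected_component (~` gamma) r%:C z.
  have cb : connected [set w : R[i] | cmod (w - 0) < d] by exact: ball_connected.
  by apply: (connected_component_max _ ballg cb) => /=; rewrite subr0// rE.
apply/bounded_cmod; move/bounded_cmod: bd => [M HM]; exists M => w zw; apply: HM.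
exact: connected_component_trans rz zw.
Qed.

(** Near [e] there is a point of an unbounded component, which by connectedness meets every larger
    circle. The outer set is thus a continuum of the kind needed in the covering lemma. *)
Lemma outer_moduli gamma e (rho : R) : outer_set gamma e -> cmod e < rho ->
  forall u, rho <= u -> exists2 q, outer_set gamma q & cmod q = u.
Proof.
move=> /closure_cmod cle erho u rhou.
have [|e' [ge' unb] e'e] := cle (rho - cmod e); first by rewrite subr_gt0.
have e'u : cmod e' <= u by have := cmod_sub e' e; lra.
have [w Cw uw] : exists2 w, connected_component (~` gamma) e' w & u <= cmod w.
  apply: contrapT => H; apply: unb; apply/bounded_cmod; exists u => w Cw.
  by rewrite leNgt; apply/negP => uw; apply: H; exists w => //; exact: ltW.
have [||||q Cq qu] := @connected_moduli R (connected_component (~` gamma) e') e' w u.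
- exact: component_connected.
- exact: connected_component_refl.
- by [].
- by rewrite e'u.
exists q => //; apply: subset_closure; split; first exact: connected_component_sub Cq.
move=> /bounded_cmod[M HM]; apply: unb; apply/bounded_cmod; exists M => w' Cw'; apply: HM.
exact: connected_component_trans (connected_component_sym Cq) Cw'.
Qed.

End OuterSets.

(** * Comparison of iterated growth functions *)

Section IterationGrowth.
Variable R : realType.
Variables (M MG : R -> R) (K theta : R).
Hypothesis K1 : 1 <= K.
Hypothesis M_mono : forall x y, x <= y -> M x <= M y.
Hypothesis MG_mono : forall x y, x <= y -> MG x <= MG y.
Hypothesis theta0 : 0 < theta.
Hypothesis M_ge : forall y, theta <= y -> y <= M y.
Hypothesis M_double : forall y, theta <= y -> 256 * K * M y <= M (2 * y).
Hypothesis comm_growth : forall y, theta <= y -> MG (M (y / 64) / K) <= 2 * M (MG y).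

(** [H] will bound the curves from above and [Phi] the outer sets from below; in these terms
    [comm_growth] reads MG o Phi <= H o MG. *)
Let H y := 2 * M y.
Let Phi y := M (y / 64) / K.

Let H_mono x y : x <= y -> H x <= H y.
Proof. by move=> xy; rewrite ler_pM2l// M_mono. Qed.

Let Phi_mono x y : x <= y -> Phi x <= Phi y.
Proof. by move=> xy; rewrite ler_pM2r ?invr_gt0 ?(lt_le_trans ltr01)// M_mono// ler_pM2r ?invr_gt0. Qed.

Let H_step w : theta <= w -> w <= H w.
Proof. by move=> tw; rewrite /H; have := M_ge tw; move: theta0; lra. Qed.

Let H_ge k y : theta <= y -> y <= iter k H y.
Proof.
move=> ty; elim: k => // k IH; rewrite iterS.
exact: le_trans IH (H_step (le_trans ty IH)).
Qed.

(** 128 = 2 * 64: Phi (128 h) = M (2 h) / K >= 256 M h = 128 H h, by the doubling hypothesis with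
    its factor 256 K. *)
Let Phi_iter k y : theta <= y -> 128 * iter k H y <= iter k Phi (128 * y).
Proof.
move=> ty; elim: k => // k IH /=; apply: le_trans (Phi_mono IH).
have tk := le_trans ty (H_ge k ty).
rewrite /Phi (_ : 128 * _ / 64 = 2 * iter k H y); last by field.
rewrite ler_pdivlMr ?(lt_le_trans ltr01)//; apply: le_trans (M_double tk).
by rewrite le_eqVlt; apply/orP; left; apply/eqP; rewrite /H; ring.
Qed.

Lemma iteration_large k Z : theta <= Z -> theta <= iter k Phi (128 * Z).
Proof.
move=> tZ; apply: le_trans (Phi_iter k tZ).
by have := H_ge k tZ; move: theta0 tZ; lra.
Qed.

(** MG (H^k D) <= MG (Phi^k (128 D)) <= H^k (MG (128 D)) <= H^k Z < 128 H^k Z <= Phi^k (128 Z). The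
    second inequality iterates [comm_growth]. *)
Lemma iteration_growth k D Z : theta <= D -> theta <= Z -> MG (128 * D) <= Z ->
  MG (iter k H D) < iter k Phi (128 * Z).
Proof.
move=> tD tZ DZ.
have MGk : MG (iter k Phi (128 * D)) <= iter k H (MG (128 * D)).
  elim: k => // k IH /=; apply: le_trans (H_mono IH); apply: comm_growth.
  by have := Phi_iter k tD; have := H_ge k tD; move: theta0 tD; lra.
have HZ : iter k H (MG (128 * D)) <= iter k H Z.
  by elim: k {MGk} => //= k IH; exact: H_mono.
apply: lt_le_trans (Phi_iter k tZ).
have := H_ge k tZ => hZ.
apply: le_lt_trans (_ : _ <= iter k H Z) _; last by move: theta0 tZ; lra.
apply: le_trans HZ; apply: le_trans MGk; apply: MG_mono.
by have := Phi_iter k tD; have := H_ge k tD; move: theta0 tD; lra.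
Qed.

End IterationGrowth.

(** * Orbits and the eventual position of the curves *)

Section OuterSequences.
Variable R : realType.
Implicit Types (f g : R[i] -> sphere R) (z w a b c p v q : R[i]).

Lemma poles_bounded f : finitely_many_poles f -> exists r : R, forall p, pole f p -> cmod p < r.
Proof.
move=> pf.
have [|N HN] := @finite_uniform _ _ (fun n p => cmod p < n%:R :> R) pf.
  move=> p _; exists (Num.truncn (cmod p)).+1 => n pn.
  by apply: lt_le_trans (truncnS_gt _) _; rewrite ler_nat.
by exists N%:R => p; exact: HN.
Qed.

Lemma holomorphic_outside f (r : R) : meromorphic f -> (forall p, pole f p -> cmod p < r) ->
  forall z, r <= cmod z -> holomorphic_at f z.
Proof. by move=> mf H z rz; case: (mf z) => // /H; rewrite ltNge rz. Qed.

Lemma iterate_orbit f z (u : nat -> R[i]) : (forall n, iterate f n z = Some (Some (u n))) ->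
  u 0%N = z /\ forall n, f (u n) = Some (u n.+1).
Proof.
move=> Hu; split; first by have := Hu 0%N; rewrite /iterate /= => -[].
by move=> n; have := Hu n.+1; rewrite /iterate iterS -/(iterate f n z) Hu /= => -[].
Qed.

Lemma iterate_commute f g z w (u : nat -> R[i]) : commuting f g ->
  (forall n, iterate f n z = Some (Some (u n))) -> g z = Some w ->
  forall n, iterate f n w = Some (g (u n)).
Proof.
move=> comm Hu gz; have [u0 uS] := iterate_orbit Hu.
elim=> [|n IH]; first by rewrite /iterate /= u0 gz.
by rewrite /iterate iterS -/(iterate f n w) IH comm uS.
Qed.

Lemma dist0_eventually (gamma : nat -> set R[i]) : dist0 (gamma n) @[n --> \oo] --> +oo ->
  forall d : R, exists N, forall n z, (N <= n)%N -> gamma n z -> d <= cmod z.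
Proof.
move=> /cvgryPge H d; have [N _ HN] := H d.
by exists N => n z nN gz; apply: le_trans (HN n nN) (dist0_le gz).
Qed.

End OuterSequences.

Theorem theorem1p2 (R : realType) (f g : R[i] -> sphere R)
  (hf : transcendental_meromorphic f) (hg : transcendental_meromorphic g)
  (pf : finitely_many_poles f) (pg : finitely_many_poles g)
  (hfg : commuting f g)
  (gamma : nat -> set R[i]) (hgamma : outer_sequence f gamma)
  (z : R[i]) (hz : escaping f z) (hzA : ~ fast_escaping f gamma z) :
  ~ (Some @` fast_escaping f gamma) (g z).
Proof.
move=> [w [l [l1 fast]] gz]; apply: hzA.
have [u [Hu uinf]] := hz.
have [u0 uS] := iterate_orbit Hu.
have Gu := iterate_commute hfg Hu (esym gz).
case: hgamma => jordan [r [[r_gt0 poles sur] dist image preimage]].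
have [rg Hrg] := poles_bounded pg.
pose r1 := Num.max r rg.
have r10 : 0 < r1 by rewrite lt_max r_gt0.
have rr1 : r <= r1 by rewrite le_max lexx.
have holf : forall a, r1 <= cmod a -> holomorphic_at f a.
  apply: holomorphic_outside hf.1 _ => p /poles pr; exact: lt_le_trans pr rr1.
have holg : forall a, r1 <= cmod a -> holomorphic_at g a.
  by apply: holomorphic_outside hg.1 _ => p /Hrg pr; rewrite lt_max pr orbT.
have npf := transcendental_not_poly r10 holf hf.2.
have npg := transcendental_not_poly r10 holg hg.2.
pose F := finpart f; pose G := finpart g.
have dF a : r1 <= cmod a -> cdiff F a by move=> /holf/holomorphic_cdiff.
have dG a : r1 <= cmod a -> cdiff G a by move=> /holg/holomorphic_cdiff.
have fE a : r1 <= cmod a -> f a = Some (F a) by move=> /holf/holomorphic_finite.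
have gE a : r1 <= cmod a -> g a = Some (G a) by move=> /holg/holomorphic_finite.
have [K1 K11 [x1 Hx1]] := continuum_covering r10 dF npf.
have [K2 K21 [x2 Hx2]] := commuting_growth r10 hf.1 pf hfg holf holg npf npg.
(* Enlarging the constant only lowers M x / K, so one K serves both estimates. *)
pose K := Num.max K1 K2.
have K_1 : 1 <= K by rewrite le_max K11.
pose M := maxmod F r1; pose MG := maxmod G r1.
have Mm x y : x <= y -> M x <= M y by exact: maxmod_mono.
have MGm x y : x <= y -> MG x <= MG y by exact: maxmod_mono.
have [y1 Hy1] := growth_power r10 dF npf 1.
have [y2 Hy2] := growth_double r10 dF npf (256 * K).
have [theta [th1 thr thy1 thy2 [thx1 thx2]]] : exists theta : R,
    [/\ 1 <= theta, r1 <= theta, y1 <= theta, y2 <= theta &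
        64 * `|x1| <= theta /\ 64 * `|x2| <= theta].
  exists (1 + r1 + `|y1| + `|y2| + 64 * `|x1| + 64 * `|x2|).
  have := ler_norm y1; have := ler_norm y2; have := normr_ge0 y1; have := normr_ge0 y2.
  have := normr_ge0 x1; have := normr_ge0 x2; move: r10; clear.
  by move=> *; split; try split; lra.
have th0 : 0 < theta by exact: lt_le_trans ltr01 th1.
have M_ge y : theta <= y -> y <= M y.
  by move=> ty; rewrite -[X in X <= _]expr1 ltW// Hy1// (le_trans thy1).
have M_double y : theta <= y -> 256 * K * M y <= M (2 * y).
  by move=> ty; rewrite ltW// Hy2// (le_trans thy2).
have big_scale (x0 y : R) : 64 * `|x0| <= theta -> theta <= y -> x0 <= y / 64.
  move=> h1 h2; apply: le_trans (ler_norm x0) _.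
  by rewrite ler_pdivlMr// mulrC (le_trans h1).
have MK (k x : R) : 1 <= k -> k <= K -> M x / K <= M x / k.
  move=> k1 kK; rewrite ler_wpM2l ?maxmod_ge0// lef_pV2 ?posrE//.
    exact: lt_le_trans ltr01 K_1.
  exact: lt_le_trans ltr01 k1.
have comm_growth y : theta <= y -> MG (M (y / 64) / K) <= 2 * M (MG y).
  move=> ty; apply: le_trans (_ : MG (M (y / 64) / K2) <= _).
    by apply: MGm; apply: MK => //; rewrite le_max lexx orbT.
  have := Hx2 (y / 64) (big_scale _ _ thx2 ty).
  by rewrite (_ : 64 * (y / 64) = y); [|field].
(* A point of E_(n+1) of smaller modulus would let E_(n+1) cross the covering annulus. This gives
   [a] with |a| <= d / 8 and f a in E_(n+1); by the condition on preimages [a] is in E_n, where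
   moduli are at least d, or in |w| < r, which |a| >= r1 excludes. *)
have outer_step n d : (1 <= n)%N -> theta <= d ->
    (forall a, outer_set (gamma n) a -> d <= cmod a) ->
    forall a, outer_set (gamma n.+1) a -> M (d / 64) / K <= cmod a.
  move=> n1 td free e Ee; rewrite leNgt; apply/negP => elt.
  have d0 : 0 < d by exact: lt_le_trans th0 td.
  have elt' : cmod e < M (d / 64) / K1 by apply: lt_le_trans elt _; apply: MK; rewrite // le_max lexx.
  have [|a /andP[ra ad] Ea] := Hx1 (d / 64) (big_scale _ _ thx1 td) (outer_set (gamma n.+1)) (@closed_closure _ _).
    by move=> s /andP[s1 _]; exact: outer_moduli Ee elt' s s1.
  have Pa : (f @^-1` (Some @` outer_set (gamma n.+1))) a by exists (F a); rewrite ?fE.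
  case: (preimage n n1 a Pa) => sub; have := sub a (connected_component_refl Pa).
    by move=> /free; move: ad d0; lra.
  by move=> /= /lt_le_trans /(_ rr1); rewrite ltNge ra.
have outer_fwd n a : (1 <= n)%N -> r1 <= cmod a -> ~ outer_set (gamma n) a ->
    ~ outer_set (gamma n.+1) (F a).
  move=> n1 ra nE EF.
  have Pa : (f @^-1` (Some @` outer_set (gamma n.+1))) a by exists (F a); rewrite ?fE.
  case: (preimage n n1 a Pa) => sub; have := sub a (connected_component_refl Pa); first by [].
  by move=> /= /lt_le_trans /(_ rr1); rewrite ltNge ra.
have free_eventually d : exists N, forall n, (N <= n)%N -> (1 <= n)%N ->
    forall a, outer_set (gamma n) a -> d <= cmod a.
  have [N HN] := dist0_eventually dist (Num.max d (r + 1)).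
  exists N => n nN n1 a Ea; apply: le_trans (_ : Num.max d (r + 1) <= _); first by rewrite le_max lexx.
  apply: (outer_away r_gt0 _ (sur n n1)) Ea; first by rewrite lt_max ltrDl ltr01 orbT.
  by move=> b; exact: HN.
have [n0' Hn0'] := dist0_eventually dist r1.
pose n0 := n0'.+1.
have gr1 n a : (n0 <= n)%N -> gamma n a -> r1 <= cmod a by move=> nn; apply: Hn0'; exact: ltnW.
have [D1 HD1] := jordan_curve_bounded (jordan n0 isT).
pose D := Num.max D1 theta.
have thD : theta <= D by rewrite le_max lexx orbT.
pose H y := 2 * M y.
(* A point of the next curve is the image of a point of the current one, where the maximum modulus
   applies. *)
have gD k a : gamma (n0 + k)%N a -> cmod a <= iter k H D.
  elim: k a => [|k IH] a.
    by rewrite addn0 => /HD1 /le_trans; apply; rewrite le_max lexx.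
  rewrite addnS => ga; have [|b gb fb] := image (n0 + k)%N _ (Some a) (ex_intro2 _ _ a ga erefl).
    by rewrite addn_gt0.
  have rb : r1 <= cmod b by apply: gr1 gb; rewrite leq_addr.
  move: fb; rewrite fE// => -[<-] /=.
  apply: le_trans (_ : M (iter k H D) <= _).
    by apply: maxmod_ge => //; rewrite rb IH.
  by rewrite /H ler_peMl ?maxmod_ge0// ler1n.
pose Z := Num.max theta (MG (128 * D)).
have thZ : theta <= Z by rewrite le_max lexx.
have [N1 HN1] := free_eventually (128 * Z).
have [B0 HB0] : exists B0, forall n, (B0 <= n)%N -> r1 <= cmod (u n).
  have nb : at_infty [set a : R[i] | r1 <= cmod a] by exists r1 => a; exact: ltW.
  by have [N _ HN] := uinf _ nb; exists N => n /HN.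
(* From [n1] on the outer sets lie beyond 128 Z; being at least [n0 + B0], it also makes the shift
   [j] at least [B0], so that the part of the orbit in use avoids |z| < r1. *)
pose n1 := (maxn N1 (n0 + B0)).
have n1n0 : (n0 + B0 <= n1)%N by rewrite leq_maxr.
have n1N1 : (N1 <= n1)%N by rewrite leq_maxl.
pose j := (n1 - n0)%N.
have jB : (B0 <= j)%N by rewrite /j leq_subRL// (leq_trans (leq_addr _ _) n1n0).
apply: contrapT => nfast.
(* [l + j] is tried as the shift for z. Its failure at one index suffices, since the complements of
   the outer sets are carried forward along the orbit. *)
have [n [n_1 nE]] : exists n, (1 <= n)%N /\ ~ outer_set (gamma n) (u (n + (l + j))%N).
  apply: contrapT => no; apply: nfast; exists (l + j)%N; split; first by rewrite addn_gt0 l1.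
  move=> n n_1; exists (u (n + (l + j))%N); first exact: Hu.
  by apply: contrapT => nE; apply: no; exists n.
have ru m : (j <= m)%N -> r1 <= cmod (u m) by move=> jm; apply: HB0; exact: leq_trans jB jm.
have nEk k : ~ outer_set (gamma (n + k)%N) (u (n + k + (l + j))%N).
  elim: k => [|k IH]; first by rewrite addn0.
  have ruk : r1 <= cmod (u (n + k + (l + j))%N) by apply: ru; rewrite addnA leq_addl.
  have nk : (1 <= n + k)%N by rewrite addn_gt0 n_1.
  have uE : u (n + k + (l + j)).+1%N = F (u (n + k + (l + j))%N).
    by have := uS (n + k + (l + j))%N; rewrite fE// => -[].
  by rewrite addnS addSn uE; exact: outer_fwd.
(* [m] is read in two ways. As (n + n0) + (l + j) it puts u m outside E_(n + n0), hence within the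
   size of that curve; as (n1 + n) + l it puts g (u m) into E_(n1 + n). *)
have := nEk n0; set m := (n + n0 + (l + j))%N => nEm.
have rum : r1 <= cmod (u m) by apply: ru; rewrite /m addnA leq_addl.
have uD : cmod (u m) <= iter n H D.
  rewrite leNgt; apply/negP => lt; apply: nEm; apply: exterior_outer lt => a ga.
  by apply: gD; rewrite addnC.
have n1_gt0 : (0 < n1)%N by rewrite (leq_trans _ n1n0).
have free k : forall a, outer_set (gamma (n1 + k)%N) a ->
    iter k (fun y => M (y / 64) / K) (128 * Z) <= cmod a.
  elim: k => [|k IH]; first by rewrite addn0 => a; exact: HN1.
  have big := iteration_large K_1 Mm th0 M_ge M_double k thZ.
  by rewrite addnS; apply: (outer_step _ _ _ big IH); rewrite addn_gt0 n1_gt0.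
have mE : m = (n1 + n + l)%N.
  by rewrite /m /j; move: n1n0; clear; lia.
have [|y Hy Ey] := fast (n1 + n)%N; first by rewrite addn_gt0 n1_gt0.
have yE : y = G (u m).
  have : Some (Some y) = Some (g (u m)) by rewrite -Hy Gu mE.
  by rewrite (gE _ rum) => -[].
have rumD : r1 <= cmod (u m) <= iter n H D by rewrite rum uD.
have Gm : cmod (G (u m)) <= MG (iter n H D) := maxmod_ge r10 dG rumD.
have DZ : MG (128 * D) <= Z by rewrite /Z le_max lexx orbT.
(* |G (u m)| is at least Phi^n (128 Z) and at most MG (H^n D), in contradiction to this strict
   inequality. *)
have lt1 := iteration_growth K_1 Mm MGm th0 M_ge M_double comm_growth n thD thZ DZ.
have := le_trans (free n _ Ey) _; rewrite yE => /(_ _ Gm).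
by rewrite leNgt lt1.
Qed.
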